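(* Let $\beta>0$ and let $a,b\in C^\infty(\mathbb T;\mathbb R)$ satisfy $a,b\ge0$, $a\not\equiv0$, $b\not\equiv0$. The operator $\mathcal A_d=\mathcal A-\mathcal D$ generates a strongly continuous semigroup $\{S_d(t)\}_{t\ge0}$ on $\mathcal H$. Consequently, for every $Z_0\in\mathcal H$, the system $Z_t=\mathcal A_dZ$, $Z(0)=Z_0$, admits a unique mild solution $Z(t)=S_d(t)Z_0\in C([0,\infty);\mathcal H)$. If, in addition, $Z_0\in D(\mathcal A_d)=D(\mathcal A)$, then $Z\in C([0,\infty);D(\mathcal A_d))\cap C^1([0,\infty);\mathcal H)$, and $Z$ is the unique classical solution of this system.
   Context: $\mathbb T=\mathbb R/(2\pi\mathbb Z)$; functions are complex valued. Fourier convention: $\widehat v(k)=\frac1{2\pi}\int_{\mathbb T}v(x)e^{-ikx}dx$, $k\in\mathbb Z$. $\langle k\rangle=(1+k^2)^{1/2}$ and $\|v\|_{H^s}^2=2\pi\sum_k\langle k\rangle^{2s}|\widehat v(k)|^2$. Fourier multipliers: $\widehat{T_\beta v}(k)=-im_\beta(k)\widehat v(k)$ with $m_\beta(k)=\tanh(\beta k)/\beta$; $\widehat{P_\beta v}(k)=p_\beta(k)\widehat v(k)$ with $p_\beta(k)=\frac{\tanh(\beta k)}{\beta k}$ for $k\ne0$ and $p_\beta(0)=1$. Energy space: $\mathcal H=L^2(\mathbb T)\times H^{-1/2}(\mathbb T)$ with inner product $\langle(h,u),(\varphi,\psi)\rangle_{\mathcal H}=\langle h,\varphi\rangle_{L^2}+\langle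 P_\beta u,\psi\rangle_{H^{1/2},H^{-1/2}}=2\pi\sum_k\widehat h(k)\overline{\widehat\varphi(k)}+2\pi\sum_kp_\beta(k)\widehat u(k)\overline{\widehat\psi(k)}$. Operators: $\mathcal A(h,u)=(T_\beta u,-h_x)$ with domain $D(\mathcal A)=H^{1/2}(\mathbb T)\times L^2(\mathbb T)$; damping operator $\mathcal D(h,u)=(a^2h,\,b^2P_\beta u)$ on $\mathcal H$; $\mathcal A_d=\mathcal A-\mathcal D$ with $D(\mathcal A_d)=D(\mathcal A)$ (equipped with the graph norm). *)

(* Defs.v *)
From Stdlib Require Import Reals Lra Lia Psatz ZArith.
From Stdlib Require Import FunctionalExtensionality ProofIrrelevance.
From Coquelicot Require Import Coquelicot.
Open Scope R_scope.

(* C^infty(T; R): functions on T = R / 2 pi Z are 2 pi-periodic functions on R. *)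
Record smoothT : Type := MkSmoothT {
  sfun :> R -> R;
  sfun_smooth : forall (n : nat) (x : R), ex_derive_n sfun n x;
  sfun_periodic : forall x : R, sfun (x + 2 * PI) = sfun x }.

Lemma smoothT_ext (f g : smoothT) : (forall x, f x = g x) -> f = g.
Proof.
destruct f as [f p q], g as [g p' q']; simpl; intros H.
assert (E : f = g) by (apply functional_extensionality; exact H).
subst g. f_equal; apply proof_irrelevance.
Qed.

Lemma Derive_n_S_comm f n x : Derive_n (Derive f) n x = Derive_n f (S n) x.
Proof.
change (Derive f) with (Derive_n f 1). rewrite Derive_n_comp.
now replace (n + 1)%nat with (S n) by lia.
Qed.

Lemma locally_all (P : R -> Prop) x : (forall y, P y) -> locally x P.
Proof. intros H; exists (mkposreal 1 Rlt_0_1); auto. Qed.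

Lemma smooth_Derive f :
  (forall n x, ex_derive_n f n x) -> forall n x, ex_derive_n (Derive f) n x.
Proof.
intros H [|n] x; [exact I|]. simpl.
apply ex_derive_ext with (Derive_n f (S n)).
intros t; symmetry; apply Derive_n_S_comm. exact (H (S (S n)) x).
Qed.

Lemma ex_derive_n_of_Derive (h h' : R -> R) n :
  (forall x, is_derive h x (h' x)) -> (forall x, ex_derive_n h' n x) ->
  forall x, ex_derive_n h (S n) x.
Proof.
intros H H' x. assert (E : forall y, Derive h y = h' y) by
 (intros y; apply is_derive_unique, H).
destruct n as [|n]; simpl.
- exists (h' x); apply H.
- apply ex_derive_ext with (Derive_n h' n).
  + intros t. change (Derive (Derive_n h n) t) with (Derive_n h (S n) t).
    rewrite <- Derive_n_S_comm. apply Derive_n_ext; intros; symmetry; apply E.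
  + exact (H' x).
Qed.

Lemma smooth_ex_derive (f : R -> R) x :
  (forall n x, ex_derive_n f n x) -> ex_derive f x.
Proof. intros H; exact (H 1%nat x). Qed.

Lemma smooth_mult f g :
  (forall n x, ex_derive_n f n x) -> (forall n x, ex_derive_n g n x) ->
  forall n x, ex_derive_n (fun y => f y * g y) n x.
Proof.
intros Hf Hg n. revert f g Hf Hg.
cut (forall k, (k <= n)%nat -> forall f g,
 (forall n x, ex_derive_n f n x) -> (forall n x, ex_derive_n g n x) ->
  forall x, ex_derive_n (fun y => f y * g y) k x).
{ intros H f g Hf Hg; apply H; auto. }
induction n as [|n IH]; intros k Hk f g Hf Hg x.
- replace k with 0%nat by lia. exact I.
- destruct k as [|k]; [exact I|].
  apply ex_derive_n_of_Derive with
   (fun y => Derive f y * g y + f y * Derive g y).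
  + intros y. apply (is_derive_mult f g y (Derive f y) (Derive g y)).
    * apply Derive_correct, smooth_ex_derive, Hf.
    * apply Derive_correct, smooth_ex_derive, Hg.
    * intros; apply Rmult_comm.
  + intros y. apply ex_derive_n_plus; apply locally_all; intros z j Hj;
    apply IH; try lia; auto; now apply smooth_Derive.
Qed.

Definition s_const (c : R) : smoothT.
Proof.
refine (MkSmoothT (fun _ => c) _ _); intros.
apply ex_derive_n_const. reflexivity.
Defined.

Definition s_plus (f g : smoothT) : smoothT.
Proof.
refine (MkSmoothT (fun x => f x + g x) _ _); intros.
- apply ex_derive_n_plus; apply locally_all; intros; apply sfun_smooth.
- now rewrite !sfun_periodic.
Defined.

Definition s_opp (f : smoothT) : smoothT.
Proof.
refine (MkSmoothT (fun x => - f x) _ _); intros.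
- apply ex_derive_n_opp; apply sfun_smooth.
- now rewrite !sfun_periodic.
Defined.

Definition s_mult (f g : smoothT) : smoothT.
Proof.
refine (MkSmoothT (fun x => f x * g x) _ _); intros.
- apply smooth_mult; apply sfun_smooth.
- now rewrite !sfun_periodic.
Defined.

Definition s_deriv (f : smoothT) : smoothT.
Proof.
refine (MkSmoothT (fun x => Derive f x) _ _); intros.
- apply smooth_Derive, sfun_smooth.
- change (Derive f) with (Derive_n f 1).
  rewrite <- (Derive_n_comp_trans f 1 x (2*PI)).
  apply Derive_n_ext; intros; apply sfun_periodic.
Defined.

Lemma smooth_trig k : 
  (forall n x, ex_derive_n (fun y => cos (k * y)) n x) /\
  (forall n x, ex_derive_n (fun y => sin (k * y)) n x).
Proof.
cut (forall n, (forall x, ex_derive_n (fun y => cos (k * y)) n x) /\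
  (forall x, ex_derive_n (fun y => sin (k * y)) n x)).
{ intros H; split; intros n; apply H. }
induction n as [|n [IHc IHs]]; [split; intros; exact I|].
split; intros x.
- apply ex_derive_n_of_Derive with (fun y => (-k) * sin (k * y)).
  + intros y; auto_derive; auto; ring.
  + intros; apply ex_derive_n_scal_l, IHs.
- apply ex_derive_n_of_Derive with (fun y => k * cos (k * y)).
  + intros y; auto_derive; auto; ring.
  + intros; apply ex_derive_n_scal_l, IHc.
Qed.

Lemma cos_period_Z x (m : Z) : cos (x + 2 * IZR m * PI) = cos x.
Proof.
destruct (Z_le_dec 0 m) as [H|H].
- rewrite <- (Z2Nat.id m) by easy. rewrite <- INR_IZR_INZ. apply cos_period.
- rewrite <- (cos_period (x + 2 * IZR m * PI) (Z.to_nat (-m))).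
  rewrite INR_IZR_INZ, Z2Nat.id by lia. f_equal. rewrite opp_IZR. ring.
Qed.

Lemma sin_period_Z x (m : Z) : sin (x + 2 * IZR m * PI) = sin x.
Proof.
destruct (Z_le_dec 0 m) as [H|H].
- rewrite <- (Z2Nat.id m) by easy. rewrite <- INR_IZR_INZ. apply sin_period.
- rewrite <- (sin_period (x + 2 * IZR m * PI) (Z.to_nat (-m))).
  rewrite INR_IZR_INZ, Z2Nat.id by lia. f_equal. rewrite opp_IZR. ring.
Qed.

Definition s_cos (k : Z) : smoothT.
Proof.
refine (MkSmoothT (fun x => cos (IZR k * x)) _ _); intros.
- apply (proj1 (smooth_trig (IZR k))).
- replace (IZR k * (x + 2 * PI)) with (IZR k * x + 2 * IZR k * PI) by ring.
  apply cos_period_Z.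
Defined.

Definition s_sin (k : Z) : smoothT.
Proof.
refine (MkSmoothT (fun x => sin (IZR k * x)) _ _); intros.
- apply (proj2 (smooth_trig (IZR k))).
- replace (IZR k * (x + 2 * PI)) with (IZR k * x + 2 * IZR k * PI) by ring.
  apply sin_period_Z.
Defined.

Lemma s_periodic_Z (f : smoothT) x (m : Z) : f (x + 2 * IZR m * PI) = f x.
Proof.
assert (P : forall n y, f (y + 2 * INR n * PI) = f y).
{ induction n; intros y. simpl; f_equal; ring.
  rewrite S_INR. replace (y + 2 * (INR n + 1) * PI) with
   ((y + 2 * INR n * PI) + 2 * PI) by ring. rewrite sfun_periodic; auto. }
destruct (Z_le_dec 0 m) as [H|H].
- rewrite <- (Z2Nat.id m) by easy. rewrite <- INR_IZR_INZ. apply P.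
- rewrite <- (P (Z.to_nat (-m)) (x + 2 * IZR m * PI)).
  rewrite INR_IZR_INZ, Z2Nat.id by lia. f_equal. rewrite opp_IZR. ring.
Qed.

Lemma reduce_2pi x : exists m : Z, Rabs (x + 2 * IZR m * PI) <= PI.
Proof.
assert (Hpi := PI_RGT_0).
destruct (archimed ((x - PI) / (2 * PI))) as [H1 H2].
revert H1 H2. generalize (up ((x - PI) / (2 * PI))); intros u H1 H2.
exists (- u)%Z. rewrite opp_IZR.
assert (E : (x - PI) = ((x - PI) / (2 * PI)) * (2 * PI)) by (field; lra).
revert E H1 H2. generalize ((x - PI) / (2 * PI)); intros q E H1 H2.
apply Rabs_le. split; nra.
Qed.

Lemma s_continuous (f : smoothT) x : continuous f x.
Proof. apply (ex_derive_continuous (V:=R_NormedModule)), (sfun_smooth f 1). Qed.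

Lemma s_bounded (f : smoothT) : exists M, 0 <= M /\ forall x, Rabs (f x) <= M.
Proof.
assert (Hpi := PI_RGT_0).
destruct (continuity_ab_maj (fun x => Rabs (f x)) (-PI) PI) as [z [Hz _]].
lra.
intros c _. apply continuity_pt_filterlim.
apply (continuous_comp f Rabs). apply s_continuous.
apply continuous_Rabs.
exists (Rabs (f z)). split. apply Rabs_pos.
intros x. destruct (reduce_2pi x) as [m Hm].
rewrite <- (s_periodic_Z f x m). apply Hz. now apply Rabs_le_between.
Qed.

Lemma s_Derive_n (f : smoothT) n : exists g : smoothT, forall x, g x = Derive_n f n x.
Proof.
induction n as [|n [g Hg]]. now exists f.
exists (s_deriv g). intros x; simpl. now apply Derive_ext.
Qed.

Lemma s_is_derive (f : smoothT) x : is_derive f x (s_deriv f x).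
Proof. apply Derive_correct, (sfun_smooth f 1). Qed.

Lemma s_mult_bound N : forall a : smoothT, exists K, 0 <= K /\
  forall (f : smoothT) M, (forall n x, (n <= N)%nat -> Rabs (Derive_n f n x) <= M) ->
  forall n x, (n <= N)%nat -> Rabs (Derive_n (s_mult a f) n x) <= K * M.
Proof.
induction N as [|N IH]; intros a.
- destruct (s_bounded a) as [K [HK Ha]]. exists K; split; auto.
  intros f M Hf n x Hn. replace n with 0%nat by lia; simpl.
  rewrite Rabs_mult. apply Rmult_le_compat; try apply Rabs_pos; auto.
  apply (Hf 0%nat x); lia.
- destruct (s_bounded a) as [K0 [HK0 Ha]].
  destruct (IH a) as [K1 [HK1 H1]], (IH (s_deriv a)) as [K2 [HK2 H2]].
  exists (K0 + K1 + K2); split. lra.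
  intros f M Hf n x Hn.
  assert (HM : 0 <= M) by (eapply Rle_trans; [apply Rabs_pos | apply (Hf 0%nat x); lia]).
  destruct n as [|n].
  + simpl. rewrite Rabs_mult. apply Rle_trans with (K0 * M).
    apply Rmult_le_compat; try apply Rabs_pos; auto. apply (Hf 0%nat x); lia.
    nra.
  + rewrite <- Derive_n_S_comm.
    rewrite (Derive_n_ext _ (fun y => (s_mult (s_deriv a) f) y + (s_mult a (s_deriv f)) y)).
    2:{ intros t. apply is_derive_unique.
        apply (is_derive_mult a f t (s_deriv a t) (s_deriv f t)).
        apply s_is_derive. apply s_is_derive. intros; apply Rmult_comm. }
    rewrite Derive_n_plus; try (apply locally_all; intros; apply sfun_smooth).
    eapply Rle_trans. apply Rabs_triang.
    assert (A1 := H2 f M (fun n x h => Hf n x (le_S _ _ h)) n x ltac:(lia)).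
    assert (A2 := fun h => H1 (s_deriv f) M h n x ltac:(lia)).
    assert (Rabs (Derive_n (s_mult a (s_deriv f)) n x) <= K1 * M).
    { apply A2. intros j y Hj. simpl.
      change (fun x0 => Derive f x0) with (Derive f).
      rewrite Derive_n_S_comm. apply Hf; lia. }
    nra.
Qed.

(* C^infty(T; C) = C^infty(T; R) + i C^infty(T; R), the test functions. *)
Record testT : Type := MkTest { t_re : smoothT; t_im : smoothT }.
Definition teval (phi : testT) (x : R) : C := (t_re phi x, t_im phi x).
Coercion teval : testT >-> Funclass.

Lemma testT_ext (f g : testT) : (forall x, f x = g x) -> f = g.
Proof.
destruct f as [f1 f2], g as [g1 g2]; intros H.
f_equal; apply smoothT_ext; intros x; specialize (H x); unfold teval in H;
simpl in H; congruence.
Qed.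

Definition t_const (c : C) : testT := MkTest (s_const (Re c)) (s_const (Im c)).
Definition t_plus (f g : testT) : testT :=
  MkTest (s_plus (t_re f) (t_re g)) (s_plus (t_im f) (t_im g)).
Definition t_mult (f g : testT) : testT :=
  MkTest (s_plus (s_mult (t_re f) (t_re g)) (s_opp (s_mult (t_im f) (t_im g))))
         (s_plus (s_mult (t_re f) (t_im g)) (s_mult (t_im f) (t_re g))).
Definition t_scal (c : C) (f : testT) : testT := t_mult (t_const c) f.
Definition t_smult (a : smoothT) (f : testT) : testT :=
  MkTest (s_mult a (t_re f)) (s_mult a (t_im f)).
Definition t_deriv (f : testT) : testT :=
  MkTest (s_deriv (t_re f)) (s_deriv (t_im f)).
Definition t_exp (k : Z) : testT := MkTest (s_cos k) (s_sin k).

Lemma t_constE c x : t_const c x = c.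
Proof. now destruct c. Qed.
Lemma t_plusE f g x : t_plus f g x = (f x + g x)%C.
Proof. reflexivity. Qed.
Lemma t_multE f g x : t_mult f g x = (f x * g x)%C.
Proof. unfold teval, Cmult; simpl; f_equal; ring. Qed.
Lemma t_scalE c f x : t_scal c f x = (c * f x)%C.
Proof. unfold t_scal; now rewrite t_multE, t_constE. Qed.
Lemma t_smultE a f x : t_smult a f x = (RtoC (a x) * f x)%C.
Proof. unfold teval, Cmult, RtoC; simpl; f_equal; ring. Qed.

#[global] Hint Rewrite t_constE t_plusE t_multE t_scalE t_smultE : tst.

Lemma Derive_plus' (f g : smoothT) x :
  s_deriv (s_plus f g) x = s_deriv f x + s_deriv g x.
Proof. apply is_derive_unique, (is_derive_plus f g); apply s_is_derive. Qed.
Lemma Derive_opp' (f : smoothT) x : s_deriv (s_opp f) x = - s_deriv f x.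
Proof. apply is_derive_unique, (is_derive_opp f); apply s_is_derive. Qed.
Lemma Derive_mult' (f g : smoothT) x :
  s_deriv (s_mult f g) x = s_deriv f x * g x + f x * s_deriv g x.
Proof.
apply is_derive_unique, (is_derive_mult f g); try apply s_is_derive.
intros; apply Rmult_comm.
Qed.
Lemma Derive_const' c x : s_deriv (s_const c) x = 0.
Proof. apply (Derive_const c). Qed.

Lemma t_deriv_plus f g : t_deriv (t_plus f g) = t_plus (t_deriv f) (t_deriv g).
Proof.
apply testT_ext; intros x. unfold teval; cbn [t_re t_im t_deriv t_plus].
now rewrite !Derive_plus'.
Qed.
Lemma t_deriv_mult f g :
  t_deriv (t_mult f g) = t_plus (t_mult (t_deriv f) g) (t_mult f (t_deriv g)).
Proof.
apply testT_ext; intros x. unfold teval; cbn [t_re t_im t_deriv t_plus t_mult].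
rewrite !Derive_plus', Derive_opp', !Derive_mult'. simpl. f_equal; ring.
Qed.
Lemma t_deriv_scal c f : t_deriv (t_scal c f) = t_scal c (t_deriv f).
Proof.
unfold t_scal. rewrite t_deriv_mult. apply testT_ext; intros x.
autorewrite with tst. replace (t_deriv (t_const c) x) with (RtoC 0). ring.
unfold teval; cbn [t_re t_im t_deriv t_const]. now rewrite !Derive_const'.
Qed.
Lemma t_deriv_exp k : t_deriv (t_exp k) = t_scal (Ci * IZR k) (t_exp k).
Proof.
apply testT_ext; intros x. autorewrite with tst.
unfold teval, Ci, Cmult, RtoC; simpl. f_equal; apply is_derive_unique;
auto_derive; auto; ring.
Qed.

Lemma t_exp_add k l x : (t_exp k x * t_exp l x)%C = t_exp (k + l) x.
Proof.
unfold teval, Cmult; simpl. rewrite plus_IZR, Rmult_plus_distr_r, cos_plus, sin_plus.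
f_equal; ring.
Qed.
Lemma t_exp_0 x : t_exp 0 x = RtoC 1.
Proof. unfold teval; simpl. now rewrite Rmult_0_l, cos_0, sin_0. Qed.

Definition t_int (f : testT) : C :=
  (RInt (t_re f) 0 (2 * PI), RInt (t_im f) 0 (2 * PI)).

Lemma s_ex_RInt (f : smoothT) a b : ex_RInt f a b.
Proof. apply (ex_RInt_continuous (V:=R_CompleteNormedModule)); intros; apply s_continuous. Qed.

Lemma t_int_plus f g : t_int (t_plus f g) = (t_int f + t_int g)%C.
Proof.
unfold t_int, Cplus; simpl; f_equal;
apply (RInt_plus (V:=R_CompleteNormedModule)); apply s_ex_RInt.
Qed.

Lemma s_RInt_lin (c d : R) (f g : smoothT) :
  RInt (fun x => c * f x + d * g x) 0 (2*PI) =
  c * RInt f 0 (2*PI) + d * RInt g 0 (2*PI).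
Proof.
rewrite (RInt_plus (V:=R_CompleteNormedModule) (fun x => c * f x) (fun x => d * g x)).
- rewrite (RInt_scal (V:=R_CompleteNormedModule) f), (RInt_scal (V:=R_CompleteNormedModule) g).
  reflexivity. apply s_ex_RInt. apply s_ex_RInt.
- apply (s_ex_RInt (s_mult (s_const c) f)).
- apply (s_ex_RInt (s_mult (s_const d) g)).
Qed.

Lemma t_int_scal c f : t_int (t_scal c f) = (c * t_int f)%C.
Proof.
unfold t_int, Cmult. destruct c as [c d]; cbn [fst snd]. f_equal.
- replace (c * RInt (t_re f) 0 (2*PI) - d * RInt (t_im f) 0 (2 * PI)) with
  (c * RInt (t_re f) 0 (2*PI) + (-d) * RInt (t_im f) 0 (2 * PI)) by ring.
  rewrite <- s_RInt_lin. apply RInt_ext; intros; simpl. ring.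
- rewrite <- s_RInt_lin. apply RInt_ext; intros; simpl. ring.
Qed.

Lemma t_int_deriv f : t_int (t_deriv f) = RtoC 0.
Proof.
assert (H : forall g : smoothT, RInt (s_deriv g) 0 (2 * PI) = 0).
{ intros g. rewrite (is_RInt_unique _ _ _ (minus (g (2*PI)) (g 0))).
  unfold minus, plus, opp; simpl. rewrite <- (sfun_periodic g 0), Rplus_0_l. ring.
  apply (is_RInt_derive (V:=R_CompleteNormedModule)); intros.
  apply s_is_derive. apply s_continuous. }
unfold t_int; cbn [t_re t_im t_deriv]. now rewrite !H.
Qed.

Lemma Cmod_le_sum (z : C) : Cmod z <= Rabs (fst z) + Rabs (snd z).
Proof.
destruct z as [x y]; cbn [fst snd].
assert (E : (x, y) = (RtoC x + Ci * RtoC y)%C).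
{ unfold Cplus, Cmult, Ci, RtoC; simpl; f_equal; ring. }
rewrite E. eapply Rle_trans. apply Cmod_triangle.
rewrite Cmod_mult, Cmod_Ci, !Cmod_R. lra.
Qed.

Lemma s_RInt_bound (f : smoothT) M : (forall x, Rabs (f x) <= M) ->
  Rabs (RInt f 0 (2 * PI)) <= 2 * PI * M.
Proof.
assert (Hpi := PI_RGT_0). intros H.
replace (2 * PI * M) with ((2*PI - 0) * M) by ring.
apply abs_RInt_le_const; auto. lra. apply s_ex_RInt.
Qed.

(* (1 / 2 pi) int_0^{2 pi} f(x) e^{-ikx} dx *)
Definition t_coef (f : testT) (k : Z) : C :=
  (/ RtoC (2 * PI) * t_int (t_mult f (t_exp (- k))))%C.

Lemma RtoC_2PI_neq : RtoC (2 * PI) <> 0.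
Proof. assert (H := PI_RGT_0). intros E; apply RtoC_inj in E; lra. Qed.

Lemma t_coef_deriv f k : t_coef (t_deriv f) k = (Ci * IZR k * t_coef f k)%C.
Proof.
unfold t_coef. set (e := t_exp (-k)).
assert (H := t_int_deriv (t_mult f e)).
rewrite t_deriv_mult, t_int_plus in H. unfold e in H at 2. rewrite t_deriv_exp in H.
replace (t_mult f (t_scal (Ci * (IZR (-k))) (t_exp (-k)))) with
  (t_scal (Ci * IZR (-k)) (t_mult f e)) in H.
2:{ apply testT_ext; intros; autorewrite with tst. fold e. ring. }
rewrite t_int_scal, opp_IZR, RtoC_opp in H.
assert (E : (t_int (t_mult (t_deriv f) e) = Ci * IZR k * t_int (t_mult f e))%C).
{ replace (Ci * IZR k * t_int (t_mult f e))%C with (RtoC 0 + Ci * IZR k * t_int (t_mult f e))%C by ring.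
  rewrite <- H. ring. }
rewrite E. ring.
Qed.

Lemma t_coef_plus f g k : t_coef (t_plus f g) k = (t_coef f k + t_coef g k)%C.
Proof.
unfold t_coef. rewrite <- Cmult_plus_distr_l, <- t_int_plus. do 2 f_equal.
apply testT_ext; intros; autorewrite with tst; ring.
Qed.
Lemma t_coef_scal c f k : t_coef (t_scal c f) k = (c * t_coef f k)%C.
Proof.
unfold t_coef. replace (t_mult (t_scal c f) (t_exp (- k))) with
 (t_scal c (t_mult f (t_exp (- k)))). rewrite t_int_scal; ring.
apply testT_ext; intros; autorewrite with tst; ring.
Qed.

Lemma t_int_exp k : t_int (t_exp k) = if Z.eq_dec k 0 then RtoC (2*PI) else RtoC 0.
Proof.
destruct Z.eq_dec as [->|n].
- replace (t_exp 0) with (t_const 1).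
  unfold t_int; simpl. rewrite !(RInt_const (V:=R_CompleteNormedModule)).
  unfold scal, RtoC; simpl; unfold mult; simpl. f_equal; ring.
  apply testT_ext; intros; now rewrite t_exp_0, t_constE.
- assert (N : (Ci * IZR k)%C <> 0).
  { apply Cmult_neq_0. intros E; injection E; lra.
    intros E; apply RtoC_inj in E. now apply eq_IZR in E. }
  replace (t_exp k) with (t_deriv (t_scal (/ (Ci * IZR k)) (t_exp k))).
  apply t_int_deriv. rewrite t_deriv_scal, t_deriv_exp.
  apply testT_ext; intros; autorewrite with tst. field. 
  split. intros E; apply RtoC_inj in E; now apply eq_IZR in E.
  intros E; injection E; lra.
Qed.

Lemma t_coef_exp k l : t_coef (t_exp k) l = if Z.eq_dec k l then RtoC 1 else RtoC 0.
Proof.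
unfold t_coef. replace (t_mult (t_exp k) (t_exp (-l))) with (t_exp (k - l)).
2:{ apply testT_ext; intros; autorewrite with tst; now rewrite t_exp_add. }
rewrite t_int_exp. destruct Z.eq_dec, Z.eq_dec; try lia.
- field. apply RtoC_2PI_neq.
- ring.
Qed.

(* M bounds the derivatives of f up to order N: the seminorms that define the
   topology of C^infty(T; C). *)
Definition t_bounded (N : nat) (M : R) (f : testT) : Prop :=
  forall (n : nat) (x : R), (n <= N)%nat ->
  Rabs (Derive_n (t_re f) n x) <= M /\ Rabs (Derive_n (t_im f) n x) <= M.

Lemma t_bounded_deriv N M f : t_bounded (S N) M f -> t_bounded N M (t_deriv f).
Proof.
intros H n x Hn. simpl.
change (fun x => Derive (t_re f) x) with (Derive (t_re f)).
change (fun x => Derive (t_im f) x) with (Derive (t_im f)).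
rewrite !Derive_n_S_comm. apply H; lia.
Qed.

Lemma t_bounded_smult N a : exists K, 0 <= K /\ forall f M,
  t_bounded N M f -> t_bounded N (K * M) (t_smult a f).
Proof.
destruct (s_mult_bound N a) as [K [HK H]]. exists K; split; auto.
intros f M Hf n x Hn; simpl; split; apply H; auto; intros; now apply Hf.
Qed.

Lemma t_bounded_pos N M f : t_bounded N M f -> 0 <= M.
Proof.
intros H. destruct (H 0%nat 0) as [A _]. lia.
eapply Rle_trans; [apply Rabs_pos | exact A].
Qed.

Lemma t_coef_bound M f k : t_bounded 0 M f -> Cmod (t_coef f k) <= 4 * M.
Proof.
intros H. assert (HM := t_bounded_pos _ _ _ H).
assert (Hpi := PI_RGT_0).
unfold t_coef. rewrite Cmod_mult, Cmod_inv by apply RtoC_2PI_neq.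
rewrite Cmod_R, Rabs_pos_eq by lra.
assert (B : forall x, Rabs (t_re f x) <= M /\ Rabs (t_im f x) <= M).
{ intros x; apply (H 0%nat x); lia. }
set (g := t_mult f (t_exp (-k))).
assert (G : forall x, Rabs (t_re g x) <= 2 * M /\ Rabs (t_im g x) <= 2 * M).
{ intros x. destruct (B x) as [B1 B2].
  assert (S1 := SIN_bound (IZR (-k) * x)). assert (S2 := COS_bound (IZR (-k) * x)).
  assert (P : forall u v, Rabs u <= M -> -1 <= v <= 1 -> Rabs (u * v) <= M).
  { intros u v Hu Hv. rewrite Rabs_mult. rewrite <- (Rmult_1_r M).
    apply Rmult_le_compat; try apply Rabs_pos; auto. now apply Rabs_le. }
  simpl; split; (eapply Rle_trans; [apply Rabs_triang|]); rewrite ?Rabs_Ropp;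
  match goal with |- Rabs ?a + Rabs ?b <= _ =>
   assert (Rabs a <= M) by auto; assert (Rabs b <= M) by auto end; lra. }
assert (Cmod (t_int g) <= 2 * PI * (4 * M)).
{ eapply Rle_trans. apply Cmod_le_sum. unfold t_int; cbn [fst snd].
  assert (A1 := s_RInt_bound (t_re g) (2*M) (fun x => proj1 (G x))).
  assert (A2 := s_RInt_bound (t_im g) (2*M) (fun x => proj2 (G x))). lra. }
apply Rmult_le_reg_l with (2 * PI). lra.
rewrite <- Rmult_assoc, Rinv_r, Rmult_1_l by lra. auto.
Qed.

Lemma t_coef_bound_n n : forall M f k, t_bounded n M f ->
  Rabs (IZR k) ^ n * Cmod (t_coef f k) <= 4 * M.
Proof.
induction n as [|n IH]; intros M f k H; simpl.
- rewrite Rmult_1_l. now apply t_coef_bound.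
- replace (Rabs (IZR k) * Rabs (IZR k) ^ n * Cmod (t_coef f k)) with
   (Rabs (IZR k) ^ n * Cmod (t_coef (t_deriv f) k)).
  apply IH. now apply t_bounded_deriv.
  rewrite t_coef_deriv, !Cmod_mult, Cmod_Ci, Cmod_R. ring.
Qed.

Lemma t_bounded_le n m M f : (n <= m)%nat -> t_bounded m M f -> t_bounded n M f.
Proof. intros L H j x Hj; apply H; lia. Qed.

Lemma t_coef_decay n M f k : t_bounded n M f ->
  (Rabs (IZR k) + 1) ^ n * Cmod (t_coef f k) <= 2 ^ n * 8 * M.
Proof.
intros H. assert (HM := t_bounded_pos _ _ _ H).
assert (A0 := t_coef_bound M f k (t_bounded_le 0 n M f ltac:(lia) H)).
assert (A1 := t_coef_bound_n n M f k H).
assert (Q : (Rabs (IZR k) + 1) ^ n <= 2 ^ n * (1 + Rabs (IZR k) ^ n)).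
{ assert (P2 : 1 <= 2 ^ n) by (apply pow_R1_Rle; lra).
  assert (Pk : 0 <= Rabs (IZR k) ^ n) by (apply pow_le, Rabs_pos).
  destruct (Z.eq_dec k 0) as [->|nz].
  - rewrite Rabs_R0, Rplus_0_l, pow1 in *. nra.
  - assert (1 <= Rabs (IZR k)).
    { rewrite <- abs_IZR. apply IZR_le. lia. }
    apply Rle_trans with ((2 * Rabs (IZR k)) ^ n).
    apply pow_incr; lra. rewrite Rpow_mult_distr. nra. }
assert (0 <= Cmod (t_coef f k)) by apply Cmod_ge_0.
assert (0 < 2 ^ n) by (apply pow_lt; lra).
apply Rle_trans with (2 ^ n * (1 + Rabs (IZR k) ^ n) * Cmod (t_coef f k)).
now apply Rmult_le_compat_r.
replace (2 ^ n * 8 * M) with (2 ^ n * (4 * M + 4 * M)) by ring.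
rewrite Rmult_assoc. apply Rmult_le_compat_l; lra.
Qed.

Fixpoint t_sum (n : nat) (f : nat -> testT) : testT :=
  match n with O => t_const 0 | S n => t_plus (t_sum n f) (f n) end.
Fixpoint c_sum (n : nat) (f : nat -> C) : C :=
  match n with O => 0 | S n => c_sum n f + f n end%C.

Lemma t_sumE n f x : t_sum n f x = c_sum n (fun j => f j x).
Proof. induction n; simpl; autorewrite with tst; [reflexivity | now rewrite IHn]. Qed.
Lemma c_sum_ext n f g : (forall j, (j < n)%nat -> f j = g j) -> c_sum n f = c_sum n g.
Proof.
induction n; intros H; simpl; auto. rewrite IHn, H; auto.
Qed.
Lemma c_sum_scal n c f : c_sum n (fun j => c * f j)%C = (c * c_sum n f)%C.
Proof. induction n; simpl; [|rewrite IHn]; ring. Qed.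
Lemma c_sum_conj n f : Cconj (c_sum n f) = c_sum n (fun j => Cconj (f j)).
Proof.
induction n; simpl. unfold Cconj, RtoC; simpl; f_equal; ring.
now rewrite Cplus_conj, IHn.
Qed.
Lemma c_sum_one n f j : (j < n)%nat -> (forall l, l <> j -> f l = RtoC 0) ->
  c_sum n f = f j.
Proof.
intros Hj H. assert (Z0 : forall m, (m <= j)%nat -> c_sum m f = RtoC 0).
{ induction m; intros; simpl; auto. rewrite IHm, H by lia. ring. }
induction n; [lia|]; simpl. destruct (Nat.eq_dec j n) as [->|].
- rewrite Z0 by lia. ring.
- rewrite IHn, (H n) by lia. ring.
Qed.
Lemma c_sum_const n c : c_sum n (fun _ => c) = (RtoC (INR n) * c)%C.
Proof.
induction n; cbn [c_sum]. simpl; ring. rewrite IHn, S_INR, RtoC_plus. ring.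
Qed.

Lemma t_mult_comm f g : t_mult f g = t_mult g f.
Proof. apply testT_ext; intros; autorewrite with tst; ring. Qed.
Lemma t_mult_plus_r f g h : t_mult f (t_plus g h) = t_plus (t_mult f g) (t_mult f h).
Proof. apply testT_ext; intros; autorewrite with tst; ring. Qed.
Lemma t_mult_scal_r c f g : t_mult f (t_scal c g) = t_scal c (t_mult f g).
Proof. apply testT_ext; intros; autorewrite with tst; ring. Qed.

Lemma t_int_mult_sum phi n f :
  t_int (t_mult phi (t_sum n f)) = c_sum n (fun j => t_int (t_mult phi (f j))).
Proof.
induction n; cbn [t_sum c_sum].
- replace (t_mult phi (t_const 0)) with (t_scal 0 phi).
  rewrite t_int_scal; ring.
  apply testT_ext; intros; autorewrite with tst; ring.
- now rewrite t_mult_plus_r, t_int_plus, IHn.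
Qed.

Definition zdiff (j l : nat) : Z := (Z.of_nat j - Z.of_nat l)%Z.

(* The Fejer means of phi converge to it in C^infty (t_fejer_cv), so a
   distribution is determined by its Fourier coefficients (coef_eq0); the energy
   norm needs this to be a norm. *)
Definition t_fejer (N : nat) (phi : testT) : testT :=
  t_scal (/ RtoC (INR N)) (t_sum N (fun j => t_sum N (fun l =>
    t_scal (t_coef phi (zdiff j l)) (t_exp (zdiff j l))))).

Definition t_kernel (N : nat) (x : R) : testT :=
  t_scal (/ RtoC (INR N)) (t_sum N (fun j => t_sum N (fun l =>
    t_scal (t_exp (zdiff j l) x) (t_exp (- zdiff j l))))).

Lemma t_fejer_kernel N phi x :
  t_fejer N phi x = (/ RtoC (2 * PI) * t_int (t_mult phi (t_kernel N x)))%C.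
Proof.
unfold t_fejer, t_kernel. rewrite t_scalE, t_sumE, t_mult_scal_r, t_int_scal.
rewrite t_int_mult_sum.
rewrite (c_sum_ext N (fun j => t_sum N _ x) (fun j => / RtoC (2 * PI) *
  t_int (t_mult phi (t_sum N (fun l => t_scal (t_exp (zdiff j l) x) (t_exp (- zdiff j l))))))%C).
rewrite c_sum_scal; ring.
intros j _. rewrite t_sumE, t_int_mult_sum, <- c_sum_scal.
apply c_sum_ext; intros l _. rewrite t_scalE, t_mult_scal_r, t_int_scal.
unfold t_coef. ring.
Qed.

Definition dker (N : nat) (s : R) : C := c_sum N (fun j => t_exp (Z.of_nat j) s).

Lemma t_exp_opp k s : t_exp (- k) s = Cconj (t_exp k s).
Proof.
unfold teval, Cconj; simpl. rewrite opp_IZR, Ropp_mult_distr_l_reverse, cos_neg, sin_neg.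
reflexivity.
Qed.
Lemma t_exp_neg k s : t_exp (- k) s = t_exp k (- s).
Proof. unfold teval; simpl. rewrite opp_IZR. do 2 f_equal; ring. Qed.
Lemma t_exp_add_arg k s t : t_exp k (s + t) = (t_exp k s * t_exp k t)%C.
Proof.
unfold teval, Cmult; simpl. rewrite Rmult_plus_distr_l, cos_plus, sin_plus.
f_equal; ring.
Qed.

Lemma t_kernelE N x t : (0 < N)%nat -> t_kernel N x t =
  RtoC (/ INR N * Cmod (dker N (x - t)) ^ 2).
Proof.
intros N0. assert (HN : INR N <> 0) by (apply not_0_INR; lia).
unfold t_kernel, dker. rewrite t_scalE, t_sumE, RtoC_mult, RtoC_inv by easy. f_equal.
rewrite Cmod2_conj, c_sum_conj.
rewrite Cmult_comm, <- c_sum_scal. apply c_sum_ext; intros j _.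
rewrite Cmult_comm, t_sumE, <- c_sum_scal. apply c_sum_ext; intros l _.
rewrite t_scalE, t_exp_neg, <- t_exp_add_arg, <- t_exp_opp, t_exp_add. reflexivity.
Qed.

Lemma dker_geom N s : ((1 - t_exp 1 s) * dker N s = 1 - t_exp (Z.of_nat N) s)%C.
Proof.
induction N; unfold dker; cbn [c_sum].
- simpl Z.of_nat. rewrite t_exp_0. ring.
- fold (dker N s). rewrite Cmult_plus_distr_l, IHN, Nat2Z.inj_succ.
  unfold Z.succ. rewrite <- t_exp_add. ring.
Qed.

Lemma Cmod_t_exp k s : Cmod (t_exp k s) = 1.
Proof.
unfold Cmod, teval; cbn [fst snd t_re t_im t_exp s_cos s_sin sfun].
assert (H := sin2_cos2 (IZR k * s)). unfold Rsqr in H.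
replace (cos (IZR k * s) ^ 2 + sin (IZR k * s) ^ 2) with 1 by lra. apply sqrt_1.
Qed.

Lemma dker_bound N s : sin (s / 2) ^ 2 * Cmod (dker N s) ^ 2 <= 1.
Proof.
assert (G := f_equal Cmod (dker_geom N s)). rewrite Cmod_mult in G.
assert (B : Cmod (1 - t_exp (Z.of_nat N) s) <= 2).
{ eapply Rle_trans. apply Cmod_triangle. rewrite Cmod_opp, Cmod_t_exp, Cmod_1. lra. }
assert (E : Cmod (1 - t_exp 1 s) ^ 2 = 4 * sin (s / 2) ^ 2).
{ rewrite Cmod2_alt. unfold Re, Im, teval, Cminus, Cplus, Copp, RtoC; cbn [fst snd t_re t_im t_exp s_cos s_sin sfun].
  replace (1 * s) with (2 * (s / 2)) by field. rewrite cos_2a_sin, sin_2a.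
  assert (H := sin2_cos2 (s/2)). unfold Rsqr in H. nra. }
assert (0 <= Cmod (1 - t_exp (Z.of_nat N) s)) by apply Cmod_ge_0.
assert (H4 : 4 * (sin (s / 2) ^ 2 * Cmod (dker N s) ^ 2) <= 4).
{ rewrite <- Rmult_assoc, <- E, <- Rpow_mult_distr, G. nra. }
lra.
Qed.

Lemma t_int_kernel N x : (0 < N)%nat -> t_int (t_kernel N x) = RtoC (2 * PI).
Proof.
intros HN.
assert (HN' : RtoC (INR N) <> 0).
{ intros E; apply RtoC_inj in E. apply (not_0_INR N); auto. lia. }
assert (H : t_fejer N (t_exp 0) x = RtoC 1).
{ unfold t_fejer. rewrite t_scalE, t_sumE.
  rewrite (c_sum_ext _ _ (fun _ => RtoC 1)).
  rewrite c_sum_const. field; auto.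
  intros j Hj. rewrite t_sumE, (c_sum_one _ _ j); auto.
  - unfold zdiff; rewrite Z.sub_diag, t_scalE, t_coef_exp, t_exp_0. simpl; ring.
  - intros l Hl. rewrite t_scalE, t_coef_exp. destruct Z.eq_dec. unfold zdiff in e; lia. ring. }
rewrite t_fejer_kernel in H.
replace (t_mult (t_exp 0) (t_kernel N x)) with (t_kernel N x) in H.
2:{ apply testT_ext; intros; autorewrite with tst. rewrite t_exp_0; ring. }
replace (t_int (t_kernel N x)) with (RtoC (2*PI) * (/ RtoC (2 * PI) * t_int (t_kernel N x)))%C.
rewrite H; ring. field. apply RtoC_2PI_neq.
Qed.

Lemma sin_ge_third y : 0 <= y <= PI / 2 -> y / 3 <= sin y.
Proof.
intros [H0 H1]. assert (P4 := PI_4).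
destruct (SIN y) as [H _]; try lra.
eapply Rle_trans; [|exact H].
unfold sin_lb, sin_approx, sin_term. simpl.
assert (Hy : y <= 2) by lra.
assert (0 <= y * (4 - y * y)) by (apply Rmult_le_pos; nra).
assert (0 <= (y * y * y * y * y) * (42 - y * y)).
{ apply Rmult_le_pos; [repeat apply Rmult_le_pos; auto | nra]. }
lra.
Qed.

Lemma s_lipschitz (f : smoothT) : exists L, 0 <= L /\
  forall x t, Rabs (f x - f t) <= L * Rabs (sin ((x - t) / 2)).
Proof.
destruct (s_bounded (s_deriv f)) as [B [HB H]]. exists (6 * B); split. lra.
intros x t. destruct (reduce_2pi (x - t)) as [m Hm].
rewrite <- (s_periodic_Z f x m).
assert (M : Rabs (f (x + 2 * IZR m * PI) - f t) <= B * Rabs (x - t + 2 * IZR m * PI)).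
{ destruct (MVT_gen f t (x + 2 * IZR m * PI) (s_deriv f)) as [c [_ Hc]].
  - intros; apply s_is_derive.
  - intros; apply continuity_pt_filterlim, s_continuous.
  - rewrite Hc, Rabs_mult. replace (x + 2 * IZR m * PI - t) with (x - t + 2 * IZR m * PI) by ring.
    apply Rmult_le_compat_r; auto. apply Rabs_pos. }
eapply Rle_trans. exact M.
assert (E : Rabs (sin ((x - t) / 2)) = Rabs (sin ((x - t + 2 * IZR m * PI) / 2))).
{ replace ((x - t + 2 * IZR m * PI) / 2) with ((x - t) / 2 + IZR m * PI) by field.
  rewrite sin_plus, (sin_eq_0_1 (IZR m * PI)) by eauto.
  rewrite Rmult_0_r, Rplus_0_r, Rabs_mult.
  assert (C1 : Rabs (cos (IZR m * PI)) = 1).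
  { assert (S := sin2_cos2 (IZR m * PI)). rewrite (sin_eq_0_1 (IZR m * PI)) in S by eauto.
    rewrite <- Rabs_R1. apply Rsqr_eq_abs_0. unfold Rsqr in *; lra. }
  rewrite C1; ring. }
rewrite E. clear E M. revert Hm. generalize (x - t + 2 * IZR m * PI); intros y Hy.
assert (Q : Rabs y <= 6 * Rabs (sin (y / 2))).
{ unfold Rabs in Hy; destruct (Rcase_abs y) as [Hn|Hp].
  - assert (S := sin_ge_third (- (y / 2)) ltac:(lra)). rewrite sin_neg in S.
    rewrite (Rabs_left y) by lra. rewrite Rabs_left1 by lra. lra.
  - assert (S := sin_ge_third (y / 2) ltac:(lra)).
    rewrite (Rabs_pos_eq y) by lra. rewrite Rabs_pos_eq by lra. lra. }
nra.
Qed.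

Lemma s_kernel_bound (f : smoothT) : exists L, 0 <= L /\
  forall N x eps, (0 < N)%nat -> 0 < eps ->
  Rabs (RInt (s_mult (s_plus (s_const (f x)) (s_opp f)) (t_re (t_kernel N x))) 0 (2 * PI))
   <= 2 * PI * (L * (eps + / (INR N * eps))).
Proof.
assert (Hpi := PI_RGT_0).
destruct (s_lipschitz f) as [L [HL H]]. exists (L / 2); split. lra.
intros N x eps HN He.
assert (HN' : 0 < INR N) by now apply lt_0_INR.
set (G := t_re (t_kernel N x)).
assert (IG : RInt G 0 (2 * PI) = 2 * PI).
{ assert (E := f_equal fst (t_int_kernel N x HN)). exact E. }
assert (GE : forall t, G t = / INR N * Cmod (dker N (x - t)) ^ 2).
{ intros t. exact (f_equal fst (t_kernelE N x t HN)). }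
set (B := s_plus (s_mult (s_const (L / 2 * eps)) G) (s_const (L / 2 * / (INR N * eps)))).
assert (IB : RInt B 0 (2 * PI) = 2 * PI * (L / 2 * (eps + / (INR N * eps)))).
{ transitivity (RInt (fun t => L / 2 * eps * G t + (L / 2 * / (INR N * eps)) * s_const 1 t) 0 (2*PI)).
  apply RInt_ext; intros; simpl; ring.
  rewrite s_RInt_lin, IG. simpl. rewrite (RInt_const (V:=R_CompleteNormedModule)).
  unfold scal; simpl; unfold mult; simpl. ring. }
assert (K : forall t, Rabs (s_mult (s_plus (s_const (f x)) (s_opp f)) G t) <= B t).
{ intros t.
  change (Rabs ((f x + - f t) * G t) <= L / 2 * eps * G t + L / 2 * / (INR N * eps)).
  assert (G0 : 0 <= G t).
  { rewrite GE. apply Rmult_le_pos. left; now apply Rinv_0_lt_compat. apply pow_le, Cmod_ge_0. }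
  rewrite Rabs_mult, (Rabs_pos_eq (G t)) by auto.
  set (s := Rabs (sin ((x - t) / 2))).
  assert (SG : s ^ 2 * G t <= / INR N).
  { rewrite GE. unfold s. rewrite pow2_abs. rewrite <- Rmult_assoc, (Rmult_comm _ (/ INR N)), Rmult_assoc.
    rewrite <- (Rmult_1_r (/ INR N)) at 2. apply Rmult_le_compat_l.
    left; now apply Rinv_0_lt_compat. apply dker_bound. }
  assert (F : Rabs (f x + - f t) <= L * s) by apply H.
  apply Rle_trans with (L * s * G t). now apply Rmult_le_compat_r.
  rewrite Rinv_mult.
  assert (AG : s <= / 2 * (eps + s ^ 2 * / eps)).
  { assert (0 <= (s - eps) ^ 2 * / eps). apply Rmult_le_pos. apply pow2_ge_0.
    left; now apply Rinv_0_lt_compat.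
    replace ((s - eps) ^ 2 * / eps) with (s ^ 2 * / eps - 2 * s + eps) in H0 by (field; lra). lra. }
  assert (X : s * G t <= / 2 * (eps * G t + / INR N * / eps)).
  { apply Rle_trans with (/ 2 * (eps + s ^ 2 * / eps) * G t). now apply Rmult_le_compat_r.
    replace (/ 2 * (eps + s ^ 2 * / eps) * G t) with (/ 2 * (eps * G t + (s ^ 2 * G t) * / eps)) by ring.
    assert (s ^ 2 * G t * / eps <= / INR N * / eps). apply Rmult_le_compat_r; auto.
    left; now apply Rinv_0_lt_compat. lra. }
  rewrite Rmult_assoc. apply Rle_trans with (L * (/ 2 * (eps * G t + / INR N * / eps))).
  now apply Rmult_le_compat_l. right; field. split; lra. }
rewrite <- IB. apply Rabs_le. split.
- replace (- RInt B 0 (2 * PI)) with (RInt (s_opp B) 0 (2*PI)).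
  apply RInt_le; try apply s_ex_RInt. lra. intros t _. specialize (K t).
  apply Rabs_le_between in K. apply K.
  apply (RInt_opp (V:=R_CompleteNormedModule) B), s_ex_RInt.
- apply RInt_le; try apply s_ex_RInt. lra. intros t _. specialize (K t).
  apply Rabs_le_between in K. apply K.
Qed.

Definition t_minus (f g : testT) : testT := t_plus f (t_scal (RtoC (-1)) g).

Lemma t_fejer_bound phi : exists L, 0 <= L /\ forall N eps, (0 < N)%nat -> 0 < eps ->
  t_bounded 0 (L * (eps + / (INR N * eps))) (t_minus phi (t_fejer N phi)).
Proof.
assert (Hpi := PI_RGT_0).
destruct (s_kernel_bound (t_re phi)) as [L1 [H1 B1]], (s_kernel_bound (t_im phi)) as [L2 [H2 B2]].
exists (L1 + L2); split. lra. intros N eps HN He n x Hn. replace n with 0%nat by lia.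
cbn [Derive_n].
assert (E : t_minus phi (t_fejer N phi) x = (/ RtoC (2 * PI) *
  t_int (t_mult (t_plus (t_const (phi x)) (t_scal (RtoC (-1)) phi)) (t_kernel N x)))%C).
{ rewrite t_mult_comm, t_mult_plus_r, t_mult_scal_r, t_int_plus, t_int_scal.
  unfold t_minus; rewrite t_plusE, t_scalE, t_fejer_kernel, (t_mult_comm phi).
  rewrite (t_mult_comm (t_kernel N x) (t_const _)). fold (t_scal (phi x) (t_kernel N x)).
  rewrite t_int_scal, t_int_kernel by auto. field. apply RtoC_2PI_neq. }
assert (A1 : t_int (t_mult (t_plus (t_const (phi x)) (t_scal (RtoC (-1)) phi)) (t_kernel N x)) =
 (RInt (s_mult (s_plus (s_const (t_re phi x)) (s_opp (t_re phi))) (t_re (t_kernel N x))) 0 (2 * PI),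
  RInt (s_mult (s_plus (s_const (t_im phi x)) (s_opp (t_im phi))) (t_re (t_kernel N x))) 0 (2 * PI))).
{ assert (KI : forall t, t_im (t_kernel N x) t = 0).
  { intros t. exact (f_equal snd (t_kernelE N x t HN)). }
  revert KI; generalize (t_kernel N x); intros K KI.
  unfold t_int; f_equal; apply RInt_ext; intros t _; simpl; rewrite (KI t); ring. }
rewrite A1 in E. clear A1.
specialize (B1 N x eps HN He). specialize (B2 N x eps HN He).
rewrite <- RtoC_inv in E by lra.
assert (E1 := f_equal fst E). assert (E2 := f_equal snd E).
unfold teval, RtoC, Cmult in E1, E2. cbn [fst snd] in E1, E2. rewrite E1, E2.
assert (0 <= eps + / (INR N * eps)).
{ assert (0 < / (INR N * eps)). apply Rinv_0_lt_compat, Rmult_lt_0_compat; auto. now apply lt_0_INR. lra. }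
assert (Q : forall r L, Rabs r <= 2 * PI * (L * (eps + / (INR N * eps))) -> L <= L1 + L2 ->
  Rabs (/ (2 * PI) * r) <= (L1 + L2) * (eps + / (INR N * eps))).
{ intros r L Hr HL. rewrite Rabs_mult, Rabs_pos_eq.
  2:{ left; apply Rinv_0_lt_compat; lra. }
  apply Rmult_le_reg_l with (2 * PI). lra. rewrite <- Rmult_assoc, Rinv_r, Rmult_1_l by lra.
  eapply Rle_trans. exact Hr. apply Rmult_le_compat_l. lra. now apply Rmult_le_compat_r. }
rewrite !Rmult_0_l, Rminus_0_r, Rplus_0_r.
split; eapply Q; eauto; lra.
Qed.

Lemma t_bounded_weaken N M M' f : M <= M' -> t_bounded N M f -> t_bounded N M' f.
Proof. intros L H n x Hn. destruct (H n x Hn); split; lra. Qed.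

Lemma t_deriv_sum n f : t_deriv (t_sum n f) = t_sum n (fun j => t_deriv (f j)).
Proof.
induction n; cbn [t_sum].
- apply testT_ext; intros x. unfold teval; cbn [t_re t_im t_deriv t_const].
  now rewrite !Derive_const'.
- now rewrite t_deriv_plus, IHn.
Qed.

Lemma t_sum_ext n f g : (forall j, f j = g j) -> t_sum n f = t_sum n g.
Proof. intros H; induction n; simpl; auto. now rewrite IHn, H. Qed.

Lemma t_fejer_deriv N phi : t_deriv (t_fejer N phi) = t_fejer N (t_deriv phi).
Proof.
unfold t_fejer. rewrite t_deriv_scal, t_deriv_sum. f_equal.
apply t_sum_ext; intros j. rewrite t_deriv_sum. apply t_sum_ext; intros l.
rewrite t_deriv_scal, t_deriv_exp, t_coef_deriv.
apply testT_ext; intros x; autorewrite with tst; ring.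
Qed.

Lemma t_fejer_cv n : forall phi delta, 0 < delta -> exists N0, forall N, (N0 <= N)%nat ->
  t_bounded n delta (t_minus phi (t_fejer N phi)).
Proof.
induction n as [|n IH]; intros phi delta Hd.
- destruct (t_fejer_bound phi) as [L [HL H]].
  set (eps := delta / (2 * (L + 1))).
  assert (He : 0 < eps) by (apply Rdiv_lt_0_compat; lra).
  destruct (archimed (/ (eps * eps))) as [A _].
  assert (Hee : 0 < / (eps * eps)) by (apply Rinv_0_lt_compat; nra).
  exists (Z.to_nat (up (/ (eps * eps)))). intros N HN.
  assert (HN1 : / (eps * eps) <= INR N).
  { rewrite INR_IZR_INZ. left. eapply Rlt_le_trans. exact A. apply IZR_le. lia. }
  assert (HN0 : (0 < N)%nat) by (apply INR_lt; simpl; lra).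
  apply t_bounded_weaken with (2 := H N eps HN0 He).
  assert (/ (INR N * eps) <= eps).
  { apply Rmult_le_reg_l with (INR N * eps). nra. rewrite Rinv_r by nra.
    assert (1 = / (eps * eps) * (eps * eps)) by (field; lra).
    rewrite Rmult_assoc. rewrite H0. apply Rmult_le_compat_r; nra. }
  apply Rle_trans with (L * (2 * eps)). apply Rmult_le_compat_l; lra.
  apply Rle_trans with ((L + 1) * (2 * eps)). nra. right; unfold eps; field; lra.
- destruct (IH phi delta Hd) as [N1 H1], (IH (t_deriv phi) delta Hd) as [N2 H2].
  exists (max N1 N2). intros N HN j x Hj.
  destruct j as [|j]. apply (H1 N ltac:(lia) 0%nat x). lia.
  specialize (H2 N ltac:(lia) j x ltac:(lia)).
  rewrite <- t_fejer_deriv in H2.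
  replace (t_minus (t_deriv phi) (t_deriv (t_fejer N phi))) with
    (t_deriv (t_minus phi (t_fejer N phi))) in H2.
  2:{ unfold t_minus; now rewrite t_deriv_plus, t_deriv_scal. }
  rewrite <- !Derive_n_S_comm. exact H2.
Qed.

(* Both one-sided series are total operators; the sums over Z are meaningful under
   ex_sumZ. *)
Definition ex_sumZ (f : Z -> R) : Prop :=
  ex_series (fun n : nat => f (Z.of_nat n)) /\
  ex_series (fun n : nat => f (- Z.of_nat (S n))%Z).
Definition sumZ (f : Z -> R) : R :=
  Series (fun n : nat => f (Z.of_nat n)) + Series (fun n : nat => f (- Z.of_nat (S n))%Z).
Definition sumZC (f : Z -> C) : C :=
  (sumZ (fun k => Re (f k)), sumZ (fun k => Im (f k))).

Lemma ex_sumZ_ext f g : (forall k, f k = g k) -> ex_sumZ f -> ex_sumZ g.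
Proof. intros H [A B]; split; [exact (ex_series_ext _ _ (fun n => H _) A) | exact (ex_series_ext _ _ (fun n => H _) B)]. Qed.
Lemma sumZ_ext f g : (forall k, f k = g k) -> sumZ f = sumZ g.
Proof. intros H; unfold sumZ; f_equal; apply Series_ext; auto. Qed.
Lemma ex_sumZ_plus f g : ex_sumZ f -> ex_sumZ g -> ex_sumZ (fun k => f k + g k).
Proof. intros [A B] [C D]; split; apply (ex_series_plus (V:=R_NormedModule)); auto. Qed.
Lemma sumZ_plus f g : ex_sumZ f -> ex_sumZ g ->
  sumZ (fun k => f k + g k) = sumZ f + sumZ g.
Proof. intros [A B] [C D]; unfold sumZ. rewrite !Series_plus; auto; ring. Qed.
Lemma ex_sumZ_scal c f : ex_sumZ f -> ex_sumZ (fun k => c * f k).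
Proof.
intros [A B]; split; [apply (ex_series_scal_l c (fun n => f (Z.of_nat n))) | apply (ex_series_scal_l c (fun n => f (- Z.of_nat (S n))%Z))]; auto.
Qed.
Lemma sumZ_scal c f : sumZ (fun k => c * f k) = c * sumZ f.
Proof.
unfold sumZ. rewrite (Series_scal_l c (fun n => f (Z.of_nat n))),
 (Series_scal_l c (fun n => f (- Z.of_nat (S n))%Z)); ring.
Qed.
Lemma ex_sumZ_le f g : (forall k, Rabs (f k) <= g k) -> ex_sumZ g -> ex_sumZ f.
Proof.
intros H [A B]; split.
exact (ex_series_le (K:=R_AbsRing) (V:=R_CompleteNormedModule) _ _ (fun n => H _) A).
exact (ex_series_le (K:=R_AbsRing) (V:=R_CompleteNormedModule) _ _ (fun n => H _) B).
Qed.
Lemma sumZ_abs_le f g : (forall k, Rabs (f k) <= g k) -> ex_sumZ g -> Rabs (sumZ f) <= sumZ g.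
Proof.
intros H [A B].
assert (Q : forall u v : nat -> R, (forall n, Rabs (u n) <= v n) -> ex_series v ->
  Rabs (Series u) <= Series v).
{ intros u v Huv Hv. eapply Rle_trans. apply Series_Rabs.
  apply (ex_series_le (K:=R_AbsRing) (V:=R_CompleteNormedModule) _ v); auto.
  intros; simpl. unfold norm; simpl; unfold abs; simpl. now rewrite Rabs_Rabsolu.
  apply Series_le; auto. intros; split; auto using Rabs_pos. }
unfold sumZ. eapply Rle_trans. apply Rabs_triang. apply Rplus_le_compat; apply Q; auto.
Qed.
Lemma sumZ_nonneg f : (forall k, 0 <= f k) -> ex_sumZ f -> 0 <= sumZ f.
Proof.
intros H E. eapply Rle_trans. apply (Rabs_pos (sumZ f)). apply sumZ_abs_le; auto.
intros k. rewrite Rabs_pos_eq by auto. apply Rle_refl.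
Qed.
Lemma sumZ_le f g : (forall k, 0 <= f k <= g k) -> ex_sumZ g -> sumZ f <= sumZ g.
Proof.
intros H E. eapply Rle_trans. apply Rle_abs. apply sumZ_abs_le; auto.
intros k. rewrite Rabs_pos_eq; apply H.
Qed.

Lemma series_one (f : nat -> R) j : (forall n, n <> j -> f n = 0) -> is_series f (f j).
Proof.
intros H. apply (filterlim_ext_loc (F:=eventually) (fun _ => f j)).
- exists j. intros n Hn.
  assert (Z0 : forall m, (m < j)%nat -> sum_n f m = 0).
  { induction m; intros. now rewrite sum_O, H by lia.
    rewrite sum_Sn, IHm, H by lia. apply Rplus_0_l. }
  induction n as [|n IHn].
  + replace j with 0%nat by lia. now rewrite sum_O.
  + destruct (Nat.eq_dec j (S n)) as [->|].
    * rewrite sum_Sn, Z0 by lia. symmetry; apply Rplus_0_l.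
    * rewrite sum_Sn, <- IHn, (H (S n)) by lia. symmetry; apply Rplus_0_r.
- apply filterlim_const.
Qed.
Lemma Series_zero (f : nat -> R) : (forall n, f n = 0) -> Series f = 0.
Proof.
intros H. rewrite (Series_ext _ (fun n => 0 * 0)). rewrite Series_scal_l; ring.
intros; rewrite H; ring.
Qed.
Lemma sumZ_one f k : (forall l, l <> k -> f l = 0) -> sumZ f = f k.
Proof.
intros H. unfold sumZ. destruct (Z_le_dec 0 k) as [Hk|Hk].
- rewrite (is_series_unique _ (f k)), Series_zero, Rplus_0_r; auto.
  intros n; apply H; lia.
  assert (S1 := series_one (fun n => f (Z.of_nat n)) (Z.to_nat k)). simpl in S1.
  rewrite Z2Nat.id in S1 by lia. apply S1. intros; apply H; lia.
- rewrite (Series_zero (fun n => f (Z.of_nat n))), Rplus_0_l.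
  2: intros; apply H; lia.
  apply is_series_unique.
  assert (S1 := series_one (fun n => f (- Z.of_nat (S n))%Z) (Z.to_nat (-k-1))). cbn beta in S1.
  replace (- Z.of_nat (S (Z.to_nat (- k - 1))))%Z with k in S1 by lia.
  apply S1. intros; apply H; lia.
Qed.

Lemma Re_sumZC f : Re (sumZC f) = sumZ (fun k => Re (f k)). Proof. reflexivity. Qed.

Lemma sumZC_ext f g : (forall k, f k = g k) -> sumZC f = sumZC g.
Proof. intros H; unfold sumZC; f_equal; apply sumZ_ext; intros; now rewrite H. Qed.
Definition ex_sumZC (f : Z -> C) : Prop :=
  ex_sumZ (fun k => Re (f k)) /\ ex_sumZ (fun k => Im (f k)).
Lemma sumZC_plus f g : ex_sumZC f -> ex_sumZC g ->
  sumZC (fun k => f k + g k)%C = (sumZC f + sumZC g)%C.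
Proof.
intros [A B] [C D]. unfold sumZC, Cplus; cbn [fst snd]; f_equal; rewrite <- sumZ_plus; auto;
apply sumZ_ext; intros; reflexivity.
Qed.
Lemma sumZC_scal c f : ex_sumZC f -> sumZC (fun k => c * f k)%C = (c * sumZC f)%C.
Proof.
intros [A B]. destruct c as [c d]. unfold sumZC, Cmult; cbn [fst snd]; f_equal.
- replace (c * sumZ (fun k => Re (f k)) - d * sumZ (fun k => Im (f k))) with
   (c * sumZ (fun k => Re (f k)) + (-d) * sumZ (fun k => Im (f k))) by ring.
  rewrite <- !sumZ_scal, <- sumZ_plus by now apply ex_sumZ_scal.
  apply sumZ_ext; intros; unfold Re, Im; simpl; ring.
- rewrite <- !sumZ_scal, <- sumZ_plus by now apply ex_sumZ_scal.
  apply sumZ_ext; intros; unfold Re, Im; simpl; ring.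
Qed.
Lemma Re_le_Cmod z : Rabs (Re z) <= Cmod z.
Proof. apply re_le_Cmod. Qed.
Lemma Im_le_Cmod z : Rabs (Im z) <= Cmod z.
Proof. eapply Rle_trans; [apply Rmax_r | apply Rmax_Cmod]. Qed.
Lemma ex_sumZC_le f g : (forall k, Cmod (f k) <= g k) -> ex_sumZ g -> ex_sumZC f.
Proof.
intros H E; split; eapply ex_sumZ_le; eauto; intros k; cbv beta;
(eapply Rle_trans; [|apply H]); auto using Re_le_Cmod, Im_le_Cmod.
Qed.
Lemma sumZC_bound f g : (forall k, Cmod (f k) <= g k) -> ex_sumZ g -> Cmod (sumZC f) <= 2 * sumZ g.
Proof.
intros H E. eapply Rle_trans. apply Cmod_le_sum. unfold sumZC; cbn [fst snd].
assert (Rabs (sumZ (fun k => Re (f k))) <= sumZ g) by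
 (apply sumZ_abs_le; auto; intros; eapply Rle_trans; [apply Re_le_Cmod | apply H]).
assert (Rabs (sumZ (fun k => Im (f k))) <= sumZ g) by
 (apply sumZ_abs_le; auto; intros; eapply Rle_trans; [apply Im_le_Cmod | apply H]).
lra.
Qed.

Lemma ex_series_inv2 : ex_series (fun n => / (INR n + 1) ^ 2).
Proof.
assert (T : ex_series (fun n => / ((INR n + 1) * (INR n + 2)))).
{ exists 1. assert (E : forall n, 1 - / (INR n + 2) = sum_n (fun n => / ((INR n + 1) * (INR n + 2))) n).
  { induction n. rewrite sum_O; simpl; field. rewrite sum_Sn, <- IHn.
    change (1 - / (INR (S n) + 2) = 1 - / (INR n + 2) + / ((INR (S n) + 1) * (INR (S n) + 2))).
    rewrite S_INR. assert (0 <= INR n) by apply pos_INR. field. lra. }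
  eapply filterlim_ext; [exact E|].
  change (is_lim_seq (fun n => 1 - / (INR n + 2)) 1).
  replace (Finite 1) with (Finite (1 - 0)) by (f_equal; ring).
  apply is_lim_seq_minus'. apply is_lim_seq_const.
  apply (is_lim_seq_inv _ p_infty); [|discriminate].
  apply (is_lim_seq_plus _ _ p_infty 2). apply is_lim_seq_INR. apply is_lim_seq_const. reflexivity. }
apply (ex_series_le (K:=R_AbsRing) (V:=R_CompleteNormedModule)) with
  (b := fun n => 2 * / ((INR n + 1) * (INR n + 2))).
- intros n. assert (0 <= INR n) by apply pos_INR.
  change (Rabs (/ (INR n + 1) ^ 2) <= 2 * / ((INR n + 1) * (INR n + 2))).
  rewrite Rabs_pos_eq. 2: left; apply Rinv_0_lt_compat; nra.
  apply Rmult_le_reg_l with ((INR n + 1) ^ 2 * (INR n + 2)). apply Rmult_lt_0_compat; nra.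
  replace ((INR n + 1) ^ 2 * (INR n + 2) * / (INR n + 1) ^ 2) with (INR n + 2) by (field; lra).
  replace ((INR n + 1) ^ 2 * (INR n + 2) * (2 * / ((INR n + 1) * (INR n + 2)))) with (2 * (INR n + 1)) by (field; lra).
  lra.
- apply (ex_series_scal_l (K:=R_AbsRing) 2 (fun n => / ((INR n + 1) * (INR n + 2)))), T.
Qed.

Lemma ex_sumZ_inv2 : ex_sumZ (fun k => / (Rabs (IZR k) + 1) ^ 2).
Proof.
split.
- eapply ex_series_ext; [|apply ex_series_inv2]. intros n; cbv beta.
  now rewrite <- INR_IZR_INZ, Rabs_pos_eq by apply pos_INR.
- eapply ex_series_ext; [|apply (proj1 (ex_series_incr_1 (K:=R_AbsRing) (V:=R_NormedModule) (fun n => / (INR n + 1) ^ 2))), ex_series_inv2].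
  intros n; cbv beta. rewrite opp_IZR, Rabs_Ropp, <- INR_IZR_INZ.
  now rewrite Rabs_pos_eq by apply pos_INR.
Qed.

(* Periodic distributions, the dual of C^infty(T; C); the pairing is bilinear, a
   function v acting by f |-> int_T v f. *)
Record distT : Type := MkDist {
  dist_app :> testT -> C;
  dist_plus : forall f g, dist_app (t_plus f g) = (dist_app f + dist_app g)%C;
  dist_scal : forall c f, dist_app (t_scal c f) = (c * dist_app f)%C;
  dist_cont : exists (N : nat) (K : R), forall M f,
    t_bounded N M f -> Cmod (dist_app f) <= K * M }.

Lemma distT_ext (v w : distT) : (forall f, v f = w f) -> v = w.
Proof.
destruct v as [v p q r], w as [w p' q' r']; simpl; intros H.
assert (E : v = w) by (apply functional_extensionality; exact H).
subst w. f_equal; apply proof_irrelevance.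
Qed.

Lemma dist_cont' (v : distT) : exists N K, 0 <= K /\ forall M f,
    t_bounded N M f -> Cmod (v f) <= K * M.
Proof.
destruct (dist_cont v) as [N [K H]]. exists N, (Rmax K 0). split. apply Rmax_r.
intros M f Hf. eapply Rle_trans. eapply H; eauto.
apply Rmult_le_compat_r. eapply t_bounded_pos; eauto. apply Rmax_l.
Qed.

Definition d_zero : distT.
Proof.
refine (MkDist (fun _ => RtoC 0) _ _ _); intros; try ring.
exists 0%nat, 0. intros M f _; rewrite Cmod_0, Rmult_0_l; apply Rle_refl.
Defined.
Definition d_plus (v w : distT) : distT.
Proof.
refine (MkDist (fun f => v f + w f)%C _ _ _); intros.
- rewrite !dist_plus; ring.
- rewrite !dist_scal; ring.
- destruct (dist_cont' v) as [N [K [HK H]]], (dist_cont' w) as [N' [K' [HK' H']]].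
  exists (max N N'), (K + K'). intros M f Hf. eapply Rle_trans. apply Cmod_triangle.
  rewrite Rmult_plus_distr_r. apply Rplus_le_compat; [apply H | apply H'];
  (apply (t_bounded_le _ (max N N')); [lia | exact Hf]).
Defined.
Definition d_scal (c : C) (v : distT) : distT.
Proof.
refine (MkDist (fun f => c * v f)%C _ _ _); intros.
- rewrite !dist_plus; ring.
- rewrite !dist_scal; ring.
- destruct (dist_cont v) as [N [K H]].
  exists N, (Cmod c * K). intros M f Hf. rewrite Cmod_mult, Rmult_assoc.
  apply Rmult_le_compat_l; auto. apply Cmod_ge_0.
Defined.
Definition d_opp (v : distT) : distT := d_scal (RtoC (-1)) v.

(* <a v, f> = <v, a f> *)
Definition d_smult (a : smoothT) (v : distT) : distT.
Proof.
refine (MkDist (fun f => v (t_smult a f)) _ _ _); intros.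
- rewrite <- dist_plus. f_equal. apply testT_ext; intros; autorewrite with tst; ring.
- rewrite <- dist_scal. f_equal. apply testT_ext; intros; autorewrite with tst; ring.
- destruct (dist_cont v) as [N [K H]], (t_bounded_smult N a) as [K' [HK' H']].
  exists N, (K * K'). intros M f Hf. rewrite Rmult_assoc. auto.
Defined.
Definition d_deriv (v : distT) : distT.
Proof.
refine (MkDist (fun f => - v (t_deriv f))%C _ _ _); intros.
- rewrite t_deriv_plus, dist_plus; ring.
- rewrite t_deriv_scal, dist_scal; ring.
- destruct (dist_cont v) as [N [K H]].
  exists (S N), K. intros M f Hf. rewrite Cmod_opp. apply H. now apply t_bounded_deriv.
Defined.

(* (1 / 2 pi) <v, e^{-ikx}>, which is (1 / 2 pi) int_T v(x) e^{-ikx} dx when v is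
   a function. *)
Definition coef (v : distT) (k : Z) : C := (/ RtoC (2 * PI) * v (t_exp (- k)))%C.

Lemma coef_plus v w k : coef (d_plus v w) k = (coef v k + coef w k)%C.
Proof. unfold coef; simpl; ring. Qed.
Lemma coef_scal c v k : coef (d_scal c v) k = (c * coef v k)%C.
Proof. unfold coef; simpl; ring. Qed.

Lemma dist_const0 (v : distT) : v (t_const 0) = RtoC 0.
Proof.
replace (t_const 0) with (t_scal 0 (t_const 0)). rewrite dist_scal; ring.
apply testT_ext; intros; autorewrite with tst; ring.
Qed.
Lemma dist_sum (v : distT) n f : v (t_sum n f) = c_sum n (fun j => v (f j)).
Proof.
induction n; cbn [t_sum c_sum]. apply dist_const0. now rewrite dist_plus, IHn.
Qed.

Lemma coef_eq0 v : (forall k, coef v k = RtoC 0) -> v = d_zero.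
Proof.
intros H. apply distT_ext; intros phi. simpl.
assert (E : forall k, v (t_exp k) = RtoC 0).
{ intros k. specialize (H (-k)%Z). unfold coef in H. rewrite Z.opp_involutive in H.
  replace (v (t_exp k)) with (RtoC (2 * PI) * (/ RtoC (2 * PI) * v (t_exp k)))%C.
  rewrite H; ring. field. apply RtoC_2PI_neq. }
assert (F : forall N, v (t_fejer N phi) = RtoC 0).
{ intros N. unfold t_fejer. rewrite dist_scal, dist_sum.
  rewrite (c_sum_ext _ _ (fun _ => RtoC 0)). rewrite c_sum_const; ring.
  intros j _. rewrite dist_sum. rewrite (c_sum_ext _ _ (fun _ => RtoC 0)). rewrite c_sum_const; ring.
  intros l _. rewrite dist_scal, E; ring. }
destruct (dist_cont' v) as [N [K [HK HC]]].
apply Cmod_eq_0. apply Rle_antisym; [|apply Cmod_ge_0].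
apply le_epsilon. intros eps He. rewrite Rplus_0_l.
destruct (t_fejer_cv N phi (eps / (K + 1))) as [n Hn]. apply Rdiv_lt_0_compat; lra.
specialize (Hn n (Nat.le_refl n)). apply HC in Hn. unfold t_minus in Hn.
rewrite dist_plus, dist_scal, F in Hn. replace (v phi + RtoC (-1) * RtoC 0)%C with (v phi) in Hn by ring.
eapply Rle_trans. exact Hn.
apply Rmult_le_reg_r with (K + 1). lra. unfold Rdiv. rewrite !Rmult_assoc, Rinv_l by lra. nra.
Qed.

Lemma t_bounded_exp N k : t_bounded N ((Rabs (IZR k) + 1) ^ N) (t_exp k).
Proof.
assert (H : forall n c, 0 <= c -> forall x, 
  Rabs (Derive_n (fun y => cos (IZR k * y)) n x) <= Rabs (IZR k) ^ n /\
  Rabs (Derive_n (fun y => sin (IZR k * y)) n x) <= Rabs (IZR k) ^ n).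
{ intros n c _. induction n; intros x.
  - simpl. assert (S1 := SIN_bound (IZR k * x)). assert (S2 := COS_bound (IZR k * x)).
    split; now apply Rabs_le.
  - rewrite <- !Derive_n_S_comm.
    rewrite (Derive_n_ext (Derive (fun y => cos (IZR k * y))) (fun y => - IZR k * sin (IZR k * y))).
    rewrite (Derive_n_ext (Derive (fun y => sin (IZR k * y))) (fun y => IZR k * cos (IZR k * y))).
    rewrite !Derive_n_scal_l, !Rabs_mult, Rabs_Ropp.
    destruct (IHn x). split; apply Rmult_le_compat_l; auto using Rabs_pos.
    intros t; apply is_derive_unique; auto_derive; auto; ring.
    intros t; apply is_derive_unique; auto_derive; auto; ring. }
intros n x Hn. destruct (H n 0 (Rle_refl 0) x) as [A B].
assert (P : Rabs (IZR k) ^ n <= (Rabs (IZR k) + 1) ^ N).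
{ assert (0 <= Rabs (IZR k)) by apply Rabs_pos.
  apply Rle_trans with ((Rabs (IZR k) + 1) ^ n). apply pow_incr; lra.
  apply Rle_pow; auto; lra. }
simpl; split; eapply Rle_trans; eauto.
Qed.

Lemma coef_growth v : exists N K, 0 <= K /\
  forall k, Cmod (coef v k) <= K * (Rabs (IZR k) + 1) ^ N.
Proof.
assert (Hpi := PI_RGT_0).
destruct (dist_cont' v) as [N [K [HK H]]]. exists N, (/ (2 * PI) * K). split.
apply Rmult_le_pos; auto. left; apply Rinv_0_lt_compat; lra.
intros k. unfold coef. rewrite Cmod_mult, Cmod_inv by apply RtoC_2PI_neq.
rewrite Cmod_R, Rabs_pos_eq, Rmult_assoc by lra. apply Rmult_le_compat_l.
left; apply Rinv_0_lt_compat; lra.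
apply H. replace (Rabs (IZR k)) with (Rabs (IZR (-k))). apply t_bounded_exp.
now rewrite opp_IZR, Rabs_Ropp.
Qed.

Definition bounded_symbol (sigma : Z -> C) : Prop := exists B, forall k, Cmod (sigma k) <= B.

Lemma multiplier_bound sigma v : bounded_symbol sigma -> exists N K, 0 <= K /\ forall M f k,
  t_bounded N M f ->
  Cmod (sigma k * coef v k * t_coef f (- k)) <= K * M * / (Rabs (IZR k) + 1) ^ 2.
Proof.
intros [B HB]. destruct (coef_growth v) as [N [K [HK H]]].
exists (N + 2)%nat, (B * K * (2 ^ (N + 2) * 8)). 
assert (B0 : 0 <= B) by (eapply Rle_trans; [apply Cmod_ge_0 | apply (HB 0%Z)]).
split. repeat apply Rmult_le_pos; auto; try lra. apply pow_le; lra.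
intros M f k Hf. assert (D := t_coef_decay (N + 2) M f (-k) Hf).
rewrite opp_IZR, Rabs_Ropp, pow_add in D.
specialize (H k). specialize (HB k).
assert (P : 0 < Rabs (IZR k) + 1) by (assert (0 <= Rabs (IZR k)) by apply Rabs_pos; lra).
set (r := Rabs (IZR k) + 1) in *.
assert (PN : 0 < r ^ N) by now apply pow_lt.
assert (P2 : 0 < r ^ 2) by now apply pow_lt.
rewrite !Cmod_mult.
apply Rle_trans with (B * (K * r ^ N) * Cmod (t_coef f (- k))).
{ apply Rmult_le_compat_r. apply Cmod_ge_0. apply Rmult_le_compat; auto using Cmod_ge_0. }
apply Rmult_le_reg_r with (r ^ 2); auto.
replace (B * (K * r ^ N) * Cmod (t_coef f (- k)) * r ^ 2) with
 (B * K * (r ^ N * r ^ 2 * Cmod (t_coef f (- k)))) by ring.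
replace (B * K * (2 ^ (N + 2) * 8) * M * / r ^ 2 * r ^ 2) with (B * K * (2 ^ (N + 2) * 8 * M)).
2: field; lra.
apply Rmult_le_compat_l; auto. now apply Rmult_le_pos.
Qed.

Lemma t_bounded_ex N f : exists M, t_bounded N M f.
Proof.
destruct f as [f g]. unfold t_bounded; simpl.
induction N as [|N [M IH]].
- destruct (s_bounded f) as [A [_ HA]], (s_bounded g) as [B [_ HB]].
  exists (Rmax A B). intros n x Hn. replace n with 0%nat by lia. simpl.
  split; eapply Rle_trans; eauto. apply Rmax_l. apply Rmax_r.
- destruct (s_Derive_n f (S N)) as [f' Hf], (s_Derive_n g (S N)) as [g' Hg].
  destruct (s_bounded f') as [A [_ HA]], (s_bounded g') as [B [_ HB]].
  exists (Rmax M (Rmax A B)). intros n x Hn. destruct (Nat.eq_dec n (S N)) as [->|].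
  + rewrite <- Hf, <- Hg. specialize (HA x). specialize (HB x).
    split; eapply Rle_trans; eauto; eapply Rle_trans; [|apply Rmax_r| |apply Rmax_r].
    apply Rmax_l. apply Rmax_r.
  + destruct (IH n x) as [P Q]. lia. split; eapply Rle_trans; eauto; apply Rmax_l.
Qed.

(* The distribution attached to a smooth function. *)
Definition d_of_test (g : testT) : distT.
Proof.
refine (MkDist (fun f => t_int (t_mult g f)) _ _ _); intros.
- now rewrite t_mult_plus_r, t_int_plus.
- now rewrite t_mult_scal_r, t_int_scal.
- destruct (t_bounded_ex 0 g) as [B HB]. assert (Hpi := PI_RGT_0).
  exists 0%nat, (2 * PI * (4 * (2 * B))). intros M f Hf.
  assert (E : t_int (t_mult g f) = (RtoC (2 * PI) * t_coef (t_mult g f) 0)%C).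
  { unfold t_coef. replace (t_mult (t_mult g f) (t_exp (- 0))) with (t_mult g f).
    field. apply RtoC_2PI_neq.
    apply testT_ext; intros; autorewrite with tst; simpl Z.opp; rewrite t_exp_0; ring. }
  rewrite E, Cmod_mult, Cmod_R, Rabs_pos_eq by lra.
  rewrite (Rmult_assoc (2 * PI)). apply Rmult_le_compat_l; [lra|].
  rewrite Rmult_assoc. apply t_coef_bound.
  intros n x Hn. replace n with 0%nat by lia.
  destruct (HB 0%nat x (Nat.le_refl 0)) as [G1 G2], (Hf 0%nat x (Nat.le_refl 0)) as [F1 F2].
  cbn [Derive_n] in *.
  assert (P : forall u v, Rabs u <= B -> Rabs v <= M -> Rabs (u * v) <= B * M).
  { intros u v Hu Hv. rewrite Rabs_mult. apply Rmult_le_compat; auto using Rabs_pos. }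
  simpl; split; (eapply Rle_trans; [apply Rabs_triang|]); rewrite ?Rabs_Ropp;
  (apply Rle_trans with (B * M + B * M); [apply Rplus_le_compat; auto | lra]).
Defined.

Lemma coef_of_test g k : coef (d_of_test g) k = t_coef g k.
Proof. reflexivity. Qed.

Lemma d_smult_of_test a g : d_smult a (d_of_test g) = d_of_test (t_smult a g).
Proof.
apply distT_ext; intros f; cbn [dist_app d_smult d_of_test]. f_equal.
apply testT_ext; intros x; autorewrite with tst; ring.
Qed.

Lemma d_deriv_of_test g : d_deriv (d_of_test g) = d_of_test (t_deriv g).
Proof.
apply distT_ext; intros f; cbn [dist_app d_deriv d_of_test].
assert (H := t_int_deriv (t_mult g f)). rewrite t_deriv_mult, t_int_plus in H.
replace (t_int (t_mult (t_deriv g) f)) with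
  (t_int (t_mult (t_deriv g) f) + t_int (t_mult g (t_deriv f)) - t_int (t_mult g (t_deriv f)))%C by ring.
rewrite H; ring.
Qed.

Lemma multiplier_ex sigma v f : bounded_symbol sigma ->
  ex_sumZC (fun k => sigma k * coef v k * t_coef f (- k))%C.
Proof.
intros Hs. destruct (multiplier_bound sigma v Hs) as [N [K [HK H]]].
destruct (t_bounded_ex N f) as [M HM].
apply ex_sumZC_le with (g := fun k => K * M * / (Rabs (IZR k) + 1) ^ 2). auto.
apply ex_sumZ_scal, ex_sumZ_inv2.
Qed.

(* The distribution with Fourier coefficients sigma(k) coef v k (coef_multiplier),
   paired with f through Parseval: <w, f> = 2 pi sum_k w^(k) f^(-k). *)
Definition d_multiplier (sigma : Z -> C) (Hs : bounded_symbol sigma) (v : distT) : distT.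
Proof.
refine (MkDist (fun f => RtoC (2 * PI) *
   sumZC (fun k => sigma k * coef v k * t_coef f (- k)))%C _ _ _); intros.
- rewrite <- Cmult_plus_distr_l, <- sumZC_plus by now apply multiplier_ex.
  f_equal. apply sumZC_ext; intros. rewrite t_coef_plus; ring.
- rewrite Cmult_assoc, (Cmult_comm c), <- Cmult_assoc. f_equal.
  rewrite <- sumZC_scal by now apply multiplier_ex.
  apply sumZC_ext; intros. rewrite t_coef_scal; ring.
- destruct (multiplier_bound sigma v Hs) as [N [K [HK H]]].
  exists N, (2 * PI * (2 * (K * sumZ (fun k => / (Rabs (IZR k) + 1) ^ 2)))).
  intros M f Hf. assert (Hpi := PI_RGT_0).
  rewrite Cmod_mult, Cmod_R, Rabs_pos_eq by lra.
  rewrite (Rmult_assoc (2 * PI)). apply Rmult_le_compat_l. lra.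
  eapply Rle_trans. apply sumZC_bound with (g := fun k => K * M * / (Rabs (IZR k) + 1) ^ 2). auto.
  apply ex_sumZ_scal, ex_sumZ_inv2.
  rewrite sumZ_scal. right; ring.
Defined.

Lemma coef_multiplier sigma Hs v k :
  coef (d_multiplier sigma Hs v) k = (sigma k * coef v k)%C.
Proof.
unfold coef at 1. cbn [dist_app d_multiplier].
assert (E : sumZC (fun l => sigma l * coef v l * t_coef (t_exp (- k)) (- l))%C = (sigma k * coef v k)%C).
{ assert (Z0 : forall l, l <> k -> (sigma l * coef v l * t_coef (t_exp (- k)) (- l))%C = RtoC 0).
  { intros l Hl. rewrite t_coef_exp. destruct Z.eq_dec. lia. ring. }
  unfold sumZC. rewrite (sumZ_one _ k), (sumZ_one _ k).
  - rewrite t_coef_exp. destruct Z.eq_dec; [|lia].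
    replace (sigma k * coef v k * 1)%C with (sigma k * coef v k)%C by ring.
    symmetry; apply surjective_pairing.
  - intros l Hl. now rewrite Z0.
  - intros l Hl. now rewrite Z0. }
rewrite E. field. apply RtoC_2PI_neq.
Qed.

Lemma coef_deriv v k : coef (d_deriv v) k = (Ci * IZR k * coef v k)%C.
Proof.
unfold coef; cbn [dist_app d_deriv]. rewrite t_deriv_exp, dist_scal, opp_IZR, RtoC_opp. ring.
Qed.

(* H^s(T) inside the periodic distributions; L^2(T) is H^0(T). *)
Definition Hs (s : R) (v : distT) : Prop :=
  ex_sumZ (fun k => Rpower (1 + IZR k ^ 2) s * Cmod (coef v k) ^ 2).

Definition m_symb (beta : R) (k : Z) : R := tanh (beta * IZR k) / beta.
Definition p_symb (beta : R) (k : Z) : R :=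
  if Z.eq_dec k 0 then 1 else tanh (beta * IZR k) / (beta * IZR k).

Lemma cosh_pos x : 0 < cosh x.
Proof. unfold cosh. assert (A := exp_pos x). assert (B := exp_pos (-x)). lra. Qed.
Lemma tanh_abs_le1 x : Rabs (tanh x) <= 1.
Proof.
unfold tanh. assert (C := cosh_pos x).
apply Rabs_le. split; apply Rmult_le_reg_r with (cosh x); auto; unfold Rdiv; rewrite Rmult_assoc, Rinv_l by lra;
unfold sinh, cosh; assert (A := exp_pos x); assert (B := exp_pos (-x)); lra.
Qed.
Lemma tanh_div_pos x : x <> 0 -> 0 < tanh x / x.
Proof.
intros Hx. unfold tanh. assert (C := cosh_pos x).
replace (sinh x / cosh x / x) with ((sinh x / x) * / cosh x) by (field; lra).
apply Rmult_lt_0_compat; [|now apply Rinv_0_lt_compat].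
destruct (Rtotal_order x 0) as [H|[H|H]]; [|lra|].
- replace (sinh x / x) with ((- sinh x) * / (- x)) by (field; lra).
  apply Rmult_lt_0_compat; [|apply Rinv_0_lt_compat; lra].
  unfold sinh. assert (exp x < exp (-x)) by (apply exp_increasing; lra). lra.
- apply Rmult_lt_0_compat; [|apply Rinv_0_lt_compat; lra].
  unfold sinh. assert (exp (-x) < exp x) by (apply exp_increasing; lra). lra.
Qed.

Lemma p_symb_pos (beta : posreal) k : 0 < p_symb beta k.
Proof.
destruct beta as [b Hb]; unfold p_symb; simpl. destruct Z.eq_dec; [lra|].
apply tanh_div_pos. intros E. apply Rmult_integral in E. destruct E as [E|E]; [lra|].
now apply eq_IZR in E.
Qed.

Lemma IZR_abs_ge1 k : k <> 0%Z -> 1 <= Rabs (IZR k).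
Proof. intros H. rewrite <- abs_IZR. apply IZR_le. lia. Qed.

Lemma p_symb_le (beta : posreal) k : k <> 0%Z -> p_symb beta k <= / (beta * Rabs (IZR k)).
Proof.
intros Hk. assert (P := p_symb_pos beta k). rewrite <- (Rabs_pos_eq (p_symb beta k)) by lra.
destruct beta as [b Hb]; unfold p_symb; simpl. destruct Z.eq_dec; [easy|].
assert (A := IZR_abs_ge1 k Hk).
unfold Rdiv. rewrite Rabs_mult, Rabs_inv, Rabs_mult, (Rabs_pos_eq b) by lra.
rewrite <- (Rmult_1_l (/ (b * Rabs (IZR k)))) at 2. apply Rmult_le_compat_r.
left; apply Rinv_0_lt_compat; nra. apply tanh_abs_le1.
Qed.

Lemma p_symb_weight (beta : posreal) k :
  p_symb beta k <= (1 + 2 / beta) * Rpower (1 + IZR k ^ 2) (- / 2).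
Proof.
assert (HR : Rpower (1 + IZR k ^ 2) (- / 2) = / sqrt (1 + IZR k ^ 2)).
{ rewrite Rpower_Ropp, Rpower_sqrt; auto. assert (0 <= IZR k ^ 2) by apply pow2_ge_0. lra. }
rewrite HR. assert (Hb := cond_pos beta).
assert (0 < / beta) by now apply Rinv_0_lt_compat.
destruct (Z.eq_dec k 0) as [->|Hk].
- unfold p_symb; simpl. replace (1 + 0 * (0 * 1)) with 1 by ring. rewrite sqrt_1, Rinv_1. unfold Rdiv; lra.
- assert (A := IZR_abs_ge1 k Hk). eapply Rle_trans. now apply p_symb_le.
  set (r := Rabs (IZR k)) in *.
  assert (S : sqrt (1 + IZR k ^ 2) <= 2 * r).
  { rewrite <- (sqrt_pow2 (2 * r)) by lra. apply sqrt_le_1_alt.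
    rewrite <- (pow2_abs (IZR k)). fold r. nra. }
  assert (S0 : 0 < sqrt (1 + IZR k ^ 2)).
  { apply sqrt_lt_R0. assert (0 <= IZR k ^ 2) by apply pow2_ge_0. lra. }
  assert (I : / (2 * r) <= / sqrt (1 + IZR k ^ 2)) by now apply Rinv_le_contravar.
  assert (I0 : 0 < / (2 * r)) by (apply Rinv_0_lt_compat; lra).
  replace (/ (beta * r)) with (2 / beta * / (2 * r)) by (field; split; lra).
  apply Rle_trans with ((1 + 2 / beta) * / (2 * r)).
  unfold Rdiv; nra. apply Rmult_le_compat_l; auto. unfold Rdiv; lra.
Qed.

Lemma T_bounded (beta : posreal) :
  bounded_symbol (fun k => - Ci * RtoC (m_symb beta k))%C.
Proof.
exists (/ beta). intros k. rewrite Cmod_mult, Cmod_opp, Cmod_Ci, Cmod_R, Rmult_1_l.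
unfold m_symb, Rdiv. assert (Hb := cond_pos beta). rewrite Rabs_mult, Rabs_inv, (Rabs_pos_eq beta) by lra.
rewrite <- (Rmult_1_l (/ beta)) at 2. apply Rmult_le_compat_r.
left; now apply Rinv_0_lt_compat. apply tanh_abs_le1.
Qed.
Lemma P_bounded (beta : posreal) : bounded_symbol (fun k => RtoC (p_symb beta k)).
Proof.
assert (Hb := cond_pos beta). assert (0 < / beta) by now apply Rinv_0_lt_compat.
exists (1 + / beta). intros k. rewrite Cmod_R, Rabs_pos_eq by (left; apply p_symb_pos).
destruct (Z.eq_dec k 0) as [->|Hk]. unfold p_symb; simpl. lra.
eapply Rle_trans. now apply p_symb_le. assert (A := IZR_abs_ge1 k Hk).
apply Rle_trans with (/ beta); [|lra]. apply Rinv_le_contravar; nra.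
Qed.

Definition Tbeta (beta : posreal) : distT -> distT := d_multiplier _ (T_bounded beta).
Definition Pbeta (beta : posreal) : distT -> distT := d_multiplier _ (P_bounded beta).

Definition w2 (w : Z -> R) (v : distT) (k : Z) : R := w k * Cmod (coef v k) ^ 2.

Lemma conv_ineq (a b : C) t : 0 < t < 1 ->
  Cmod (a + b) ^ 2 <= / t * Cmod a ^ 2 + / (1 - t) * Cmod b ^ 2.
Proof.
intros Ht. assert (T := Cmod_triangle a b).
assert (A := Cmod_ge_0 a). assert (B := Cmod_ge_0 b). assert (D := Cmod_ge_0 (a + b)).
apply Rle_trans with ((Cmod a + Cmod b) ^ 2). apply pow_incr; lra.
set (x := Cmod a) in *; set (y := Cmod b) in *.
assert (E : / t * x ^ 2 + / (1 - t) * y ^ 2 - (x + y) ^ 2 =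
  ((1 - t) * x - t * y) ^ 2 * (/ t * / (1 - t))) by (field; lra).
assert (0 <= ((1 - t) * x - t * y) ^ 2 * (/ t * / (1 - t))).
{ apply Rmult_le_pos. apply pow2_ge_0. left. apply Rmult_lt_0_compat; apply Rinv_0_lt_compat; lra. }
lra.
Qed.

Lemma ex_w2_plus w v1 v2 : (forall k, 0 <= w k) -> ex_sumZ (w2 w v1) -> ex_sumZ (w2 w v2) ->
  ex_sumZ (w2 w (d_plus v1 v2)).
Proof.
intros W E1 E2.
apply ex_sumZ_le with (fun k => 2 * w2 w v1 k + 2 * w2 w v2 k).
- intros k. unfold w2. rewrite Rabs_pos_eq.
  2: apply Rmult_le_pos; auto; apply pow_le, Cmod_ge_0.
  rewrite coef_plus. assert (H := conv_ineq (coef v1 k) (coef v2 k) (/2) ltac:(lra)).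
  replace (/ (1 - / 2)) with 2 in H by field. rewrite Rinv_inv in H.
  specialize (W k). nra.
- apply ex_sumZ_plus; apply ex_sumZ_scal; auto.
Qed.
Lemma ex_w2_scal w c v : ex_sumZ (w2 w v) -> ex_sumZ (w2 w (d_scal c v)).
Proof.
intros E. apply ex_sumZ_ext with (fun k => Cmod c ^ 2 * w2 w v k).
intros k; unfold w2. rewrite coef_scal, Cmod_mult; ring. now apply ex_sumZ_scal.
Qed.
Lemma w2_scal w c v : sumZ (w2 w (d_scal c v)) = Cmod c ^ 2 * sumZ (w2 w v).
Proof.
rewrite <- sumZ_scal. apply sumZ_ext; intros k; unfold w2. rewrite coef_scal, Cmod_mult; ring.
Qed.
Lemma w2_conv w v1 v2 t : 0 < t < 1 -> (forall k, 0 <= w k) -> ex_sumZ (w2 w v1) -> ex_sumZ (w2 w v2) ->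
  sumZ (w2 w (d_plus v1 v2)) <= / t * sumZ (w2 w v1) + / (1 - t) * sumZ (w2 w v2).
Proof.
intros Ht W E1 E2. rewrite <- !sumZ_scal, <- sumZ_plus by now apply ex_sumZ_scal.
apply sumZ_le. 2: apply ex_sumZ_plus; now apply ex_sumZ_scal.
intros k; unfold w2; split. apply Rmult_le_pos; auto; apply pow_le, Cmod_ge_0.
rewrite coef_plus. assert (H := conv_ineq (coef v1 k) (coef v2 k) t Ht). specialize (W k). nra.
Qed.
Lemma sumZ_ge_term f k : (forall k, 0 <= f k) -> ex_sumZ f -> f k <= sumZ f.
Proof.
intros H E.
assert (S1 : sumZ (fun l => if Z.eq_dec l k then f l else 0) = f k).
{ rewrite (sumZ_one _ k). destruct (Z.eq_dec k k); easy.
  intros l Hl; destruct Z.eq_dec; easy. }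
rewrite <- S1. apply sumZ_le; auto.
intros l; destruct Z.eq_dec; split; auto; apply Rle_refl.
Qed.
Lemma w2_nonneg w v k : 0 <= w k -> 0 <= w2 w v k.
Proof. intros; unfold w2; apply Rmult_le_pos; auto; apply pow_le, Cmod_ge_0. Qed.
Lemma w2_eq0 w v : (forall k, 0 < w k) -> ex_sumZ (w2 w v) -> sumZ (w2 w v) = 0 -> v = d_zero.
Proof.
intros W E H. apply coef_eq0; intros k.
assert (G := sumZ_ge_term (w2 w v) k (fun k => w2_nonneg w v k (Rlt_le _ _ (W k))) E).
rewrite H in G. unfold w2 in G. specialize (W k).
apply Cmod_eq_0. apply Rle_antisym; [|apply Cmod_ge_0].
apply Rnot_lt_le; intros L.
assert (0 < w k * Cmod (coef v k) ^ 2) by (apply Rmult_lt_0_compat; auto; now apply pow_lt). lra.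
Qed.

(* L^2 x H^{-1/2}; the parameter beta enters only through the inner product. *)
Record energy (beta : posreal) : Type := MkEnergy {
  en_h : distT;
  en_u : distT;
  en_h_L2 : Hs 0 en_h;
  en_u_Hm : Hs (- / 2) en_u }.
Arguments MkEnergy {beta}. Arguments en_h {beta}. Arguments en_u {beta}.
Arguments en_h_L2 {beta}. Arguments en_u_Hm {beta}.

Definition inner (beta : posreal) (Z W : energy beta) : C :=
  (RtoC (2 * PI) * sumZC (fun k => coef (en_h Z) k * Cconj (coef (en_h W) k)) +
   RtoC (2 * PI) * sumZC (fun k => RtoC (p_symb beta k) * coef (en_u Z) k * Cconj (coef (en_u W) k)))%C.

Definition enorm (beta : posreal) (Z : energy beta) : R := sqrt (Re (inner beta Z Z)).

Section EnergySpace.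
Context (beta : posreal).
Notation E := (energy beta).

Lemma energy_ext (Z W : E) : en_h Z = en_h W -> en_u Z = en_u W -> Z = W.
Proof.
destruct Z as [h u p q], W as [h' u' p' q']; simpl; intros -> ->.
f_equal; apply proof_irrelevance.
Qed.

Lemma Rpower_pos' s k : 0 < Rpower (1 + IZR k ^ 2) s.
Proof. apply exp_pos. Qed.

Lemma Hs_plus s v w : Hs s v -> Hs s w -> Hs s (d_plus v w).
Proof. apply ex_w2_plus. intros; left; apply Rpower_pos'. Qed.
Lemma Hs_scal s c v : Hs s v -> Hs s (d_scal c v).
Proof. apply ex_w2_scal. Qed.
Lemma Hs_zero s : Hs s d_zero.
Proof.
apply ex_sumZ_ext with (fun k => 0 * (/ (Rabs (IZR k) + 1) ^ 2)).
intros k. unfold coef; simpl. rewrite Cmult_0_r, Cmod_0. ring.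
apply ex_sumZ_scal, ex_sumZ_inv2.
Qed.

Definition en_zero : E := MkEnergy d_zero d_zero (Hs_zero _) (Hs_zero _).
Definition en_plus (Z W : E) : E :=
  MkEnergy (d_plus (en_h Z) (en_h W)) (d_plus (en_u Z) (en_u W))
    (Hs_plus _ _ _ (en_h_L2 Z) (en_h_L2 W)) (Hs_plus _ _ _ (en_u_Hm Z) (en_u_Hm W)).
Definition en_scal (c : C) (Z : E) : E :=
  MkEnergy (d_scal c (en_h Z)) (d_scal c (en_u Z))
    (Hs_scal _ _ _ (en_h_L2 Z)) (Hs_scal _ _ _ (en_u_Hm Z)).
Definition en_opp (Z : E) : E := en_scal (RtoC (-1)) Z.

Ltac en_tac := intros; apply energy_ext; apply distT_ext; intros; simpl; ring.

Lemma en_plus_comm (x y : E) : en_plus x y = en_plus y x. Proof. en_tac. Qed.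
Lemma en_plus_assoc (x y z : E) : en_plus x (en_plus y z) = en_plus (en_plus x y) z. Proof. en_tac. Qed.
Lemma en_plus_zero (x : E) : en_plus x en_zero = x. Proof. en_tac. Qed.
Lemma en_plus_opp (x : E) : en_plus x (en_opp x) = en_zero. Proof. en_tac. Qed.
Lemma en_scal_assoc (c d : C) (x : E) : en_scal c (en_scal d x) = en_scal (c * d)%C x. Proof. en_tac. Qed.
Lemma en_scal_one (x : E) : en_scal (RtoC 1) x = x. Proof. en_tac. Qed.
Lemma en_scal_plus (c : C) (x y : E) : en_scal c (en_plus x y) = en_plus (en_scal c x) (en_scal c y). Proof. en_tac. Qed.
Lemma en_scal_plus_l (c d : C) (x : E) : en_scal (c + d)%C x = en_plus (en_scal c x) (en_scal d x). Proof. en_tac. Qed.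

Definition en_q (Z : E) : R :=
  2 * PI * (sumZ (w2 (fun _ => 1) (en_h Z)) + sumZ (w2 (p_symb beta) (en_u Z))).

Lemma en_ex_h (Z : E) : ex_sumZ (w2 (fun _ => 1) (en_h Z)).
Proof.
eapply ex_sumZ_ext; [|apply (en_h_L2 Z)]. intros k; unfold w2; cbv beta.
rewrite Rpower_O; auto. assert (0 <= IZR k ^ 2) by apply pow2_ge_0. lra.
Qed.
Lemma en_ex_u (Z : E) : ex_sumZ (w2 (p_symb beta) (en_u Z)).
Proof.
eapply ex_sumZ_le; [|apply (ex_sumZ_scal (1 + 2 / beta)), (en_u_Hm Z)].
intros k; cbv beta. rewrite Rabs_pos_eq by (apply w2_nonneg; left; apply p_symb_pos).
unfold w2. rewrite <- Rmult_assoc. apply Rmult_le_compat_r. apply pow_le, Cmod_ge_0.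
apply p_symb_weight.
Qed.

Lemma Re_inner_diag (Z : E) : Re (inner beta Z Z) = en_q Z.
Proof.
unfold inner, en_q. rewrite re_plus, !re_scal_l, Rmult_plus_distr_l.
unfold sumZC; cbn [Re fst]. unfold w2.
f_equal; f_equal; apply sumZ_ext; intros k.
- rewrite <- Cmod2_conj. rewrite Rmult_1_l. reflexivity.
- rewrite <- Cmult_assoc, <- Cmod2_conj, <- RtoC_mult. reflexivity.
Qed.

Lemma enormE (Z : E) : enorm beta Z = sqrt (en_q Z).
Proof. unfold enorm; now rewrite Re_inner_diag. Qed.

Lemma en_q_nonneg (Z : E) : 0 <= en_q Z.
Proof.
assert (Hpi := PI_RGT_0). unfold en_q. apply Rmult_le_pos. lra. apply Rplus_le_le_0_compat;
(apply sumZ_nonneg; [intros; apply w2_nonneg | ]).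
lra. apply en_ex_h. left; apply p_symb_pos. apply en_ex_u.
Qed.

Lemma en_q_eq0 (Z : E) : en_q Z = 0 -> Z = en_zero.
Proof.
intros H. assert (Hpi := PI_RGT_0). unfold en_q in H.
assert (A : 0 <= sumZ (w2 (fun _ => 1) (en_h Z))).
{ apply sumZ_nonneg. intros; apply w2_nonneg; lra. apply en_ex_h. }
assert (B : 0 <= sumZ (w2 (p_symb beta) (en_u Z))).
{ apply sumZ_nonneg. intros; apply w2_nonneg; left; apply p_symb_pos. apply en_ex_u. }
apply energy_ext; simpl.
- apply (w2_eq0 (fun _ => 1)). intros; lra. apply en_ex_h. nra.
- apply (w2_eq0 (p_symb beta)). apply p_symb_pos. apply en_ex_u. nra.
Qed.

Lemma enorm_nonneg (Z : E) : 0 <= enorm beta Z.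
Proof. apply sqrt_pos. Qed.
Lemma enorm_eq0 (Z : E) : enorm beta Z = 0 -> Z = en_zero.
Proof. rewrite enormE; intros H. apply en_q_eq0, sqrt_eq_0; auto. apply en_q_nonneg. Qed.

Lemma enorm_scal (c : C) (Z : E) : enorm beta (en_scal c Z) = Cmod c * enorm beta Z.
Proof.
rewrite !enormE. replace (en_q (en_scal c Z)) with (Cmod c ^ 2 * en_q Z).
rewrite sqrt_mult, sqrt_pow2; auto using Cmod_ge_0, en_q_nonneg. apply pow2_ge_0.
unfold en_q; cbn [en_h en_u en_scal]. rewrite !w2_scal. ring.
Qed.

Lemma enorm_zero : enorm beta en_zero = 0.
Proof.
replace en_zero with (en_scal (RtoC 0) en_zero) by en_tac. rewrite enorm_scal, Cmod_0; ring.
Qed.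

Lemma enorm_triangle (Z W : E) : enorm beta (en_plus Z W) <= enorm beta Z + enorm beta W.
Proof.
assert (A := enorm_nonneg Z). assert (B := enorm_nonneg W).
destruct (Req_dec (enorm beta Z) 0) as [A0|A0].
{ rewrite (enorm_eq0 _ A0), en_plus_comm, en_plus_zero, enorm_zero. lra. }
destruct (Req_dec (enorm beta W) 0) as [B0|B0].
{ rewrite (enorm_eq0 _ B0), en_plus_zero, enorm_zero. lra. }
assert (QA : en_q Z = enorm beta Z ^ 2).
{ rewrite enormE, pow2_sqrt; auto using en_q_nonneg. }
assert (QB : en_q W = enorm beta W ^ 2).
{ rewrite enormE, pow2_sqrt; auto using en_q_nonneg. }
rewrite (enormE (en_plus Z W)).
set (x := enorm beta Z) in *; set (y := enorm beta W) in *.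
rewrite <- (sqrt_pow2 (x + y)) by lra. apply sqrt_le_1_alt.
set (t := x / (x + y)).
assert (T1 : 0 < t) by (apply Rdiv_lt_0_compat; lra).
assert (T2 : 1 - t = y / (x + y)) by (unfold t; field; lra).
assert (T3 : 0 < 1 - t) by (rewrite T2; apply Rdiv_lt_0_compat; lra).
assert (Ht : 0 < t < 1) by lra.
assert (K : en_q (en_plus Z W) <= / t * en_q Z + / (1 - t) * en_q W).
{ unfold en_q; cbn [en_h en_u en_plus]. assert (Hpi := PI_RGT_0).
  assert (C1 := w2_conv (fun _ => 1) (en_h Z) (en_h W) t Ht (fun _ => Rle_0_1) (en_ex_h Z) (en_ex_h W)).
  assert (C2 := w2_conv (p_symb beta) (en_u Z) (en_u W) t Ht (fun k => Rlt_le _ _ (p_symb_pos beta k)) (en_ex_u Z) (en_ex_u W)).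
  match goal with |- _ * (?a + ?b) <= / t * (_ * (?c + ?d)) + _ * (_ * (?e + ?f)) =>
   apply Rle_trans with (2 * PI * ((/ t * c + / (1 - t) * e) + (/ t * d + / (1 - t) * f))) end.
  apply Rmult_le_compat_l; lra. right; ring. }
eapply Rle_trans. exact K. rewrite QA, QB, T2. unfold t. right; field. lra.
Qed.

Definition en_AbelianMonoid_mixin :=
  AbelianMonoid.Mixin E en_plus en_zero en_plus_comm en_plus_assoc en_plus_zero.
Canonical en_AbelianMonoid := AbelianMonoid.Pack E en_AbelianMonoid_mixin E.
Definition en_AbelianGroup_mixin :=
  AbelianGroup.Mixin en_AbelianMonoid en_opp en_plus_opp.
Canonical en_AbelianGroup :=
  AbelianGroup.Pack E (AbelianGroup.Class _ _ en_AbelianGroup_mixin) E.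
Definition en_ModuleSpace_mixin :=
  ModuleSpace.Mixin C_Ring en_AbelianGroup en_scal en_scal_assoc en_scal_one en_scal_plus en_scal_plus_l.
Canonical en_ModuleSpace :=
  ModuleSpace.Pack C_Ring E (ModuleSpace.Class _ _ _ en_ModuleSpace_mixin) E.

Definition en_ball (x : E) (e : R) (y : E) : Prop := enorm beta (minus y x) < e.

Lemma enorm_minus_sym (x y : E) : enorm beta (minus x y) = enorm beta (minus y x).
Proof.
replace (minus x y) with (en_opp (minus y x)).
unfold en_opp. rewrite enorm_scal, Cmod_R, Rabs_left by lra. ring.
unfold minus, plus, opp; simpl. en_tac.
Qed.
Lemma en_ball_center (x : E) (e : posreal) : en_ball x e x.
Proof. unfold en_ball. rewrite minus_eq_zero. change zero with en_zero. rewrite enorm_zero. apply cond_pos. Qed.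
Lemma en_ball_sym (x y : E) (e : R) : en_ball x e y -> en_ball y e x.
Proof. unfold en_ball; now rewrite enorm_minus_sym. Qed.
Lemma en_ball_triangle (x y z : E) (e1 e2 : R) :
  en_ball x e1 y -> en_ball y e2 z -> en_ball x (e1 + e2) z.
Proof.
unfold en_ball; intros H1 H2. rewrite (minus_trans y).
eapply Rle_lt_trans. apply enorm_triangle. lra.
Qed.
Definition en_UniformSpace_mixin :=
  UniformSpace.Mixin E en_zero en_ball en_ball_center en_ball_sym en_ball_triangle.
Canonical en_UniformSpace := UniformSpace.Pack E en_UniformSpace_mixin E.
Canonical en_NormedModuleAux := NormedModuleAux.Pack C_AbsRing E
  (NormedModuleAux.Class C_AbsRing E (ModuleSpace.class _ en_ModuleSpace) (UniformSpace.class en_UniformSpace)) E.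

Lemma en_norm_scal_le (c : C_AbsRing) (x : en_NormedModuleAux) : 
  enorm beta (scal c x) <= abs c * enorm beta x.
Proof. right; apply enorm_scal. Qed.
Lemma en_norm_compat1 (x y : en_NormedModuleAux) (e : R) : enorm beta (minus y x) < e -> ball x e y.
Proof. auto. Qed.
Lemma en_norm_compat2 (x y : en_NormedModuleAux) (e : posreal) :
  ball x e y -> enorm beta (minus y x) < 1 * e.
Proof. rewrite Rmult_1_l; auto. Qed.
Definition en_NormedModule_mixin := NormedModule.Mixin C_AbsRing en_NormedModuleAux
  (enorm beta) 1 enorm_triangle en_norm_scal_le en_norm_compat1 en_norm_compat2 enorm_eq0.
Canonical en_NormedModule := NormedModule.Pack C_AbsRing E
  (NormedModule.Class C_AbsRing E _ en_NormedModule_mixin) E.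
End EnergySpace.

(* A complex normed module as a real one, with the same norm and topology: time
   derivatives and integrals are taken over R. *)
Section Realification.
Context (X : NormedModule C_AbsRing).
Definition rscal (r : R) (x : X) : X := scal (K := C_Ring) (RtoC r) x.
Lemma rscal_assoc (r s : R) (x : X) : rscal r (rscal s x) = rscal (r * s) x.
Proof.
unfold rscal. rewrite scal_assoc, RtoC_mult. reflexivity.
Qed.
Lemma rscal_one (x : X) : rscal 1 x = x.
Proof. apply (scal_one (K := C_Ring)). Qed.
Lemma rscal_distr_l (r : R) (x y : X) : rscal r (plus x y) = plus (rscal r x) (rscal r y).
Proof. exact (scal_distr_l (V := NormedModule.ModuleSpace _ X) (RtoC r) x y). Qed.
Lemma rscal_distr_r (r s : R) (x : X) : rscal (r + s) x = plus (rscal r x) (rscal s x).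
Proof.
unfold rscal. rewrite RtoC_plus.
exact (scal_distr_r (V := NormedModule.ModuleSpace _ X) (RtoC r) (RtoC s) x).
Qed.
Definition real_ModuleSpace_mixin :=
  ModuleSpace.Mixin R_Ring (NormedModule.AbelianGroup _ X) rscal rscal_assoc rscal_one rscal_distr_l rscal_distr_r.
Definition real_NormedModuleAux : NormedModuleAux R_AbsRing :=
  NormedModuleAux.Pack R_AbsRing X
   (NormedModuleAux.Class R_AbsRing X
     (ModuleSpace.Class R_Ring X _ real_ModuleSpace_mixin) (UniformSpace.class (NormedModule.UniformSpace _ X))) X.
Lemma real_norm_scal (r : R_AbsRing) (x : real_NormedModuleAux) :
  norm (K := C_AbsRing) (V := X) (scal r x) <= abs r * norm (K := C_AbsRing) (V := X) x.
Proof.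
eapply Rle_trans. apply (norm_scal (K := C_AbsRing) (V := X) (RtoC r) x).
apply Req_le. f_equal. apply Cmod_R.
Qed.
Definition real_NormedModule_mixin :=
  NormedModule.Mixin R_AbsRing real_NormedModuleAux (norm (K := C_AbsRing) (V := X))
   (norm_factor (K := C_AbsRing) (V := X))
   (norm_triangle (K := C_AbsRing) (V := X)) real_norm_scal
   (norm_compat1 (K := C_AbsRing) (V := X)) (norm_compat2 (K := C_AbsRing) (V := X))
   (norm_eq_zero (K := C_AbsRing) (V := X)).
Definition realify : NormedModule R_AbsRing :=
  NormedModule.Pack R_AbsRing X (NormedModule.Class R_AbsRing X _ real_NormedModule_mixin) X.
End Realification.

(* An operator on X with domain is given by its graph: [G x y] means that x is
   in the domain and y is its image. Functions of time are functions on R of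
   which only the values on [0, oo) matter; limits and derivatives at t >= 0
   are taken within [0, oo), hence one-sided at t = 0. *)
Section Semigroups.
Context {X : NormedModule C_AbsRing}.

Definition half_line (t : R) : (R -> Prop) -> Prop :=
  within (fun s => 0 <= s) (locally t).

Definition continuous_half (Z : R -> X) : Prop :=
  forall t, 0 <= t -> filterlim Z (half_line t) (locally (Z t)).

Definition is_derive_half (Z : R -> X) (t : R) (l : X) : Prop :=
  filterdiff (U := R_NormedModule) (V := realify X) Z (half_line t)
    (fun s => scal (V := realify X) s l).

Definition C0_semigroup (S : R -> X -> X) : Prop :=
  (forall t, 0 <= t -> is_linear (K := C_AbsRing) (S t)) /\
  (forall x, S 0 x = x) /\
  (forall s t x, 0 <= s -> 0 <= t -> S (s + t) x = S s (S t x)) /\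
  (forall x, filterlim (fun t => S t x) (at_right 0) (locally x)).

Definition generates (G : X -> X -> Prop) (S : R -> X -> X) : Prop :=
  forall x y, G x y <->
    filterlim (fun t => scal (RtoC (/ t)) (minus (S t x) x)) (at_right 0) (locally y).

(* Z(t) = x + A int_0^t Z(s) ds *)
Definition mild_solution (G : X -> X -> Prop) (x : X) (Z : R -> X) : Prop :=
  continuous_half Z /\
  forall t, 0 <= t -> exists I AI : X,
    is_RInt (V := realify X) Z 0 t I /\ G I AI /\ Z t = plus x AI.

Definition C1_half (Z Z' : R -> X) : Prop :=
  continuous_half Z' /\ forall t, 0 <= t -> is_derive_half Z t (Z' t).

Definition classical_solution (G : X -> X -> Prop) (x : X) (Z : R -> X) : Prop :=
  Z 0 = x /\
  exists Z' : R -> X, C1_half Z Z' /\ forall t, 0 <= t -> G (Z t) (Z' t).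

(* continuity of Z : [0, oo) -> D(A) for the graph norm |x| + |A x| *)
Definition continuous_graph (G : X -> X -> Prop) (Z : R -> X) : Prop :=
  exists AZ : R -> X, (forall t, 0 <= t -> G (Z t) (AZ t)) /\
  forall t, 0 <= t ->
    filterlim (fun s => norm (minus (Z s) (Z t)) + norm (minus (AZ s) (AZ t)))
      (half_line t) (locally 0).
End Semigroups.

(* The operators are defined on all pairs of distributions, then restricted. *)
Definition opA (beta : posreal) (Z : distT * distT) : distT * distT :=
  (Tbeta beta (snd Z), d_opp (d_deriv (fst Z))).

Definition opD (beta : posreal) (a b : smoothT) (Z : distT * distT) : distT * distT :=
  (d_smult (s_mult a a) (fst Z), d_smult (s_mult b b) (Pbeta beta (snd Z))).

Definition opAd (beta : posreal) (a b : smoothT) (Z : distT * distT) : distT * distT :=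
  let A := opA beta Z in let D := opD beta a b Z in
  (d_plus (fst A) (d_opp (fst D)), d_plus (snd A) (d_opp (snd D))).

Definition domA (beta : posreal) (Z : energy beta) : Prop :=
  Hs (/ 2) (en_h Z) /\ Hs 0 (en_u Z).

Definition graphAd (beta : posreal) (a b : smoothT) (Z W : energy beta) : Prop :=
  domA beta Z /\ (en_h W, en_u W) = opAd beta a b (en_h Z, en_u Z).

(* Main.v *)
Require Import Defs.
From Stdlib Require Import Reals Lra Lia Psatz.
From Stdlib Require Import FunctionalExtensionality PropExtensionality ClassicalEpsilon IndefiniteDescription.
From Coquelicot Require Import Coquelicot.
From Corelib Require Import ssreflect.
Open Scope R_scope.

(** The undamped operator is skew-adjoint and diagonal in Fourier series, and the
    damping is a bounded perturbation of it.

    Write [p] for the symbol of P. In the coordinates [x k = h^(k)] and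
    [y k = sqrt (p k) * u^(k)] the energy norm is, up to a constant, the [l2] norm
    of the pair [(x, y)], and the undamped system reads [x' = - i theta y],
    [y' = - i theta x] with the real frequencies [theta k = k sqrt (p k)]. Its flow
    is therefore the unitary rotation by the angle [theta k * t] in each mode.
    Dominated convergence for sums over the integers gives the strong continuity
    of this flow and identifies its generator ([undamped_group]); since [p k] is
    comparable to [1 / (1 + |k|)], the domain found this way, [theta x] and
    [theta y] in [l2], is H^(1/2) x L^2 ([domA_iff]).

    The damping operator is bounded because P maps H^(-1/2) into L^2 and
    multiplication by a smooth function is bounded on L^2. For distributions the
    latter is obtained by duality from Parseval's formula ([smult_L2_bounded]).

    The rest takes place in an abstract Banach space, and the energy space is one
    by [energy_complete]. If [U] is a contraction group and [B] is bounded, then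
    [S t = U t V t], where [V] solves the linear Volterra equation
    [V t x = x - int_0^t U(-s) B U(s) V s x ds] with bounded kernel. Picard
    iteration in a weighted norm solves it, uniqueness gives linearity and the
    group law of [S], and differentiating at 0 shows that the generator of [S] is
    that of [U] minus [B] ([bounded_perturbation]). Because the perturbed
    equation generates a group, and not only a semigroup, uniqueness of classical
    solutions [Z] amounts to the vanishing of the derivative of [S (- t) (Z t)]
    ([classical_unique]); mild solutions are treated by integrating their
    difference in time ([mild_unique]). *)

(** * Limits, difference quotients and integrals in a normed space *)

Section AbelianGroupIdentities.
Context {G : AbelianGroup}.

Lemma minusE (x y : G) : minus x y = plus x (opp y).
Proof. reflexivity. Qed.

Lemma plus_minus_cancel (x y : G) : plus (minus x y) y = x.
Proof. rewrite minusE -plus_assoc plus_opp_l. apply plus_zero_r. Qed.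

Lemma minus_plus_l (x y : G) : minus (plus x y) x = y.
Proof. rewrite minusE (plus_comm x y) -plus_assoc plus_opp_r. apply plus_zero_r. Qed.

Lemma minus_minus_l (x y : G) : minus x (minus x y) = y.
Proof. rewrite !minusE opp_plus opp_opp plus_assoc plus_opp_r. apply plus_zero_l. Qed.

Lemma minus_plus_distr (a b c d : G) :
  minus (plus a b) (plus c d) = plus (minus a c) (minus b d).
Proof.
rewrite !minusE opp_plus !plus_assoc. f_equal.
rewrite -!plus_assoc. f_equal. apply plus_comm.
Qed.
End AbelianGroupIdentities.

Section NormedCalculus.
Context {Y : NormedModule R_AbsRing}.

Lemma norm_scal_R (k : R) (x : Y) : norm (scal k x) <= Rabs k * norm x.
Proof. exact (norm_scal (K := R_AbsRing) k x). Qed.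

Lemma filterlim_plus2 {T} (F : (T -> Prop) -> Prop) {FF : Filter F} (f g : T -> Y) (x y : Y) :
  filterlim f F (locally x) -> filterlim g F (locally y) ->
  filterlim (fun t => plus (f t) (g t)) F (locally (plus x y)).
Proof. intros Hf Hg. eapply filterlim_comp_2; eauto. apply filterlim_plus. Qed.

Lemma filterlim_opp1 {T} (F : (T -> Prop) -> Prop) {FF : Filter F} (f : T -> Y) (x : Y) :
  filterlim f F (locally x) -> filterlim (fun t => opp (f t)) F (locally (opp x)).
Proof. intros Hf. eapply filterlim_comp; eauto. apply filterlim_opp. Qed.

Lemma filterlim_minus2 {T} (F : (T -> Prop) -> Prop) {FF : Filter F} (f g : T -> Y) (x y : Y) :
  filterlim f F (locally x) -> filterlim g F (locally y) ->
  filterlim (fun t => minus (f t) (g t)) F (locally (minus x y)).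
Proof. intros Hf Hg. apply: filterlim_plus2; auto. now apply filterlim_opp1. Qed.

Lemma filterlim_squeeze_zero {T} (F : (T -> Prop) -> Prop) {FF : Filter F} (f : T -> Y) (g : T -> R) :
  F (fun t => norm (f t) <= g t) -> filterlim g F (locally 0) ->
  filterlim f F (locally (zero : Y)).
Proof.
intros Hle Hg. apply filterlim_locally_ball_norm; intros eps.
assert (H := proj1 (filterlim_locally g 0) Hg eps).
generalize (filter_and _ _ Hle H). apply filter_imp; intros t [A B].
unfold ball_norm. rewrite minus_zero_r.
unfold ball in B; simpl in B. unfold AbsRing_ball, abs, minus, plus, opp in B; simpl in B.
apply Rabs_def2 in B. lra.
Qed.

Lemma filterlim_minus_zero {T} (F : (T -> Prop) -> Prop) {FF : Filter F} (f : T -> Y) (l : Y) :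
  filterlim f F (locally l) <-> filterlim (fun t => norm (minus (f t) l)) F (locally 0).
Proof.
split; intros H.
- rewrite -(norm_zero (V := Y)). rewrite -(minus_eq_zero l).
  eapply filterlim_comp; [|apply filterlim_norm].
  apply: filterlim_minus2; auto. apply filterlim_const.
- apply filterlim_ext with (fun t => plus (minus (f t) l) l).
  intros; apply: plus_minus_cancel.
  rewrite -[X in locally X](plus_zero_l l). apply: filterlim_plus2; [|apply filterlim_const].
  refine (filterlim_squeeze_zero F _ _ _ H). apply filter_forall; intros; apply Rle_refl.
Qed.

(** Differentiability is expressed as convergence of difference quotients along a
    punctured filter: product rules then become statements of joint continuity,
    for two-sided and one-sided derivatives alike. *)
Definition quot (f : R -> Y) (t s : R) : Y := scal (/ (s - t)) (minus (f s) (f t)).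

Definition punctured (F : (R -> Prop) -> Prop) (t : R) : (R -> Prop) -> Prop :=
  within (fun s => s <> t) F.

Global Instance punctured_filter F {FF : Filter F} t : Filter (punctured F t).
Proof. apply within_filter; auto. Qed.

Lemma quot_iff (F : (R -> Prop) -> Prop) {FF : Filter F} (f : R -> Y) (t : R) (l : Y) :
  (forall eps : posreal, F (fun s => norm (minus (minus (f s) (f t)) (scal (s - t) l))
      <= eps * Rabs (s - t))) <->
  filterlim (quot f t) (punctured F t) (locally l).
Proof.
assert (E : forall s, s <> t ->
  minus (quot f t s) l = scal (/ (s - t)) (minus (minus (f s) (f t)) (scal (s - t) l))).
{ intros s Hs. rewrite scal_minus_distr_l. unfold quot. f_equal.
  rewrite scal_assoc. change (mult (/ (s - t)) (s - t)) with (/ (s - t) * (s - t)).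
  rewrite Rinv_l; [|lra]. symmetry; apply (scal_one l). }
split; intros H.
- apply filterlim_locally_ball_norm; intros eps.
  assert (He : 0 < eps / 2) by (destruct eps; simpl; lra).
  unfold punctured, within. generalize (H (mkposreal _ He)). apply filter_imp; intros s Hs Hn. unfold ball_norm.
  rewrite E //. eapply Rle_lt_trans. apply norm_scal_R.
  rewrite Rabs_inv. simpl in Hs.
  assert (P : 0 < Rabs (s - t)) by (apply Rabs_pos_lt; lra).
  apply Rle_lt_trans with (/ Rabs (s - t) * (eps / 2 * Rabs (s - t))).
  apply Rmult_le_compat_l; auto. left; now apply Rinv_0_lt_compat.
  replace (/ Rabs (s - t) * (eps / 2 * Rabs (s - t))) with (eps / 2) by (field; lra).
  destruct eps; simpl; lra.
- intros eps.
  assert (B := proj1 (filterlim_locally_ball_norm _ _) H eps).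
  unfold punctured, within in B. revert B. apply filter_imp; intros s Hs.
  destruct (Req_dec s t) as [->|Hn].
  + rewrite minus_eq_zero Rminus_diag. rewrite (scal_zero_l l) minus_eq_zero norm_zero Rabs_R0. lra.
  + specialize (Hs Hn). unfold ball_norm in Hs.
    replace (minus (minus (f s) (f t)) (scal (s - t) l)) with (scal (s - t) (minus (quot f t s) l)).
    2:{ rewrite E // scal_assoc. change (mult (s - t) (/ (s - t))) with ((s - t) * / (s - t)).
        rewrite Rinv_r; [|lra]. apply (scal_one (V := Y)). }
    eapply Rle_trans. apply norm_scal_R. rewrite Rmult_comm.
    apply Rmult_le_compat_r. apply Rabs_pos. now left.
Qed.

Lemma filterdiff_quot (F : (R -> Prop) -> Prop) {FF : ProperFilter F} (f : R -> Y) (t : R) (l : Y) :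
  is_filter_lim F t ->
  (filterdiff (U := R_NormedModule) f F (fun s => scal s l) <->
   filterlim (quot f t) (punctured F t) (locally l)).
Proof.
intros Ft. split.
- intros [_ H]. apply quot_iff; auto. apply filter_filter. intros eps. exact (H t Ft eps).
- intros H. split. apply (is_linear_scal_l l). intros x Hx.
  assert (x = t) as ->.
  { exact (is_filter_lim_unique (V := R_NormedModule) _ _ Hx Ft). }
  intros eps. apply (proj2 (quot_iff F f t l) H eps).
Qed.

Lemma is_derive_quot (f : R -> Y) (t : R) (l : Y) :
  is_derive f t l <-> filterlim (quot f t) (punctured (locally t) t) (locally l).
Proof. apply filterdiff_quot. apply locally_filter. intros P; auto. Qed.

Global Instance half_line_proper t : 0 <= t -> ProperFilter (half_line t).
Proof.
intros Ht. split.
- intros P HP. exists t. apply (locally_singleton t _ HP). exact Ht.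
- apply within_filter, locally_filter.
Qed.
Global Instance half_line_filter t : Filter (half_line t).
Proof. apply within_filter, locally_filter. Qed.

Lemma half_line_lim t : is_filter_lim (half_line t) t.
Proof. intros P HP. apply filter_le_within, HP. Qed.

Lemma is_derive_half_quot (f : R -> Y) (t : R) (l : Y) : 0 <= t ->
  (filterdiff (U := R_NormedModule) f (half_line t) (fun s => scal s l) <->
   filterlim (quot f t) (punctured (half_line t) t) (locally l)).
Proof.
intros Ht. assert (FF := half_line_proper t Ht). apply filterdiff_quot; auto. apply half_line_lim.
Qed.

Lemma is_derive_to_half (f : R -> Y) (t : R) (l : Y) : 0 <= t -> is_derive f t l ->
  filterdiff (U := R_NormedModule) f (half_line t) (fun s => scal s l).
Proof.
intros Ht H. apply is_derive_half_quot; auto. apply is_derive_quot in H.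
eapply filterlim_filter_le_1; [|exact H].
intros P HP. unfold punctured, half_line, within in *.
revert HP. apply filter_imp. tauto.
Qed.

Lemma quot_at_right (f : R -> Y) (l : Y) :
  filterlim (quot f 0) (punctured (locally 0) 0) (locally l) ->
  filterlim (fun h => scal (/ h) (minus (f h) (f 0))) (at_right 0) (locally l).
Proof.
intros H. apply filterlim_ext with (quot f 0).
intros h; unfold quot; now rewrite Rminus_0_r.
eapply filterlim_filter_le_1; [|exact H].
intros P HP. unfold at_right, punctured, within in *. revert HP; apply filter_imp.
intros s Hs Hp. apply Hs. lra.
Qed.

(** Bounded linear maps commute with Riemann sums. *)
Lemma is_RInt_linear {Z : NormedModule R_AbsRing} (L : Y -> Z) (f : R -> Y) (a b : R) (I : Y) :
  is_linear L -> is_RInt f a b I -> is_RInt (fun s => L (f s)) a b (L I).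
Proof.
intros HL H. unfold is_RInt in *.
apply filterlim_ext with (fun ptd => L (scal (sign (b - a)) (Riemann_sum f ptd))).
- intros ptd. rewrite (linear_scal L HL (sign (b - a))). f_equal.
  apply (SF_cons_ind (fun p => L (Riemann_sum f p) = Riemann_sum (fun s => L (f s)) p)).
  + intros x. exact (linear_zero L HL).
  + intros h p IH. rewrite !Riemann_sum_cons (linear_plus L HL) IH. f_equal.
    apply (linear_scal L HL).
- eapply filterlim_comp; [exact H|]. apply linear_cont, HL.
Qed.

Lemma is_RInt_shift (f : R -> Y) (a b v : R) (I : Y) :
  is_RInt f (a + v) (b + v) I -> is_RInt (fun s => f (s + v)) a b I.
Proof.
intros H. apply is_RInt_ext with (fun y => scal 1 (f (1 * y + v))).
- intros x _. rewrite Rmult_1_l. apply (scal_one (V := Y)).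
- apply (is_RInt_comp_lin f 1 v). now rewrite !Rmult_1_l.
Qed.

(** Carrying a continuous bound [phi] in the definition spares the uniform
    boundedness principle. *)
Record strongly_continuous (T : R -> Y -> Y) (phi : R -> R) : Prop := {
  sc_linear : forall t, is_linear (T t);
  sc_bound : forall t x, norm (T t x) <= phi t * norm x;
  sc_phi : forall t, continuous phi t;
  sc_cont : forall x t, continuous (fun s => T s x) t }.

(** The bound makes the family equicontinuous near each parameter, so strong
    continuity upgrades to joint continuity. *)
Lemma sc_joint T phi : strongly_continuous T phi ->
  forall {A} (F : (A -> Prop) -> Prop) {FF : Filter F} (f : A -> R) (x : A -> Y) t x0,
  filterlim f F (locally t) -> filterlim x F (locally x0) ->
  filterlim (fun a => T (f a) (x a)) F (locally (T t x0)).
Proof.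
intros [Tl Tb Tp Tc] A F FF f x t x0 Hf Hx.
apply filterlim_ext with (fun a => plus (T (f a) (minus (x a) x0)) (T (f a) x0)).
{ intros a. rewrite (linear_minus _ _ _ (Tl (f a))). apply: plus_minus_cancel. }
rewrite -(plus_zero_l (T t x0)). apply: filterlim_plus2.
- apply: (filterlim_squeeze_zero F _ (fun a => phi (f a) * norm (minus (x a) x0))).
  + apply filter_forall; intros; apply Tb.
  + rewrite -(Rmult_0_r (phi t)).
    apply (filterlim_comp_2 (H := locally 0) (I := locally (phi t * 0)) (G := locally (phi t))
       (fun a => phi (f a)) (fun a => norm (minus (x a) x0)) Rmult).
    * exact (filterlim_comp _ _ _ f phi _ _ _ Hf (Tp t)).
    * now apply filterlim_minus_zero.
    * apply (filterlim_mult (K := R_AbsRing)).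
- exact (filterlim_comp _ _ _ f (fun s => T s x0) _ _ _ Hf (Tc x0 t)).
Qed.

Lemma sc_continuous T phi (f : R -> R) (g : R -> Y) t : strongly_continuous T phi ->
  continuous f t -> continuous g t -> continuous (fun s => T (f s) (g s)) t.
Proof. intros H Hf Hg. eapply sc_joint; eauto. apply locally_filter. Qed.

End NormedCalculus.

(** * Linear integral equations in a Banach space *)

Section Volterra.
Context {Y : CompleteNormedModule R_AbsRing}.

Lemma is_RInt_continuous (f : R -> Y) a b :
  (forall t, continuous f t) -> is_RInt f a b (RInt f a b).
Proof. intros H. apply RInt_correct, ex_RInt_continuous. intros; apply H. Qed.

Lemma is_derive_primitive (f : R -> Y) a t :
  (forall t, continuous f t) -> is_derive (fun s => RInt f a s) t (f t).
Proof.
intros H. apply (is_derive_RInt f _ a). 2: apply H.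
apply filter_forall; intros s. now apply is_RInt_continuous.
Qed.

Lemma exp_nondecreasing (r s : R) : r <= s -> exp r <= exp s.
Proof. intros [H| ->]; [left; now apply exp_increasing | apply Rle_refl]. Qed.

Lemma RInt_point_zero (f : R -> Y) a : RInt f a a = zero.
Proof. apply is_RInt_unique. apply: is_RInt_point. Qed.

Lemma is_derive_cont (f : R -> Y) t l : is_derive f t l -> continuous f t.
Proof. intros H. apply: filterdiff_continuous. eexists; exact H. Qed.

Lemma zero_derivative_constant (f : R -> Y) a b :
  (forall t, is_derive f t zero) -> f a = f b.
Proof.
intros H.
assert (I : is_RInt (fun _ => zero : Y) a b (minus (f b) (f a))).
{ apply: (is_RInt_derive f (fun _ => zero : Y)). intros; apply H. intros; apply continuous_const. }
assert (J := is_RInt_const a b (zero : Y)).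
apply is_RInt_unique in I. apply is_RInt_unique in J. rewrite I in J.
rewrite scal_zero_r in J.
rewrite -(plus_minus_cancel (f b) (f a)). rewrite J. symmetry; apply: plus_zero_l.
Qed.

Lemma geometric_limit (u : nat -> Y) (A : R) :
  (forall n, norm (minus (u (S n)) (u n)) <= A * (/ 2) ^ n) ->
  exists l, filterlim u eventually (locally l) /\
    forall n, norm (minus l (u n)) <= 2 * A * (/ 2) ^ n.
Proof.
intros H.
assert (A0 : 0 <= A).
{ specialize (H 0%nat). simpl in H. rewrite Rmult_1_r in H.
  eapply Rle_trans; [apply: norm_ge_0 | exact H]. }
assert (P : forall p n, norm (minus (u (n + p)%nat) (u n)) <= 2 * A * (/ 2) ^ n * (1 - (/ 2) ^ p)).
{ induction p as [|p IH]; intros n.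
  - rewrite Nat.add_0_r minus_eq_zero norm_zero. simpl. lra.
  - rewrite (minus_trans (u (n + p)%nat)) Nat.add_succ_r. eapply Rle_trans. apply: norm_triangle.
    specialize (IH n). specialize (H (n + p)%nat). rewrite pow_add in H.
    replace (2 * A * (/ 2) ^ n * (1 - (/ 2) ^ S p)) with
      (A * ((/ 2) ^ n * (/ 2) ^ p) + 2 * A * (/ 2) ^ n * (1 - (/ 2) ^ p)) by (simpl; field).
    now apply Rplus_le_compat. }
assert (Q : forall n m, (n <= m)%nat -> norm (minus (u m) (u n)) <= 2 * A * (/ 2) ^ n).
{ intros n m L. replace m with (n + (m - n))%nat by lia. eapply Rle_trans. apply P.
  assert (0 < (/ 2) ^ (m - n)) by (apply pow_lt; lra).
  assert (0 < (/ 2) ^ n) by (apply pow_lt; lra).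
  assert (0 <= 2 * A * (/ 2) ^ n) by nra. nra. }
assert (HC : exists l, filterlim u eventually (locally l)).
{ apply (filterlim_locally_cauchy (U := Y)). intros eps.
  assert (L : is_lim_seq (fun n => 4 * A * (/ 2) ^ n) 0).
  { replace (Finite 0) with (Rbar_mult (4 * A) 0) by (simpl; f_equal; ring).
    apply is_lim_seq_scal_l, is_lim_seq_geom. rewrite Rabs_pos_eq; lra. }
  apply is_lim_seq_spec in L. destruct (L eps) as [N HN].
  exists (fun n => (N <= n)%nat). split. now exists N.
  intros n m Hn Hm. apply: norm_compat1. rewrite (minus_trans (u N)).
  eapply Rle_lt_trans. apply: norm_triangle.
  assert (B1 := Q N m Hm). assert (B2 := Q N n Hn).
  rewrite -norm_opp opp_minus in B2.
  specialize (HN N (Nat.le_refl N)). rewrite Rminus_0_r in HN. apply Rabs_def2 in HN.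
  eapply Rle_lt_trans. apply Rplus_le_compat; [exact B1 | exact B2]. lra. }
destruct HC as [l Hl]. exists l; split; auto. intros n.
assert (F : filterlim (fun m => norm (minus (u m) (u n))) eventually (locally (norm (minus l (u n))))).
{ eapply filterlim_comp; [|apply: filterlim_norm].
  apply: filterlim_minus2; [exact Hl | apply filterlim_const]. }
assert (R := fun Hle => filterlim_le (F := eventually) _ (fun _ => 2 * A * (/ 2) ^ n)
  (Finite (norm (minus l (u n)))) (Finite (2 * A * (/ 2) ^ n)) Hle F
  (filterlim_const (F := eventually) (2 * A * (/ 2) ^ n))).
apply R. exists n. intros m Hm. now apply Q.
Qed.

Context (K : R -> Y -> Y) (C : R).
Hypothesis C_pos : 0 < C.
Hypothesis K_sc : strongly_continuous K (fun _ => C).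

Lemma volterra_integrand_continuous (f : R -> Y) :
  (forall t, continuous f t) -> forall t, continuous (fun s => K s (f s)) t.
Proof. intros H t. apply: (sc_continuous K _ (fun s => s) f t K_sc). apply continuous_id. apply H. Qed.

Lemma is_RInt_exp w a b : w <> 0 ->
  is_RInt (fun s => w * exp (w * s)) a b (exp (w * b) - exp (w * a)).
Proof.
intros Hw. apply: (is_RInt_derive (fun s => exp (w * s))).
- intros x _. auto_derive; auto; ring.
- intros x _. apply: (ex_derive_continuous (fun s => w * exp (w * s))). auto_derive; auto.
Qed.

(** The integral of [C exp (2 C |s|)] between 0 and [t] is at most half of
    [exp (2 C |t|)]. So in the norm with this weight the Volterra operator contracts
    by 1/2 on every interval, in both directions of time. *)
Lemma volterra_contraction (f : R -> Y) (T A : R) :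
  (forall t, continuous f t) -> (forall s, Rabs s <= T -> norm (f s) <= A * exp (2 * C * Rabs s)) ->
  forall t, Rabs t <= T ->
  norm (RInt (fun s => K s (f s)) 0 t) <= A * / 2 * exp (2 * C * Rabs t).
Proof.
intros Hf HA t Ht.
assert (T0 : 0 <= T) by (eapply Rle_trans; [apply Rabs_pos | exact Ht]).
assert (A0 : 0 <= A).
{ specialize (HA 0). rewrite Rabs_R0 Rmult_0_r exp_0 Rmult_1_r in HA.
  eapply Rle_trans; [apply: norm_ge_0 | apply HA; auto]. }
assert (Kf := volterra_integrand_continuous f Hf).
assert (B : forall s, Rabs s <= T -> norm (K s (f s)) <= C * (A * exp (2 * C * Rabs s))).
{ intros s Hs. eapply Rle_trans. apply (sc_bound _ _ K_sc). apply Rmult_le_compat_l; auto. lra. }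
destruct (Rle_lt_dec 0 t) as [H0|H0].
- rewrite (Rabs_pos_eq t) // in Ht. rewrite Rabs_pos_eq //.
  assert (I := is_RInt_scal _ _ _ (A / 2) _ (is_RInt_exp (2 * C) 0 t ltac:(lra))).
  assert (J := fun P => norm_RInt_le _ _ 0 t _ _ H0 P (is_RInt_continuous _ 0 t Kf) I).
  eapply Rle_trans. apply J.
  + intros s Hs. eapply Rle_trans. apply B. rewrite Rabs_pos_eq; lra.
    rewrite Rabs_pos_eq; [|lra]. right. change (C * (A * exp (2 * C * s)) = A / 2 * (2 * C * exp (2 * C * s))). field.
  + change (A / 2 * (exp (2 * C * t) - exp (2 * C * 0)) <= A * / 2 * exp (2 * C * t)).
    rewrite Rmult_0_r exp_0. lra.
- rewrite (Rabs_left t) // in Ht. rewrite Rabs_left //.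
  assert (I := is_RInt_scal _ _ _ (- (A / 2)) _ (is_RInt_exp (- (2 * C)) t 0 ltac:(lra))).
  assert (J := fun P => norm_RInt_le _ _ t 0 _ _ (Rlt_le _ _ H0) P (is_RInt_continuous _ t 0 Kf) I).
  rewrite (is_RInt_unique _ _ _ _ (is_RInt_swap _ _ _ _ (is_RInt_continuous _ t 0 Kf))) norm_opp.
  eapply Rle_trans. apply J.
  + intros s Hs. eapply Rle_trans. apply B. rewrite Rabs_left1; lra.
    rewrite Rabs_left1; [|lra]. right.
    change (C * (A * exp (2 * C * - s)) = - (A / 2) * (- (2 * C) * exp (- (2 * C) * s))).
    replace (2 * C * - s) with (- (2 * C) * s) by ring. field.
  + change (- (A / 2) * (exp (- (2 * C) * 0) - exp (- (2 * C) * t)) <= A * / 2 * exp (2 * C * - t)).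
    rewrite Rmult_0_r exp_0. replace (2 * C * - t) with (- (2 * C) * t) by ring. lra.
Qed.

Definition volterra (x : Y) (f : R -> Y) (t : R) : Y :=
  minus x (RInt (fun s => K s (f s)) 0 t).

Lemma is_derive_volterra x f t : (forall t, continuous f t) ->
  is_derive (volterra x f) t (opp (K t (f t))).
Proof.
intros Hf. rewrite -(plus_zero_l (opp (K t (f t)))).
apply: is_derive_minus. apply: is_derive_const.
apply (is_derive_primitive (fun s => K s (f s))). now apply volterra_integrand_continuous.
Qed.

Lemma volterra_continuous x f : (forall t, continuous f t) ->
  forall t, continuous (volterra x f) t.
Proof. intros Hf t. eapply is_derive_cont. now apply is_derive_volterra. Qed.

Lemma volterra_minus x y f g t : (forall t, continuous f t) -> (forall t, continuous g t) ->
  minus (volterra x f t) (volterra y g t) =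
  minus (minus x y) (RInt (fun s => K s (minus (f s) (g s))) 0 t).
Proof.
intros Hf Hg. unfold volterra.
assert (I := is_RInt_minus _ _ _ _ _ _
  (is_RInt_continuous _ 0 t (volterra_integrand_continuous f Hf))
  (is_RInt_continuous _ 0 t (volterra_integrand_continuous g Hg))).
rewrite (RInt_ext (fun s => K s (minus (f s) (g s))) (fun s => minus (K s (f s)) (K s (g s)))).
2:{ intros s _. apply: linear_minus. apply (sc_linear _ _ K_sc). }
rewrite (is_RInt_unique _ _ _ _ I).
rewrite !(minusE x) !(minusE (minus _ _)) !minusE !opp_plus !opp_opp -!plus_assoc. f_equal.
rewrite !plus_assoc. f_equal. apply: plus_comm.
Qed.

Fixpoint picard (x : Y) (n : nat) : R -> Y :=
  match n with O => fun _ => x | S n => volterra x (picard x n) end.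

Lemma picard_continuous x n t : continuous (picard x n) t.
Proof.
revert t; induction n; intros t. apply continuous_const. now apply volterra_continuous.
Qed.

Lemma picard_step x n t :
  norm (minus (picard x (S n) t) (picard x n t)) <= norm x * exp (2 * C * Rabs t) * (/ 2) ^ n.
Proof.
assert (E : forall t, norm x * 1 <= norm x * exp (2 * C * Rabs t)).
{ intros s. apply Rmult_le_compat_l. apply: norm_ge_0. rewrite -exp_0.
  apply exp_nondecreasing. assert (0 <= Rabs s) by apply Rabs_pos. nra. }
revert t. induction n as [|n IH]; intros t.
- simpl. unfold volterra. rewrite -norm_opp opp_minus minus_minus_l Rmult_1_r.
  eapply Rle_trans. apply (volterra_contraction (fun _ => x) (Rabs t) (norm x)).
  + intros; apply continuous_const.
  + intros s _. specialize (E s). lra.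
  + apply Rle_refl.
  + assert (0 <= norm x * exp (2 * C * Rabs t)); [|lra].
    apply Rmult_le_pos. apply: norm_ge_0. left; apply exp_pos.
- change (picard x (S (S n)) t) with (volterra x (picard x (S n)) t).
  change (picard x (S n) t) with (volterra x (picard x n) t).
  rewrite volterra_minus; [|intros; apply picard_continuous..].
  rewrite minus_eq_zero -norm_opp opp_minus minus_zero_r.
  eapply Rle_trans.
  apply (volterra_contraction (fun s => minus (picard x (S n) s) (picard x n s))
     (Rabs t) (norm x * (/ 2) ^ n)).
  + intros s. apply: continuous_minus; apply picard_continuous.
  + intros s _. eapply Rle_trans. apply IH. right; ring.
  + apply Rle_refl.
  + right; simpl; ring.
Qed.

Lemma le_half_powers_zero (r A : R) : 0 <= r -> (forall n, r <= A * (/ 2) ^ n) -> r = 0.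
Proof.
intros H0 H. apply Rle_antisym; auto.
assert (L : is_lim_seq (fun n => A * (/ 2) ^ n) 0).
{ replace (Finite 0) with (Rbar_mult A 0) by (simpl; f_equal; ring).
  apply is_lim_seq_scal_l, is_lim_seq_geom. rewrite Rabs_pos_eq; lra. }
exact (is_lim_seq_le (fun _ => r) _ r 0 H (is_lim_seq_const r) L).
Qed.

Lemma norm_eq0 (x : Y) : norm x = 0 -> x = zero.
Proof. apply: norm_eq_zero. Qed.

Lemma minus_eq0 (x y : Y) : minus x y = zero -> x = y.
Proof. intros H. rewrite -(plus_minus_cancel x y) H. apply: plus_zero_l. Qed.

(** The contraction estimate, iterated on the difference of two solutions. *)
Lemma volterra_unique x f g :
  (forall t, continuous f t) -> (forall t, continuous g t) ->
  (forall t, f t = volterra x f t) -> (forall t, g t = volterra x g t) ->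
  forall t, f t = g t.
Proof.
intros Hf Hg Ef Eg t. apply minus_eq0, norm_eq0.
set (d := fun s => minus (f s) (g s)).
assert (Hd : forall s, continuous d s) by (intros s; now apply: continuous_minus).
(* a continuous difference is bounded on the compact interval |s| <= |t| *)
destruct (continuity_ab_maj (fun s => norm (d s)) (- Rabs t) (Rabs t)) as [z [Hz _]].
{ assert (0 <= Rabs t) by apply Rabs_pos. lra. }
{ intros c _. apply continuity_pt_filterlim. apply: (continuous_comp d norm). apply Hd.
  apply: filterlim_norm. }
set (A := norm (d z)).
assert (P : forall n s, Rabs s <= Rabs t -> norm (d s) <= A * (/ 2) ^ n * exp (2 * C * Rabs s)).
{ induction n as [|n IH]; intros s Hs.
  - apply Rle_trans with A. apply Hz. now apply Rabs_le_between. simpl.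
    assert (1 <= exp (2 * C * Rabs s)).
    { rewrite -exp_0. apply exp_nondecreasing. assert (0 <= Rabs s) by apply Rabs_pos. nra. }
    assert (0 <= A) by apply: norm_ge_0. nra.
  - unfold d. rewrite Ef Eg volterra_minus // minus_eq_zero -norm_opp opp_minus minus_zero_r.
    eapply Rle_trans. apply (volterra_contraction d (Rabs t) (A * (/ 2) ^ n)); auto.
    right; simpl; ring. }
apply le_half_powers_zero with (A * exp (2 * C * Rabs t)). apply: norm_ge_0.
intros n. eapply Rle_trans. apply (P n t (Rle_refl _)). right; ring.
Qed.

(** The Picard iterates form a geometric sequence for the weighted norm; their
    limit is locally uniform, hence continuous and a solution. *)
Lemma volterra_solution x : exists f : R -> Y,
  (forall t, continuous f t) /\ (forall t, f t = volterra x f t) /\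
  (forall t, norm (f t) <= 3 * exp (2 * C * Rabs t) * norm x).
Proof.
destruct (functional_choice (fun t l => filterlim (fun n => picard x n t) eventually (locally l) /\
    forall n, norm (minus l (picard x n t)) <= 2 * (norm x * exp (2 * C * Rabs t)) * (/ 2) ^ n))
  as [f Hf].
{ intros t. apply geometric_limit. intros n. apply picard_step. }
assert (B : forall n t, norm (minus (f t) (picard x n t)) <=
   (2 * norm x * (/ 2) ^ n) * exp (2 * C * Rabs t)).
{ intros n t. eapply Rle_trans. apply (proj2 (Hf t) n). right; ring. }
assert (Fc : forall t : R, continuous f t).
{ intros t. refine (proj2 (filterlim_locally_ball_norm (F := locally t) f (f t)) _). intros eps.
  set (M := exp (2 * C * (Rabs t + 1))).
  assert (L : exists n, 2 * norm x * (/ 2) ^ n * M < eps / 3).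
  { assert (L : is_lim_seq (fun n => (2 * norm x * M) * (/ 2) ^ n) 0).
    { replace (Finite 0) with (Rbar_mult (2 * norm x * M) 0) by (simpl; f_equal; ring).
      apply is_lim_seq_scal_l, is_lim_seq_geom. rewrite Rabs_pos_eq; lra. }
    apply is_lim_seq_spec in L. assert (He : 0 < eps / 3) by (destruct eps; simpl; lra).
    destruct (L (mkposreal _ He)) as [n Hn]. exists n. specialize (Hn n (Nat.le_refl n)).
    rewrite Rminus_0_r in Hn. apply Rabs_def2 in Hn. simpl in Hn. destruct Hn as [Hn _].
    eapply Rle_lt_trans; [|exact Hn]. right; ring. }
  destruct L as [n Hn].
  assert (He : 0 < eps / 3) by (destruct eps; simpl; lra).
  assert (N := proj1 (filterlim_locally_ball_norm (F := locally t) _ _) (picard_continuous x n t) (mkposreal _ He)).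
  assert (U : locally t (fun s => Rabs s <= Rabs t + 1)).
  { exists (mkposreal 1 Rlt_0_1). intros s Hs. unfold ball in Hs; simpl in Hs.
    unfold AbsRing_ball, abs, minus, plus, opp in Hs; simpl in Hs.
    assert (T := Rabs_triang_inv s t). unfold Rminus in T. lra. }
  generalize (filter_and _ _ N U). apply filter_imp. intros s [Hs Us].
  unfold ball_norm in Hs |- *. simpl in Hs.
  rewrite (minus_trans (picard x n s)) (minus_trans (picard x n t) (picard x n s)).
  assert (E : forall r, Rabs r <= Rabs t + 1 -> norm (minus (f r) (picard x n r)) < eps / 3).
  { intros r Hr. eapply Rle_lt_trans; [|exact Hn]. eapply Rle_trans. apply B.
    apply Rmult_le_compat_l. apply Rmult_le_pos. assert (0 <= norm x) by apply: norm_ge_0. lra.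
    apply pow_le; lra. apply exp_nondecreasing. nra. }
  assert (E1 := E s Us). assert (E2 := E t ltac:(lra)).
  rewrite -norm_opp opp_minus in E2.
  eapply Rle_lt_trans. apply: norm_triangle.
  eapply Rle_lt_trans. apply Rplus_le_compat_l. apply: norm_triangle.
  replace (pos eps) with (eps / 3 + (eps / 3 + eps / 3)) by field.
  exact (Rplus_lt_compat _ _ _ _ E1 (Rplus_lt_compat _ _ _ _ Hs E2)). }
exists f. split; [exact Fc|]. split.
- intros t. apply minus_eq0, norm_eq0.
  apply le_half_powers_zero with (3 * norm x * exp (2 * C * Rabs t)). apply: norm_ge_0.
  intros n. rewrite (minus_trans (picard x (S n) t)).
  eapply Rle_trans. apply: norm_triangle.
  change (picard x (S n) t) with (volterra x (picard x n) t) at 2.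
  rewrite volterra_minus; [|intros; apply picard_continuous|exact Fc].
  rewrite minus_eq_zero -(norm_opp (minus zero _)) opp_minus minus_zero_r.
  assert (V := volterra_contraction (fun s => minus (picard x n s) (f s))
     (Rabs t) (2 * norm x * (/ 2) ^ n)).
  eapply Rle_trans. apply Rplus_le_compat; [apply B | apply V].
  + intros s. apply: continuous_minus. apply picard_continuous. apply Fc.
  + intros s _. rewrite -norm_opp opp_minus. apply B.
  + apply Rle_refl.
  + simpl. assert (0 <= (/ 2) ^ n) by (apply pow_le; lra).
    assert (0 <= norm x * exp (2 * C * Rabs t)).
    { apply Rmult_le_pos. apply: norm_ge_0. left; apply exp_pos. }
    nra.
- intros t. assert (B0 := B 0%nat t). simpl in B0.
  rewrite -(plus_minus_cancel (f t) x). eapply Rle_trans. apply: norm_triangle.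
  assert (1 <= exp (2 * C * Rabs t)).
  { rewrite -exp_0. apply exp_nondecreasing. assert (0 <= Rabs t) by apply Rabs_pos. nra. }
  assert (0 <= norm x) by apply: norm_ge_0. nra.
Qed.
End Volterra.

(** * Strongly continuous groups and their bounded perturbations *)

Section Groups.
Context {Y : CompleteNormedModule R_AbsRing}.

Record C0_group (S : R -> Y -> Y) (phi : R -> R) : Prop := {
  group_sc : strongly_continuous S phi;
  group_zero : forall x, S 0 x = x;
  group_add : forall s t x, S (s + t) x = S s (S t x) }.

Definition generator (S : R -> Y -> Y) (x y : Y) : Prop :=
  filterlim (fun h => scal (/ h) (minus (S h x) x)) (at_right 0) (locally y).

Lemma at_right_le_locally : filter_le (at_right 0) (locally 0).
Proof. intros P HP. unfold at_right, within. revert HP. apply filter_imp. auto. Qed.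

Lemma filterlim_at_right_id : filterlim (fun h : R => h) (at_right 0) (locally 0).
Proof. intros P HP. apply at_right_le_locally, HP. Qed.

Lemma generator_unique S x y z : generator S x y -> generator S x z -> y = z.
Proof. exact (filterlim_locally_unique (F := at_right 0) (V := Y) _ y z). Qed.

(** Strong continuity at 0 propagates to all times by the group law. *)
Lemma contraction_group (S : R -> Y -> Y) :
  (forall t, is_linear (S t)) -> (forall t x, norm (S t x) <= norm x) ->
  (forall x, S 0 x = x) -> (forall s t x, S (s + t) x = S s (S t x)) ->
  (forall x, filterlim (fun t => S t x) (locally 0) (locally x)) ->
  C0_group S (fun _ => 1).
Proof.
intros L N Z A Cz. split; auto. split; auto.
- intros t x. rewrite Rmult_1_l. apply N.
- intros; apply continuous_const.
- intros x t. unfold continuous.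
  apply filterlim_ext with (fun s => S t (S (s - t) x)).
  { intros s. rewrite -A. f_equal. ring. }
  eapply filterlim_comp; [|apply: linear_cont; apply L].
  apply (filterlim_comp _ _ _ (fun s => s - t) (fun r => S r x) _ (locally 0)).
  + rewrite -(Rminus_diag t). apply: filterlim_minus2. apply filterlim_id. apply filterlim_const.
  + apply Cz.
Qed.

Section Perturbation.
Context (U : R -> Y -> Y) (HU : C0_group U (fun _ => 1)).
Context (B : Y -> Y) (HB : is_linear B) (C : R) (C_pos : 0 < C).
Hypothesis B_bound : forall x, norm (B x) <= C * norm x.

Lemma contraction_norm t x : norm (U t x) <= norm x.
Proof. rewrite -(Rmult_1_l (norm x)). apply (sc_bound _ _ (group_sc _ _ HU)). Qed.

(** The perturbation seen in the frame moving with the unperturbed group. *)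
Definition conjugated (s : R) (x : Y) : Y := U (- s) (B (U s x)).

Lemma conjugated_sc : strongly_continuous conjugated (fun _ => C).
Proof.
assert (L := sc_linear _ _ (group_sc _ _ HU)). split.
- intros t. apply: is_linear_comp; [|apply L]. apply: is_linear_comp; [apply L | exact HB].
- intros t x. eapply Rle_trans. apply contraction_norm. eapply Rle_trans. apply B_bound.
  apply Rmult_le_compat_l. lra. apply contraction_norm.
- intros; apply continuous_const.
- intros x t. apply: (sc_continuous U _ (fun s => - s) (fun s => B (U s x)) t (group_sc _ _ HU)).
  + apply: continuous_opp. apply continuous_id.
  + apply: (continuous_comp (fun s => U s x) B). apply (sc_cont _ _ (group_sc _ _ HU)).
    apply: linear_cont. exact HB.
Qed.

Lemma conjugated_shift r s x : U s (conjugated (r + s) x) = conjugated r (U s x).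
Proof.
unfold conjugated. rewrite -!(group_add _ _ HU). f_equal. ring.
Qed.

(** By uniqueness of solutions this makes the perturbed group commute with
    whatever commutes with the data: with real scalars, and in the complex case
    with multiplication by i. *)
Lemma volterra_linear_image (J : Y -> Y) x f t : is_linear J ->
  (forall s x, J (conjugated s x) = conjugated s (J x)) -> (forall t, continuous f t) ->
  J (volterra conjugated x f t) = volterra conjugated (J x) (fun s => J (f s)) t.
Proof.
intros HJ HK Hf. unfold volterra. rewrite (linear_minus J) //. f_equal.
symmetry. apply is_RInt_unique.
apply is_RInt_ext with (fun s => J (conjugated s (f s))). intros; apply HK.
apply (is_RInt_linear J _ _ _ _ HJ). apply is_RInt_continuous.
apply (volterra_integrand_continuous _ _ conjugated_sc f Hf).
Qed.

Lemma volterra_plus x y f g t : (forall t, continuous f t) -> (forall t, continuous g t) ->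
  plus (volterra conjugated x f t) (volterra conjugated y g t) =
  volterra conjugated (plus x y) (fun s => plus (f s) (g s)) t.
Proof.
intros Hf Hg. unfold volterra. rewrite -minus_plus_distr. f_equal.
symmetry. apply is_RInt_unique.
apply is_RInt_ext with (fun s => plus (conjugated s (f s)) (conjugated s (g s))).
{ intros s _. symmetry. apply: linear_plus. apply (sc_linear _ _ conjugated_sc). }
apply: is_RInt_plus; apply is_RInt_continuous; now apply (volterra_integrand_continuous _ _ conjugated_sc).
Qed.

(** A solution restarted at time [s] and seen in the frame moved by [U s] solves
    the same equation; uniqueness turns this into the group law. *)
Lemma volterra_translate x f s t : (forall t, continuous f t) ->
  (forall t, f t = volterra conjugated x f t) ->
  U s (f (t + s)) = volterra conjugated (U s (f s)) (fun r => U s (f (r + s))) t.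
Proof.
intros Hf Ef. assert (L := sc_linear _ _ (group_sc _ _ HU) s).
assert (Kf := volterra_integrand_continuous _ _ conjugated_sc f Hf).
assert (I1 := is_RInt_continuous _ 0 s Kf).
assert (I2 := is_RInt_continuous _ s (t + s) Kf).
assert (I3 := is_RInt_Chasles _ _ _ _ _ _ I1 I2).
assert (E : f (t + s) = minus (f s) (RInt (fun r => conjugated r (f r)) s (t + s))).
{ rewrite (Ef (t + s)) (Ef s). unfold volterra.
  rewrite (is_RInt_unique _ _ _ _ I3) !minusE opp_plus plus_assoc. reflexivity. }
rewrite E (linear_minus (U s)) //. unfold volterra. f_equal. symmetry. apply is_RInt_unique.
apply is_RInt_ext with (fun r => U s (conjugated (r + s) (f (r + s)))).
{ intros r _. apply conjugated_shift. }
apply (is_RInt_linear (U s) _ _ _ _ L).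
apply (is_RInt_shift (fun r => conjugated r (f r)) 0 t s). now rewrite Rplus_0_l.
Qed.

(** In the moving frame the perturbed equation becomes [V' = - conjugated V],
    an equation with bounded coefficients; its solution, moved back, is the
    perturbed group. *)
Theorem bounded_perturbation : exists (S : R -> Y -> Y) (phi : R -> R),
  C0_group S phi /\
  (forall x y, generator S x y <-> generator U x (plus y (B x))) /\
  (forall J : Y -> Y, is_linear J -> (forall t x, J (U t x) = U t (J x)) ->
     (forall x, J (B x) = B (J x)) -> forall t x, J (S t x) = S t (J x)).
Proof.
assert (Ksc := conjugated_sc). assert (L := sc_linear _ _ (group_sc _ _ HU)).
destruct (functional_choice _ (volterra_solution conjugated C C_pos Ksc)) as [V HV].
assert (Vc : forall x t, continuous (V x) t) by (intros x; apply HV).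
assert (Ve : forall x t, V x t = volterra conjugated x (V x) t) by (intros x; apply HV).
assert (Vb : forall x t, norm (V x t) <= 3 * exp (2 * C * Rabs t) * norm x) by (intros x; apply HV).
assert (Vu : forall x g, (forall t, continuous g t) -> (forall t, g t = volterra conjugated x g t) ->
   forall t, g t = V x t).
{ intros x g Hg Eg. apply (volterra_unique conjugated C C_pos Ksc x); auto. }
assert (V0 : forall x, V x 0 = x).
{ intros x. rewrite Ve. unfold volterra. rewrite RInt_point_zero. apply: minus_zero_r. }
assert (VJ : forall J : Y -> Y, is_linear J -> (forall s x, J (conjugated s x) = conjugated s (J x)) ->
   forall x t, J (V x t) = V (J x) t).
{ intros J HJ HK x t. apply (Vu (J x) (fun t => J (V x t))).
  - intros r. apply: (continuous_comp (V x) J). apply Vc. apply: linear_cont. exact HJ.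
  - intros r. rewrite {1}Ve. now apply volterra_linear_image. }
exists (fun t x => U t (V x t)), (fun t => 3 * exp (2 * C * Rabs t)). split; [|split].
- split.
  + split.
    * intros t. split.
      -- intros x y. rewrite -(linear_plus (U t)) //. f_equal. symmetry.
         apply (Vu (plus x y) (fun t => plus (V x t) (V y t))).
         ++ intros r. apply: continuous_plus; apply Vc.
         ++ intros r. rewrite {1}(Ve x) {1}(Ve y). now apply volterra_plus.
      -- intros k x. rewrite -(linear_scal (U t)) //. f_equal. symmetry.
         apply (VJ (fun x => scal k x)).
         ++ exact (is_linear_scal_r (K := R_AbsRing) (V := Y) k Rmult_comm).
         ++ intros s z. symmetry. apply (linear_scal (conjugated s)). apply (sc_linear _ _ Ksc).
      -- exists (3 * exp (2 * C * Rabs t)). split.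
         ++ assert (0 < exp (2 * C * Rabs t)) by apply exp_pos. lra.
         ++ intros x. eapply Rle_trans. apply contraction_norm. apply Vb.
    * intros t x. eapply Rle_trans. apply contraction_norm. apply Vb.
    * intros t. apply: continuous_mult. apply continuous_const.
      apply: (continuous_comp (fun s => 2 * C * Rabs s) exp).
      apply: continuous_mult. apply continuous_const. apply continuous_Rabs.
      apply: ex_derive_continuous. auto_derive; auto.
    * intros x t. apply: (sc_continuous U _ (fun s => s) (V x) t (group_sc _ _ HU)).
      apply continuous_id. apply Vc.
  + intros x. rewrite V0. apply (group_zero _ _ HU).
  + intros s t x. rewrite (group_add _ _ HU). f_equal.
    rewrite -(Vu (U t (V x t)) (fun r => U t (V x (r + t)))) //.
    * intros r. apply: (continuous_comp (fun r => V x (r + t)) (U t)).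
      apply: (continuous_comp (fun r => r + t) (V x)).
      apply: continuous_plus. apply continuous_id. apply continuous_const. apply Vc.
      apply: linear_cont. apply L.
    * intros r. apply (volterra_translate x (V x)); auto.
- intros x y.
  assert (D : filterlim (fun h => U h (scal (/ h) (minus (V x h) x))) (at_right 0) (locally (opp (B x)))).
  { assert (E : U 0 (opp (B x)) = opp (B x)) by apply (group_zero _ _ HU). rewrite -E.
    apply: (sc_joint U _ (group_sc _ _ HU) (at_right 0) (fun h : R => h)). apply filterlim_at_right_id.
    apply filterlim_ext with (fun h => scal (/ h) (minus (V x h) (V x 0))).
    { intros h. now rewrite V0. }
    apply (quot_at_right (V x)). apply is_derive_quot.
    replace (opp (B x)) with (opp (conjugated 0 (V x 0))).
    - apply is_derive_ext with (volterra conjugated x (V x)). intros; now rewrite -Ve.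
      apply (is_derive_volterra _ _ Ksc). apply Vc.
    - rewrite V0. unfold conjugated. rewrite Ropp_0 !(group_zero _ _ HU). reflexivity. }
  assert (Q : forall h, scal (/ h) (minus (U h (V x h)) x) =
    plus (U h (scal (/ h) (minus (V x h) x))) (scal (/ h) (minus (U h x) x))).
  { intros h. rewrite (linear_scal (U h)) // (linear_minus (U h)) //.
    rewrite -scal_distr_l. f_equal. apply: minus_trans. }
  split; intros G.
  + replace (plus y (B x)) with (minus y (opp (B x))) by (rewrite minusE opp_opp; reflexivity).
    unfold generator in G |- *.
    apply filterlim_ext with (fun h => minus (scal (/ h) (minus (U h (V x h)) x))
       (U h (scal (/ h) (minus (V x h) x)))).
    { intros h. rewrite Q. apply: minus_plus_l. }
    apply: filterlim_minus2; auto.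
  + replace y with (plus (opp (B x)) (plus y (B x))).
    2:{ rewrite (plus_comm y) plus_assoc plus_opp_l. apply: plus_zero_l. }
    unfold generator in G |- *. eapply filterlim_ext. intros h; symmetry; apply Q.
    apply: filterlim_plus2; auto.
- intros J HJ JU JB t x. rewrite JU. f_equal. apply VJ; auto.
  intros s z. unfold conjugated. rewrite JU JB JU. reflexivity.
Qed.
End Perturbation.
End Groups.

(** * The Cauchy problem for a group *)

Section CauchyProblem.
Context {Y : CompleteNormedModule R_AbsRing}.
Context (S : R -> Y -> Y) (phi : R -> R) (HS : C0_group S phi).

Let S_sc := group_sc _ _ HS.
Let S_linear t : is_linear (S t) := sc_linear _ _ S_sc t.

Lemma orbit_continuous x t : continuous (fun s => S s x) t.
Proof. apply (sc_cont _ _ S_sc). Qed.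

Lemma group_linear_zero t : S t zero = zero.
Proof. exact (linear_zero (S t) (S_linear t)). Qed.

Lemma generator_minus x x' y y' : generator S x y -> generator S x' y' ->
  generator S (minus x x') (minus y y').
Proof.
intros H H'. apply filterlim_ext with (fun h => minus (scal (/ h) (minus (S h x) x))
  (scal (/ h) (minus (S h x') x'))).
{ intros h. rewrite -scal_minus_distr_l. f_equal. rewrite (linear_minus (S h)) //.
  rewrite !minusE !opp_plus !opp_opp -!plus_assoc. f_equal.
  rewrite !plus_assoc. f_equal. apply: plus_comm. }
apply: filterlim_minus2; auto.
Qed.

Lemma generator_invariant x y t : generator S x y -> generator S (S t x) (S t y).
Proof.
intros G. apply filterlim_ext with (fun h => S t (scal (/ h) (minus (S h x) x))).
{ intros h. rewrite (linear_scal (S t)) // (linear_minus (S t)) //. do 2 f_equal.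
  rewrite -!(group_add _ _ HS). f_equal. ring. }
eapply filterlim_comp; [exact G|]. apply: linear_cont. apply S_linear.
Qed.

(** The right derivative at 0 is transported to a left derivative by applying
    [S (-h)], and then to every time by the group law. *)
Lemma orbit_derivative x y t : generator S x y -> is_derive (fun s => S s x) t (S t y).
Proof.
intros G. apply is_derive_quot.
apply filterlim_ext with (fun s => S t (quot (fun r => S r x) 0 (s - t))).
{ intros s. unfold quot. rewrite (linear_scal (S t)) // (linear_minus (S t)) //.
  rewrite -!(group_add _ _ HS) Rplus_0_r Rminus_0_r. do 3 f_equal. ring. }
eapply filterlim_comp; [|apply: linear_cont; apply S_linear].
apply (filterlim_comp _ _ _ (fun s => s - t) (quot (fun r => S r x) 0) _ (punctured (locally 0) 0)).
{ intros P HP. unfold filtermap, punctured, within in *.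
  assert (L : filterlim (fun s => s - t) (locally t) (locally 0)).
  { rewrite -(Rminus_diag t). apply: filterlim_minus2. apply filterlim_id. apply filterlim_const. }
  specialize (L _ HP). unfold filtermap in L. revert L. apply filter_imp.
  intros s H Hs. apply H. lra. }
assert (Gr : filterlim (quot (fun r => S r x) 0) (at_right 0) (locally y)).
{ eapply filterlim_ext; [|exact G]. intros h. unfold quot.
  now rewrite Rminus_0_r (group_zero _ _ HS). }
assert (Gl : filterlim (quot (fun r => S r x) 0) (at_left 0) (locally y)).
{ apply filterlim_ext with (fun h => S h (scal (/ - h) (minus (S (- h) x) x))).
  { intros h. unfold quot. rewrite (linear_scal (S h)) // (linear_minus (S h)) //.
    rewrite -(group_add _ _ HS) Rplus_opp_r Rminus_0_r (group_zero _ _ HS).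
    rewrite -(opp_minus (S h x)) Rinv_opp scal_opp_r.
    change (- / h) with (opp (/ h) : R). by rewrite scal_opp_l opp_opp. }
  rewrite -(group_zero _ _ HS y).
  apply: (sc_joint S _ S_sc (at_left 0) (fun h : R => h)).
  - intros P HP. unfold filtermap, at_left, within. revert HP. apply filter_imp. auto.
  - apply (filterlim_comp _ _ _ Ropp (fun h => scal (/ h) (minus (S h x) x)) _ (at_right 0)); auto.
    assert (L : filterlim Ropp (locally 0) (locally 0)).
    { rewrite -{2}Ropp_0. apply: filterlim_opp. }
    intros P HP. unfold filtermap, at_left, at_right, within in *.
    specialize (L _ HP). unfold filtermap in L. revert L. apply filter_imp.
    intros s H Hs. apply H. lra. }
intros P HP. specialize (Gr P HP). specialize (Gl P HP).
unfold filtermap, punctured, at_left, at_right, within in *.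
generalize (filter_and _ _ Gl Gr). apply filter_imp. intros s [A B] Hs.
destruct (Rtotal_order s 0) as [H|[H|H]]; [now apply A | lra | now apply B].
Qed.

(** [S h] shifts the time integral of an orbit, so the quotient that defines the
    generator is the difference of the difference quotients of the primitive at
    [t] and at 0. *)
Lemma orbit_primitive_generator x t : generator S (RInt (fun s => S s x) 0 t) (minus (S t x) x).
Proof.
set (F := fun r => RInt (fun s => S s x) 0 r).
assert (Sc := orbit_continuous x).
assert (D : forall r, filterlim (quot F r) (punctured (locally r) r) (locally (S r x))).
{ intros r. apply (is_derive_quot F). now apply (is_derive_primitive (fun s => S s x)). }
assert (Q : filterlim (quot (fun h => F (t + h)) 0) (punctured (locally 0) 0) (locally (S t x))).
{ apply (is_derive_quot (fun h => F (t + h))). replace (S t x) with (scal 1 (S t x)) by apply: scal_one.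
  apply (is_derive_comp F (fun h => t + h) 0).
  - rewrite Rplus_0_r. now apply (is_derive_primitive (fun s => S s x)).
  - auto_derive; auto. }
assert (Q1 := quot_at_right _ _ Q). cbv beta in Q1. assert (Q0 := quot_at_right _ _ (D 0)).
rewrite (group_zero _ _ HS) in Q0.
apply filterlim_ext with (fun h => minus (scal (/ h) (minus (F (t + h)) (F (t + 0))))
  (scal (/ h) (minus (F h) (F 0)))).
2: apply: filterlim_minus2; auto.
intros h. rewrite -scal_minus_distr_l. f_equal. rewrite Rplus_0_r.
assert (E : S h (F t) = minus (F (t + h)) (F h)).
{ assert (I := is_RInt_linear (S h) _ _ _ _ (S_linear h) (is_RInt_continuous _ 0 t Sc)).
  assert (J1 := is_RInt_continuous _ h (t + h) Sc).
  assert (J2 := is_RInt_continuous _ 0 h Sc).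
  assert (J := is_RInt_Chasles _ _ _ _ _ _ J2 J1).
  apply is_RInt_unique in J. unfold F at 2 3. rewrite J minus_plus_l.
  rewrite -{1}(Rplus_0_l h) in J1. apply is_RInt_shift in J1.
  unfold F. rewrite -(is_RInt_unique _ _ _ _ I) -(is_RInt_unique _ _ _ _ J1).
  apply RInt_ext. intros s _. rewrite -(group_add _ _ HS). f_equal. ring. }
rewrite E. unfold F at 4. rewrite RInt_point_zero minus_zero_r.
rewrite !minusE -!plus_assoc. f_equal. apply: plus_comm.
Qed.

Lemma filterlim_Rmax_half_line s :
  filterlim (fun r => Rmax r 0) (locally s) (half_line (Rmax s 0)).
Proof.
intros P HP. unfold half_line, within in HP.
assert (Cm : continuous (fun r => Rmax r 0) s).
{ apply filterlim_locally. intros e. exists e. intros r Hr.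
  unfold ball in *; simpl in *. unfold AbsRing_ball, abs, minus, plus, opp in *; simpl in *.
  eapply Rle_lt_trans; [|exact Hr]. unfold Rmax. repeat destruct Rle_dec; unfold Rabs;
  repeat destruct Rcase_abs; lra. }
specialize (Cm _ HP). unfold filtermap in *. revert Cm. apply filter_imp.
intros r Hr. apply Hr. apply Rmax_r.
Qed.

(** Along a solution, [S (-t) (W t)] has zero derivative. *)
Lemma classical_unique (W W' : R -> Y) :
  (forall t, 0 <= t -> filterdiff (U := R_NormedModule) W (half_line t) (fun s => scal s (W' t))) ->
  (forall t, 0 <= t -> generator S (W t) (W' t)) ->
  forall t, 0 <= t -> W t = S t (W 0).
Proof.
intros HW HG.
set (g := fun s => S (- s) (W s)).
assert (Dg : forall t, 0 <= t -> filterlim (quot g t) (punctured (half_line t) t) (locally (zero : Y))).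
{ intros t Ht. assert (PF := half_line_proper t Ht).
  assert (FF : Filter (punctured (half_line t) t)) by (apply: punctured_filter).
  apply filterlim_ext with (fun s => plus (S (- s) (quot W t s)) (quot (fun r => S (- r) (W t)) t s)).
  { intros s. unfold quot, g. rewrite (linear_scal (S (- s))) // (linear_minus (S (- s))) //.
    rewrite -scal_distr_l. f_equal. symmetry. apply: minus_trans. }
  replace (zero : Y) with (plus (S (- t) (W' t)) (opp (S (- t) (W' t)))) by apply: plus_opp_r.
  assert (Lt : filterlim (fun s : R => s) (punctured (half_line t) t) (locally t)).
  { intros P HP. unfold filtermap, punctured, half_line, within. revert HP. apply filter_imp. auto. }
  apply: filterlim_plus2.
  - apply: (sc_joint S _ S_sc (punctured (half_line t) t) (fun s => - s)).
    + exact (filterlim_comp _ _ _ _ Ropp _ _ _ Lt (filterlim_opp (V := R_NormedModule) t)).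
    + apply (is_derive_half_quot W t _ Ht). now apply HW.
  - assert (D : is_derive (fun r => S (- r) (W t)) t (opp (S (- t) (W' t)))).
    { replace (opp (S (- t) (W' t))) with (scal (-1) (S (- t) (W' t))).
      2:{ replace (-1) with (opp 1 : R) by reflexivity. apply: scal_opp_one. }
      apply (is_derive_comp (fun r => S r (W t)) Ropp t).
      - apply orbit_derivative. auto.
      - auto_derive; auto. }
    apply (is_derive_half_quot (fun r => S (- r) (W t)) t _ Ht). now apply is_derive_to_half. }
(* extended to negative times by its value at 0, g is differentiable on all of R *)
set (G := fun s => g (Rmax s 0)).
assert (DG : forall t, is_derive G t zero).
{ intros t. apply is_derive_quot. apply quot_iff. apply locally_filter. intros eps.
  assert (Ht : 0 <= Rmax t 0) by apply Rmax_r.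
  assert (H := proj2 (quot_iff (half_line (Rmax t 0)) g (Rmax t 0) zero) (Dg _ Ht) eps).
  assert (M := filterlim_Rmax_half_line t).
  specialize (M _ H). unfold filtermap in M. revert M. apply filter_imp.
  intros s Hs. rewrite scal_zero_r minus_zero_r in Hs. rewrite scal_zero_r minus_zero_r.
  eapply Rle_trans. apply Hs. apply Rmult_le_compat_l. left; apply cond_pos.
  unfold Rmax. repeat destruct Rle_dec; unfold Rabs; repeat destruct Rcase_abs; lra. }
intros t Ht. assert (E := zero_derivative_constant G t 0 DG).
unfold G, g in E. rewrite !Rmax_left // in E; [|lra].
rewrite Ropp_0 (group_zero _ _ HS) in E. rewrite -E -(group_add _ _ HS) Rplus_opp_r.
symmetry. apply (group_zero _ _ HS).
Qed.

(** The notion [mild_solution] in a real Banach space, the operator being the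
    generator of [S]. *)
Definition abstract_mild (x : Y) (Z : R -> Y) : Prop :=
  (forall t, 0 <= t -> filterlim Z (half_line t) (locally (Z t))) /\
  forall t, 0 <= t -> exists I AI, is_RInt Z 0 t I /\ generator S I AI /\ Z t = plus x AI.

Lemma orbit_mild x : abstract_mild x (fun t => S t x).
Proof.
split.
- intros t _ P HP. apply orbit_continuous in HP. unfold filtermap, half_line, within in *.
  revert HP. apply filter_imp. auto.
- intros t _. exists (RInt (fun s => S s x) 0 t), (minus (S t x) x). split; [|split].
  + apply is_RInt_continuous, orbit_continuous.
  + apply orbit_primitive_generator.
  + rewrite plus_comm. symmetry. apply: plus_minus_cancel.
Qed.

(** The time integral of the difference of two mild solutions is a classical
    solution that starts from 0. *)
Lemma mild_unique x Z1 Z2 : abstract_mild x Z1 -> abstract_mild x Z2 ->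
  forall t, 0 <= t -> Z1 t = Z2 t.
Proof.
intros [C1 M1] [C2 M2].
set (d := fun s => minus (Z1 (Rmax s 0)) (Z2 (Rmax s 0))).
assert (dc : forall s, continuous d s).
{ intros s. assert (L := filterlim_Rmax_half_line s).
  assert (Hs : 0 <= Rmax s 0) by apply Rmax_r.
  apply: filterlim_minus2; (eapply filterlim_comp; [exact L|]); auto. }
assert (d_eq : forall s, 0 <= s -> d s = minus (Z1 s) (Z2 s)).
{ intros s Hs. unfold d. now rewrite !Rmax_left. }
set (W := fun t => RInt d 0 t).
assert (HG : forall t, 0 <= t -> generator S (W t) (d t)).
{ intros t Ht. destruct (M1 t Ht) as [I1 [A1 [J1 [G1 E1]]]], (M2 t Ht) as [I2 [A2 [J2 [G2 E2]]]].
  assert (E : W t = minus I1 I2).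
  { apply is_RInt_unique. apply is_RInt_ext with (fun s => minus (Z1 s) (Z2 s)).
    - intros s Hs. rewrite Rmin_left // in Hs. symmetry; apply d_eq; lra.
    - now apply: is_RInt_minus. }
  rewrite E d_eq // E1 E2 minus_plus_distr minus_eq_zero plus_zero_l. now apply generator_minus. }
assert (H0 : forall t, 0 <= t -> W t = zero).
{ intros t Ht. rewrite (classical_unique W d) //.
  - unfold W. rewrite RInt_point_zero. apply group_linear_zero.
  - intros s Hs. apply (is_derive_to_half W s (d s) Hs). now apply (is_derive_primitive d). }
intros t Ht. apply minus_eq0. rewrite -d_eq //.
apply (generator_unique S zero). { rewrite -(H0 t) //. now apply HG. }
assert (G0 := generator_minus _ _ _ _ (HG t Ht) (HG t Ht)). now rewrite !minus_eq_zero in G0.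
Qed.
End CauchyProblem.

(** * Sums over the integers *)

Lemma partial_sum_le_Series (u : nat -> R) n :
  (forall j, 0 <= u j) -> ex_series u -> sum_n u n <= Series u.
Proof.
intros P H. apply Series_correct in H.
apply (is_lim_seq_incr_compare (sum_n u) (Series u) H).
intros m. rewrite sum_Sn. change (sum_n u m <= sum_n u m + u (S m)). specialize (P (S m)). lra.
Qed.

Lemma bounded_nonneg_series (u : nat -> R) M :
  (forall j, 0 <= u j) -> (forall n, sum_n u n <= M) -> ex_series u /\ Series u <= M.
Proof.
intros P H.
destruct (ex_finite_lim_seq_incr (sum_n u) M) as [l Hl]; auto.
{ intros m. rewrite sum_Sn. change (sum_n u m <= sum_n u m + u (S m)). specialize (P (S m)). lra. }
assert (E : is_series u l) by exact Hl.
split. now exists l. rewrite (is_series_unique _ _ E).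
exact (is_lim_seq_le (sum_n u) (fun _ => M) l M H Hl (is_lim_seq_const M)).
Qed.

Lemma sum_n_nonneg (u : nat -> R) n : (forall j, 0 <= u j) -> 0 <= sum_n u n.
Proof.
intros P. induction n. rewrite sum_O; auto. rewrite sum_Sn.
change (0 <= sum_n u n + u (S n)). specialize (P (S n)). lra.
Qed.

(** The factor 2 comes from bounding the sums over the two half-lines separately. *)
Lemma bounded_nonneg_sumZ (f : Z -> R) M : (forall k, 0 <= f k) ->
  (forall n, sum_n (fun j => f (Z.of_nat j)) n <= M) ->
  (forall n, sum_n (fun j => f (- Z.of_nat (S j))%Z) n <= M) ->
  ex_sumZ f /\ sumZ f <= 2 * M.
Proof.
intros P H1 H2.
destruct (bounded_nonneg_series _ M (fun j => P _) H1) as [E1 B1].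
destruct (bounded_nonneg_series _ M (fun j => P _) H2) as [E2 B2].
split. now split. unfold sumZ. lra.
Qed.

Lemma half_sums_le_sumZ (f : Z -> R) n : (forall k, 0 <= f k) -> ex_sumZ f ->
  sum_n (fun j => f (Z.of_nat j)) n <= sumZ f /\
  sum_n (fun j => f (- Z.of_nat (S j))%Z) n <= sumZ f.
Proof.
intros P [E1 E2]. unfold sumZ.
assert (A1 := fun m => partial_sum_le_Series _ m (fun j => P (Z.of_nat j)) E1).
assert (A2 := fun m => partial_sum_le_Series _ m (fun j => P (- Z.of_nat (S j))%Z) E2).
assert (B1 := sum_n_nonneg (fun j => f (Z.of_nat j)) 0 (fun j => P _)).
assert (B2 := sum_n_nonneg (fun j => f (- Z.of_nat (S j))%Z) 0 (fun j => P _)).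
assert (C1 := A1 0%nat). assert (C2 := A2 0%nat). specialize (A1 n). specialize (A2 n). lra.
Qed.

Lemma filterlim_Rplus {T} (F : (T -> Prop) -> Prop) {FF : Filter F} (f g : T -> R) a b :
  filterlim f F (locally a) -> filterlim g F (locally b) ->
  filterlim (fun t => f t + g t) F (locally (a + b)).
Proof. exact (filterlim_plus2 (Y := R_NormedModule) F f g a b). Qed.

Lemma filterlim_Rmult {T} (F : (T -> Prop) -> Prop) {FF : Filter F} (f g : T -> R) a b :
  filterlim f F (locally a) -> filterlim g F (locally b) ->
  filterlim (fun t => f t * g t) F (locally (a * b)).
Proof.
intros Hf Hg. eapply filterlim_comp_2; eauto. apply (filterlim_mult (K := R_AbsRing)).
Qed.

Lemma filterlim_sum_n {T} (F : (T -> Prop) -> Prop) {FF : Filter F} (a : T -> nat -> R) b n :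
  (forall j, filterlim (fun t => a t j) F (locally (b j))) ->
  filterlim (fun t => sum_n (a t) n) F (locally (sum_n b n)).
Proof.
intros H. induction n.
- rewrite sum_O. eapply filterlim_ext; [|apply H]. intros t; now rewrite sum_O.
- rewrite sum_Sn. eapply filterlim_ext. { intros t; symmetry; apply sum_Sn. }
  now apply: filterlim_Rplus.
Qed.

Lemma filterlim_le_const {T} (F : (T -> Prop) -> Prop) {FF : ProperFilter F} (f : T -> R) l M :
  F (fun t => f t <= M) -> filterlim f F (locally l) -> l <= M.
Proof.
intros H Hf.
exact (filterlim_le (F := F) f (fun _ => M) (Finite l) (Finite M) H Hf (filterlim_const M)).
Qed.

(** Fatou's lemma on the integers. *)
Lemma sumZ_fatou {T} (F : (T -> Prop) -> Prop) {FF : ProperFilter F} (a : T -> Z -> R) b M :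
  (forall t k, 0 <= a t k) -> (forall k, filterlim (fun t => a t k) F (locally (b k))) ->
  F (fun t => ex_sumZ (a t) /\ sumZ (a t) <= M) ->
  ex_sumZ b /\ sumZ b <= 2 * M.
Proof.
intros P L H. apply bounded_nonneg_sumZ.
- intros k. assert (N := filterlim_opp (V := R_NormedModule) (b k)).
  assert (Q : - b k <= 0); [|lra].
  apply (filterlim_le_const F (fun t => - a t k)).
  + apply filter_forall. intros t. specialize (P t k). lra.
  + exact (filterlim_comp _ _ _ _ Ropp _ _ _ (L k) N).
- intros n. apply (filterlim_le_const F (fun t => sum_n (fun j => a t (Z.of_nat j)) n)).
  + revert H. apply filter_imp. intros t [E B].
    destruct (half_sums_le_sumZ (a t) n (P t) E). lra.
  + apply: (filterlim_sum_n F (fun t j => a t (Z.of_nat j))). intros j; apply L.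
- intros n. apply (filterlim_le_const F (fun t => sum_n (fun j => a t (- Z.of_nat (S j))%Z) n)).
  + revert H. apply filter_imp. intros t [E B].
    destruct (half_sums_le_sumZ (a t) n (P t) E). lra.
  + apply: (filterlim_sum_n F (fun t j => a t (- Z.of_nat (S j))%Z)). intros j; apply L.
Qed.

(** The tails of [a t] are at most those of [g], uniformly in [t]. *)
Lemma Series_dominated {T} (F : (T -> Prop) -> Prop) {FF : Filter F} (a : T -> nat -> R) g :
  ex_series g -> F (fun t => forall j, 0 <= a t j <= g j) ->
  (forall j, filterlim (fun t => a t j) F (locally 0)) ->
  filterlim (fun t => Series (a t)) F (locally 0).
Proof.
intros Eg D L. apply filterlim_locally. intros eps.
assert (Hg := Series_correct _ Eg). 
assert (Hg' : is_lim_seq (sum_n g) (Series g)) by exact Hg.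
apply is_lim_seq_spec in Hg'.
assert (He : 0 < eps / 2) by (destruct eps; simpl; lra).
destruct (Hg' (mkposreal _ He)) as [N HN]. specialize (HN N (Nat.le_refl N)). simpl in HN.
apply Rabs_def2 in HN.
assert (S0 : filterlim (fun t => sum_n (a t) N) F (locally 0)).
{ replace 0 with (sum_n (fun _ : nat => 0) N). now apply: filterlim_sum_n.
  induction N. now rewrite sum_O. rewrite sum_n_const. simpl; ring. }
assert (B := proj1 (filterlim_locally _ _) S0 (mkposreal _ He)).
generalize (filter_and _ _ D B). apply filter_imp. intros t [Dt Bt].
unfold ball in *; simpl in *. unfold AbsRing_ball, abs, minus, plus, opp in *; simpl in *.
apply Rabs_def2 in Bt.
assert (Ea : ex_series (a t)).
{ apply (ex_series_le (K := R_AbsRing) (V := R_CompleteNormedModule) (a t) g); auto.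
  intros j. change (Rabs (a t j) <= g j). rewrite Rabs_pos_eq; apply Dt. }
assert (Q : sum_n (fun j => g j - a t j) N <= Series (fun j => g j - a t j)).
{ apply partial_sum_le_Series. intros j. specialize (Dt j). lra.
  apply: (ex_series_minus (V := R_NormedModule) g (a t)); auto. }
rewrite Series_minus // in Q.
assert (Q2 : sum_n (fun j => g j - a t j) N = sum_n g N - sum_n (a t) N).
{ clear. induction N. now rewrite !sum_O. rewrite !sum_Sn IHN.
  change (sum_n g N - sum_n (a t) N + (g (S N) - a t (S N)) =
    sum_n g N + g (S N) - (sum_n (a t) N + a t (S N))). ring. }
assert (Q3 : 0 <= Series (a t)).
{ eapply Rle_trans; [|apply (partial_sum_le_Series (a t) 0)]; auto.
  rewrite sum_O; apply Dt. intros j; apply Dt. }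
assert (B1 : sum_n (a t) N < eps / 2).
{ destruct Bt as [Bt _]. rewrite Ropp_0 Rplus_0_r in Bt. exact Bt. }
assert (G1 : - (eps / 2) < sum_n g N - Series g) by exact (proj2 HN).
assert (Q1 : sum_n g N - sum_n (a t) N <= Series g - Series (a t)).
{ rewrite -Q2. exact Q. }
rewrite Ropp_0 Rplus_0_r Rabs_pos_eq; [|exact Q3]. lra.
Qed.

(** Dominated convergence, on each half-line. *)
Lemma sumZ_dominated {T} (F : (T -> Prop) -> Prop) {FF : Filter F} (a : T -> Z -> R) g :
  ex_sumZ g -> F (fun t => forall k, 0 <= a t k <= g k) ->
  (forall k, filterlim (fun t => a t k) F (locally 0)) ->
  filterlim (fun t => sumZ (a t)) F (locally 0).
Proof.
intros [E1 E2] D L. rewrite -(Rplus_0_l 0). unfold sumZ.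
refine (filterlim_Rplus F _ _ 0 0 _ _).
- refine (Series_dominated F (fun t j => a t (Z.of_nat j)) _ E1 _ (fun j => L _)).
  revert D; apply filter_imp; auto.
- refine (Series_dominated F (fun t j => a t (- Z.of_nat (S j))%Z) _ E2 _ (fun j => L _)).
  revert D; apply filter_imp; auto.
Qed.

Lemma ex_sumZ_nonneg_le f g : (forall k, 0 <= f k <= g k) -> ex_sumZ g -> ex_sumZ f.
Proof. intros H. apply ex_sumZ_le. intros k. rewrite Rabs_pos_eq; apply H. Qed.

(** * Fourier coordinates on the energy space *)

Definition dirac : distT.
Proof.
refine (MkDist (fun f => f 0) _ _ _); intros.
- apply t_plusE.
- apply t_scalE.
- exists 0%nat, 2. intros M f Hf. destruct (Hf 0%nat 0 (Nat.le_refl 0)) as [A B].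
  eapply Rle_trans. apply Cmod_le_sum. simpl in *. lra.
Defined.

Lemma coef_dirac k : coef dirac k = (/ RtoC (2 * PI))%C.
Proof.
unfold coef. cbn [dist_app dirac]. unfold teval; cbn [t_re t_im t_exp s_cos s_sin sfun].
rewrite Rmult_0_r cos_0 sin_0. change (1, 0) with (RtoC 1). ring.
Qed.

Lemma weight_half k : Rpower (1 + IZR k ^ 2) (/ 2) = sqrt (1 + IZR k ^ 2).
Proof. apply Rpower_sqrt. assert (0 <= IZR k ^ 2) by apply pow2_ge_0. lra. Qed.

Lemma weight_minus_half k : Rpower (1 + IZR k ^ 2) (- / 2) = / sqrt (1 + IZR k ^ 2).
Proof. rewrite Rpower_Ropp. f_equal. apply weight_half. Qed.

Lemma Rabs_IZR_le_sqrt k : Rabs (IZR k) <= sqrt (1 + IZR k ^ 2).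
Proof.
rewrite -(sqrt_pow2 (Rabs (IZR k))); [|apply Rabs_pos]. apply sqrt_le_1_alt.
rewrite pow2_abs. lra.
Qed.

Lemma one_le_sqrt k : 1 <= sqrt (1 + IZR k ^ 2).
Proof.
rewrite -{1}sqrt_1. apply sqrt_le_1_alt. assert (0 <= IZR k ^ 2) by apply pow2_ge_0. lra.
Qed.

(** A sequence of at most linear growth is a bounded multiple of [1 + i k], the
    coefficients of [2 pi (dirac + dirac')]. *)
Lemma dist_of_coefs (c : Z -> C) (B : R) :
  (forall k, Cmod (c k) <= B * (1 + Rabs (IZR k))) ->
  exists v : distT, forall k, coef v k = c k.
Proof.
intros H.
set (w := fun k : Z => (1 + Ci * RtoC (IZR k))%C).
assert (Hw : forall k, Cmod (w k) = sqrt (1 + IZR k ^ 2)).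
{ intros k. unfold w, Cmod, Cplus, Cmult, Ci, RtoC; cbn [fst snd]. f_equal. ring. }
assert (Hw0 : forall k, w k <> RtoC 0).
{ intros k E. specialize (Hw k). rewrite E Cmod_0 in Hw. assert (T := one_le_sqrt k). lra. }
assert (Hs : bounded_symbol (fun k => RtoC (2 * PI) * (c k / w k))%C).
{ exists (2 * PI * (2 * B)). intros k. assert (Hpi := PI_RGT_0).
  rewrite Cmod_mult Cmod_R Rabs_pos_eq; [|lra]. apply Rmult_le_compat_l; [lra|].
  rewrite Cmod_div // Hw. assert (T := one_le_sqrt k). assert (T2 := Rabs_IZR_le_sqrt k).
  apply Rmult_le_reg_r with (sqrt (1 + IZR k ^ 2)); [lra|].
  unfold Rdiv. rewrite Rmult_assoc Rinv_l; [|lra]. rewrite Rmult_1_r.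
  eapply Rle_trans. apply H.
  assert (0 <= B).
  { specialize (H 0%Z). rewrite Rabs_R0 Rplus_0_r Rmult_1_r in H.
    eapply Rle_trans; [apply Cmod_ge_0 | exact H]. }
  nra. }
exists (d_multiplier _ Hs (d_plus dirac (d_deriv dirac))). intros k.
rewrite coef_multiplier coef_plus coef_deriv coef_dirac.
assert (P := RtoC_2PI_neq). assert (W := Hw0 k). unfold w in W |- *.
field. split; auto.
Qed.

Lemma coef_inj v w : (forall k, coef v k = coef w k) -> v = w.
Proof.
intros H. assert (E : d_plus v (d_opp w) = d_zero).
{ apply coef_eq0. intros k. unfold d_opp. rewrite coef_plus coef_scal H. ring. }
apply distT_ext. intros f. assert (Ef := f_equal (fun d : distT => d f) E). simpl in Ef.
replace (v f) with (v f + RtoC (-1) * w f + w f)%C by ring. rewrite Ef. ring.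
Qed.

Section Coordinates.
Context (beta : posreal).
Notation E := (energy beta).
Notation p := (p_symb beta).

(** This is [tanh x >= x / (1 + x)] for [x > 0], which follows from
    [exp (2 x) >= 1 + 2 x]. *)
Lemma p_symb_lower k : / (1 + beta * Rabs (IZR k)) <= p k.
Proof.
assert (Hb := cond_pos beta). unfold p_symb. destruct (Z.eq_dec k 0) as [->|Hk].
{ rewrite Rabs_R0 Rmult_0_r Rplus_0_r Rinv_1. lra. }
assert (HR : forall x, 0 < x -> / (1 + x) <= tanh x / x).
{ intros x Hx. unfold tanh. assert (Hc := cosh_pos x).
  assert (K : x * cosh x <= (1 + x) * sinh x).
  { unfold cosh, sinh. assert (A := exp_pos (- x)).
    assert (X : exp x = exp (- x) * exp (2 * x)) by (rewrite -exp_plus; f_equal; ring).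
    assert (1 + 2 * x <= exp (2 * x)) by (left; apply exp_ineq1; lra).
    assert (0 <= exp (- x) * (exp (2 * x) - 1 - 2 * x)) by (apply Rmult_le_pos; lra).
    lra. }
  apply Rmult_le_reg_r with ((1 + x) * (x * cosh x)). nra.
  replace (/ (1 + x) * ((1 + x) * (x * cosh x))) with (x * cosh x) by (field; lra).
  replace (sinh x / cosh x / x * ((1 + x) * (x * cosh x))) with ((1 + x) * sinh x) by (field; lra).
  exact K. }
assert (Ht : forall x, tanh (- x) / (- x) = tanh x / x).
{ intros x. destruct (Req_dec x 0) as [->|Hx]. now rewrite Ropp_0.
  unfold tanh. replace (sinh (- x)) with (- sinh x) by (unfold sinh; rewrite Ropp_involutive; field).
  replace (cosh (- x)) with (cosh x) by (unfold cosh; rewrite Ropp_involutive; field).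
  field. split; auto. assert (Hc := cosh_pos x). lra. }
assert (A := IZR_abs_ge1 k Hk).
destruct (Rcase_abs (IZR k)) as [Hn|Hp].
- rewrite (Rabs_left _ Hn) in A |- *. rewrite -Ht.
  replace (- (beta * IZR k)) with (beta * - IZR k) by ring. apply HR. nra.
- rewrite (Rabs_right _ Hp) in A |- *. apply HR. nra.
Qed.

Lemma p_symb_upper : exists B, 0 < B /\ forall k, p k <= B.
Proof.
destruct (P_bounded beta) as [B HB]. exists (Rmax B 1). split.
- eapply Rlt_le_trans; [apply Rlt_0_1 | apply Rmax_r].
- intros k. specialize (HB k). rewrite Cmod_R in HB.
  eapply Rle_trans; [apply Rle_abs | eapply Rle_trans; [exact HB | apply Rmax_l]].
Qed.

Lemma sqrt_p_sq k : sqrt (p k) * sqrt (p k) = p k.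
Proof. apply sqrt_sqrt. left; apply p_symb_pos. Qed.

Lemma sqrt_p_pos k : 0 < sqrt (p k).
Proof. apply sqrt_lt_R0, p_symb_pos. Qed.

(** The energy becomes the [l2] norm of the pair of sequences [xc], [yc], and the
    two equations take the same form, coupled by the frequencies [theta]. *)
Definition xc (z : E) (k : Z) : C := coef (en_h z) k.
Definition yc (z : E) (k : Z) : C := (RtoC (sqrt (p k)) * coef (en_u z) k)%C.
Definition theta (k : Z) : R := IZR k * sqrt (p k).

Lemma xcE z k : xc z k = coef (en_h z) k.
Proof. reflexivity. Qed.
Lemma ycE z k : yc z k = (RtoC (sqrt (p k)) * coef (en_u z) k)%C.
Proof. reflexivity. Qed.
Lemma thetaE k : theta k = IZR k * sqrt (p k).
Proof. reflexivity. Qed.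

Definition density (z : E) (k : Z) : R := Cmod (xc z k) ^ 2 + Cmod (yc z k) ^ 2.

Lemma densityE z k : density z k = Cmod (xc z k) ^ 2 + Cmod (yc z k) ^ 2.
Proof. reflexivity. Qed.

Lemma coef_en_u z k : coef (en_u z) k = (yc z k / RtoC (sqrt (p k)))%C.
Proof.
unfold yc. field. intros H. apply RtoC_inj in H. assert (T := sqrt_p_pos k). lra.
Qed.

Lemma yc_sq z k : Cmod (yc z k) ^ 2 = p k * Cmod (coef (en_u z) k) ^ 2.
Proof.
unfold yc. rewrite Cmod_mult Cmod_R Rabs_pos_eq; [|left; apply sqrt_p_pos].
rewrite Rpow_mult_distr. f_equal. simpl. rewrite Rmult_1_r. apply sqrt_p_sq.
Qed.

Lemma density_nonneg z k : 0 <= density z k.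
Proof. apply Rplus_le_le_0_compat; apply pow2_ge_0. Qed.

Lemma ex_density z : ex_sumZ (density z).
Proof.
apply ex_sumZ_ext with (fun k => w2 (fun _ => 1) (en_h z) k + w2 p (en_u z) k).
- intros k. unfold density, w2. rewrite yc_sq. unfold xc. ring.
- apply ex_sumZ_plus. apply en_ex_h. apply en_ex_u.
Qed.

Lemma enorm_density z : enorm beta z = sqrt (2 * PI * sumZ (density z)).
Proof.
rewrite enormE. unfold en_q. rewrite -sumZ_plus; [|apply en_ex_h|apply en_ex_u].
do 2 f_equal. apply sumZ_ext. intros k. unfold density, w2. rewrite yc_sq. unfold xc. ring.
Qed.

Lemma enorm_sq z : enorm beta z ^ 2 = 2 * PI * sumZ (density z).
Proof.
rewrite enorm_density pow2_sqrt //. assert (Hpi := PI_RGT_0). apply Rmult_le_pos; [lra|].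
apply sumZ_nonneg. apply density_nonneg. apply ex_density.
Qed.

Lemma coords_ext (z W : E) : (forall k, xc z k = xc W k) -> (forall k, yc z k = yc W k) -> z = W.
Proof.
intros Hx Hy. apply energy_ext; apply coef_inj; auto.
intros k. now rewrite !coef_en_u Hy.
Qed.

Lemma xc_plus (z W : E) k : xc (plus z W) k = (xc z k + xc W k)%C.
Proof. apply coef_plus. Qed.
Lemma yc_plus (z W : E) k : yc (plus z W) k = (yc z k + yc W k)%C.
Proof.
unfold yc. change (en_u (plus z W)) with (d_plus (en_u z) (en_u W)). rewrite coef_plus. ring.
Qed.
Lemma xc_scal (c : C) (z : E) k : xc (en_scal beta c z) k = (c * xc z k)%C.
Proof. apply coef_scal. Qed.
Lemma yc_scal (c : C) (z : E) k : yc (en_scal beta c z) k = (c * yc z k)%C.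
Proof. unfold yc. cbn [en_u en_scal]. rewrite coef_scal. ring. Qed.
Lemma xc_minus (z W : E) k : xc (minus z W) k = (xc z k - xc W k)%C.
Proof.
change (minus z W) with (plus z (en_scal beta (RtoC (-1)) W)). rewrite xc_plus xc_scal. ring.
Qed.
Lemma yc_minus (z W : E) k : yc (minus z W) k = (yc z k - yc W k)%C.
Proof.
change (minus z W) with (plus z (en_scal beta (RtoC (-1)) W)). rewrite yc_plus yc_scal. ring.
Qed.

Lemma Hs0_iff v : Hs 0 v <-> ex_sumZ (fun k => Cmod (coef v k) ^ 2).
Proof.
assert (H : forall k, Rpower (1 + IZR k ^ 2) 0 = 1).
{ intros k. apply Rpower_O. assert (0 <= IZR k ^ 2) by apply pow2_ge_0. lra. }
split; apply ex_sumZ_ext; intros k; rewrite H; ring.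
Qed.

Lemma Cmod_le_of_sq z r : 0 <= r -> Cmod z ^ 2 <= r ^ 2 -> Cmod z <= r.
Proof. intros Hr H. apply Rnot_lt_le. intros L. assert (r ^ 2 < Cmod z ^ 2) by nra. lra. Qed.

Lemma energy_of_coords (x y : Z -> C) :
  ex_sumZ (fun k => Cmod (x k) ^ 2 + Cmod (y k) ^ 2) ->
  exists z : E, (forall k, xc z k = x k) /\ (forall k, yc z k = y k).
Proof.
intros H. assert (Hb := cond_pos beta).
set (M := sumZ (fun k => Cmod (x k) ^ 2 + Cmod (y k) ^ 2)).
assert (P : forall k, Cmod (x k) ^ 2 + Cmod (y k) ^ 2 <= M).
{ intros k. apply sumZ_ge_term with (f := fun k => Cmod (x k) ^ 2 + Cmod (y k) ^ 2); auto.
  intros l. apply Rplus_le_le_0_compat; apply pow2_ge_0. }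
assert (BX : forall k, Cmod (x k) <= M + 1).
{ intros k. specialize (P k). assert (0 <= Cmod (y k) ^ 2) by apply pow2_ge_0.
  assert (0 <= Cmod (x k)) by apply Cmod_ge_0. nra. }
assert (BY : forall k, Cmod (y k) <= M + 1).
{ intros k. specialize (P k). assert (0 <= Cmod (x k) ^ 2) by apply pow2_ge_0.
  assert (0 <= Cmod (y k)) by apply Cmod_ge_0. nra. }
assert (M0 : 0 <= M + 1) by (eapply Rle_trans; [apply Cmod_ge_0 | apply (BX 0%Z)]).
destruct (dist_of_coefs x (M + 1)) as [h Hh].
{ intros k. assert (0 <= Rabs (IZR k)) by apply Rabs_pos. specialize (BX k). nra. }
assert (SP : forall k, / sqrt (p k) <= 1 + beta * Rabs (IZR k)).
{ intros k. assert (T := sqrt_p_pos k). assert (0 <= Rabs (IZR k)) by apply Rabs_pos.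
  assert (L := p_symb_lower k).
  assert (Q : 0 < 1 + beta * Rabs (IZR k)) by nra.
  rewrite -(Rinv_inv (1 + beta * Rabs (IZR k))). apply Rinv_le_contravar.
  now apply Rinv_0_lt_compat.
  (* a number of [0, 1] is at most its square root *)
  assert (I1 : / (1 + beta * Rabs (IZR k)) <= 1).
  { rewrite -[X in _ <= X]Rinv_1. apply Rinv_le_contravar; nra. }
  assert (I0 : 0 < / (1 + beta * Rabs (IZR k))) by now apply Rinv_0_lt_compat.
  apply Rle_trans with (sqrt (/ (1 + beta * Rabs (IZR k)))).
  - rewrite -{1}(sqrt_sqrt (/ (1 + beta * Rabs (IZR k)))); [|lra].
    assert (S1 : sqrt (/ (1 + beta * Rabs (IZR k))) <= 1).
    { rewrite -[X in _ <= X]sqrt_1. now apply sqrt_le_1_alt. }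
    assert (S0 := sqrt_pos (/ (1 + beta * Rabs (IZR k)))). nra.
  - now apply sqrt_le_1_alt. }
destruct (dist_of_coefs (fun k => y k / RtoC (sqrt (p k)))%C ((M + 1) * (1 + beta))) as [u Hu].
{ intros k. assert (T := sqrt_p_pos k). assert (0 <= Rabs (IZR k)) by apply Rabs_pos.
  rewrite Cmod_div; [|intros Q; apply RtoC_inj in Q; lra].
  rewrite Cmod_R Rabs_pos_eq; [|lra]. unfold Rdiv.
  apply Rle_trans with ((M + 1) * (1 + beta * Rabs (IZR k))).
  - apply Rmult_le_compat; auto. apply Cmod_ge_0. left; now apply Rinv_0_lt_compat.
  - rewrite Rmult_assoc. apply Rmult_le_compat_l; auto. nra. }
assert (Lh : Hs 0 h).
{ apply Hs0_iff. eapply ex_sumZ_nonneg_le; [|exact H]. intros k; cbv beta. rewrite Hh.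
  assert (A := pow2_ge_0 (Cmod (x k))). assert (B := pow2_ge_0 (Cmod (y k))). lra. }
assert (yE : forall k, Cmod (y k) ^ 2 = p k * Cmod (coef u k) ^ 2).
{ intros k. rewrite Hu. assert (T := sqrt_p_pos k).
  rewrite Cmod_div; [|intros Q; apply RtoC_inj in Q; lra].
  rewrite Cmod_R Rabs_pos_eq; [|lra]. rewrite -{1}(sqrt_p_sq k). field. lra. }
assert (Lu : Hs (- / 2) u).
{ eapply ex_sumZ_nonneg_le; [|exact (ex_sumZ_scal (1 + beta) _ H)]. intros k; cbv beta.
  assert (T1 := one_le_sqrt k). assert (T2 := Rabs_IZR_le_sqrt k).
  assert (T0 : 0 <= Rabs (IZR k)) by apply Rabs_pos.
  assert (T3 : 0 <= Cmod (coef u k) ^ 2) by apply pow2_ge_0.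
  assert (T4 : 0 <= Cmod (x k) ^ 2) by apply pow2_ge_0.
  rewrite weight_minus_half. split. { apply Rmult_le_pos; auto. left; apply Rinv_0_lt_compat; lra. }
  rewrite yE. apply Rle_trans with ((1 + beta) * (p k * Cmod (coef u k) ^ 2)).
  2: apply Rmult_le_compat_l; lra.
  rewrite -Rmult_assoc. apply Rmult_le_compat_r; auto.
  apply Rle_trans with ((1 + beta) * / (1 + beta * Rabs (IZR k))).
  2: apply Rmult_le_compat_l; [lra | apply p_symb_lower].
  assert (T5 : 0 < 1 + beta * Rabs (IZR k)) by nra.
  apply Rmult_le_reg_r with (sqrt (1 + IZR k ^ 2) * (1 + beta * Rabs (IZR k))).
  { apply Rmult_lt_0_compat; lra. }
  replace (/ sqrt (1 + IZR k ^ 2) * (sqrt (1 + IZR k ^ 2) * (1 + beta * Rabs (IZR k))))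
    with (1 + beta * Rabs (IZR k)) by (field; lra).
  replace ((1 + beta) * / (1 + beta * Rabs (IZR k)) * (sqrt (1 + IZR k ^ 2) * (1 + beta * Rabs (IZR k))))
    with ((1 + beta) * sqrt (1 + IZR k ^ 2)) by (field; lra).
  nra. }
exists (MkEnergy h u Lh Lu). split; intros k.
- exact (Hh k).
- unfold yc; cbn [en_u]. rewrite Hu. field. intros Q. apply RtoC_inj in Q.
  assert (T := sqrt_p_pos k). lra.
Qed.

End Coordinates.

(** * Completeness of the energy space *)

Lemma Cmod_sq_expand (a b : C) :
  Cmod (a - b) ^ 2 = (Re a - Re b) * (Re a - Re b) + (Im a - Im b) * (Im a - Im b).
Proof. rewrite Cmod2_alt. unfold Re, Im; simpl. ring. Qed.

Lemma two_PI_ge_1 : 1 <= 2 * PI.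
Proof. assert (H := PI2_3_2). lra. Qed.

Section Completeness.
Context (beta : posreal).
Notation E := (energy beta).

Lemma coords_le_enorm (z : E) k :
  Cmod (xc beta z k) <= enorm beta z /\ Cmod (yc beta z k) <= enorm beta z.
Proof.
assert (H := sumZ_ge_term (density beta z) k (density_nonneg beta z) (ex_density beta z)).
assert (Q := enorm_sq beta z). assert (P := two_PI_ge_1).
assert (N := density_nonneg beta z k). unfold density at 1 in H. unfold density in N.
assert (X := pow2_ge_0 (Cmod (xc beta z k))). assert (Y := pow2_ge_0 (Cmod (yc beta z k))).
split; (apply Cmod_le_of_sq; [apply enorm_nonneg | rewrite Q; nra]).
Qed.

Lemma filterlim_Cmod_sq {T} (F : (T -> Prop) -> Prop) {FF : Filter F} (f : T -> C) (c a : C) :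
  filterlim (fun t => Re (f t)) F (locally (Re c)) ->
  filterlim (fun t => Im (f t)) F (locally (Im c)) ->
  filterlim (fun t => Cmod (f t - a) ^ 2) F (locally (Cmod (c - a) ^ 2)).
Proof.
intros Hr Hi. rewrite Cmod_sq_expand.
eapply filterlim_ext. { intros t. symmetry. apply Cmod_sq_expand. }
assert (M : forall (g : T -> R) l b, filterlim g F (locally l) ->
  filterlim (fun t => g t - b) F (locally (l - b))).
{ intros g l b Hg. refine (filterlim_Rplus F _ _ l (- b) Hg _). apply filterlim_const. }
refine (filterlim_Rplus F _ _ _ _ _ _); refine (filterlim_Rmult F _ _ _ _ _ _); now apply M.
Qed.

(** The coordinates converge along a Cauchy filter; by Fatou's lemma their limits
    are the coordinates of an element close to the elements of the filter. *)
Lemma energy_complete (F : (E -> Prop) -> Prop) : ProperFilter F ->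
  cauchy (T := en_UniformSpace beta) F ->
  exists L : E, forall eps : posreal, F (ball (L : en_UniformSpace beta) eps).
Proof.
intros PF HC.
assert (lim_real : forall l : E -> R, (forall z w, Rabs (l z - l w) <= enorm beta (minus z w)) ->
  exists r, filterlim l F (locally r)).
{ intros l Hl. apply (filterlim_locally_cauchy (U := R_CompleteSpace) (F := F) l). intros eps.
  assert (He : 0 < eps / 2) by (destruct eps; simpl; lra).
  destruct (HC (mkposreal _ He)) as [z0 H0].
  exists (ball (z0 : en_UniformSpace beta) (eps / 2)). split; auto.
  intros u v Hu Hv. change (Rabs (l v - l u) < eps).
  change (enorm beta (minus u z0) < eps / 2) in Hu.
  change (enorm beta (minus v z0) < eps / 2) in Hv.
  replace (l v - l u) with ((l v - l z0) + (l z0 - l u)) by ring.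
  eapply Rle_lt_trans. apply Rabs_triang.
  assert (A := Hl v z0). assert (B := Hl z0 u). rewrite enorm_minus_sym in B. lra. }
assert (lim_C : forall c : E -> C, (forall z w, Cmod (c z - c w) <= enorm beta (minus z w)) ->
  exists r : C, filterlim (fun z => Re (c z)) F (locally (Re r)) /\
    filterlim (fun z => Im (c z)) F (locally (Im r))).
{ intros c Hc.
  destruct (lim_real (fun z => Re (c z))) as [r Hr].
  { intros z w. eapply Rle_trans; [|apply Hc]. apply (Re_le_Cmod (c z - c w)%C). }
  destruct (lim_real (fun z => Im (c z))) as [i Hi].
  { intros z w. eapply Rle_trans; [|apply Hc]. apply (Im_le_Cmod (c z - c w)%C). }
  exists (r, i). now split. }
destruct (functional_choice (fun k r => filterlim (fun z => Re (xc beta z k)) F (locally (Re r)) /\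
    filterlim (fun z => Im (xc beta z k)) F (locally (Im r)))) as [x Hx].
{ intros k. apply lim_C. intros z w. rewrite -xc_minus. apply coords_le_enorm. }
destruct (functional_choice (fun k r => filterlim (fun z => Re (yc beta z k)) F (locally (Re r)) /\
    filterlim (fun z => Im (yc beta z k)) F (locally (Im r)))) as [y Hy].
{ intros k. apply lim_C. intros z w. rewrite -yc_minus. apply coords_le_enorm. }
assert (Fat : forall (eps : posreal) z0, F (ball (z0 : en_UniformSpace beta) eps) ->
  let b k := Cmod (x k - xc beta z0 k) ^ 2 + Cmod (y k - yc beta z0 k) ^ 2 in
  ex_sumZ b /\ sumZ b <= 2 * (eps ^ 2 / (2 * PI))).
{ intros eps z0 H0 b.
  apply (sumZ_fatou F (fun z => density beta (minus z z0))).
  - intros z k. apply density_nonneg.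
  - intros k. eapply filterlim_ext.
    { intros z. unfold density. rewrite xc_minus yc_minus. reflexivity. }
    destruct (Hx k), (Hy k).
    refine (filterlim_Rplus F _ _ _ _ _ _); now apply: filterlim_Cmod_sq.
  - revert H0. apply filter_imp. intros z Hz. split. apply ex_density.
    change (enorm beta (minus z z0) < eps) in Hz. assert (P := two_PI_ge_1).
    assert (Q := enorm_sq beta (minus z z0)). assert (N := enorm_nonneg beta (minus z z0)).
    apply Rmult_le_reg_l with (2 * PI); [lra|]. rewrite -Q.
    replace (2 * PI * (eps ^ 2 / (2 * PI))) with (eps ^ 2) by (field; lra).
    apply pow_incr. lra. }
destruct (HC (mkposreal 1 Rlt_0_1)) as [z1 H1].
destruct (Fat _ _ H1) as [E1 _].
destruct (energy_of_coords beta (fun k => x k - xc beta z1 k)%C (fun k => y k - yc beta z1 k)%C E1)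
  as [d [dx dy]].
set (L := plus z1 d : E).
assert (Lx : forall k, xc beta L k = x k) by (intros k; unfold L; rewrite xc_plus dx; ring).
assert (Ly : forall k, yc beta L k = y k) by (intros k; unfold L; rewrite yc_plus dy; ring).
exists L. intros eps.
assert (He : 0 < eps / 3) by (destruct eps; simpl; lra).
destruct (HC (mkposreal _ He)) as [z0 H0]. destruct (Fat _ _ H0) as [_ B0].
assert (D : enorm beta (minus z0 L) < 2 * (eps / 3)).
{ rewrite enorm_minus_sym. simpl in B0. rewrite Rmult_1_r in B0.
  assert (Q := enorm_sq beta (minus L z0)). assert (N := enorm_nonneg beta (minus L z0)).
  rewrite (sumZ_ext _ (fun k => Cmod (x k - xc beta z0 k) ^ 2 + Cmod (y k - yc beta z0 k) ^ 2)) in Q.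
  2:{ intros k. unfold density. now rewrite xc_minus yc_minus Lx Ly. }
  assert (P := two_PI_ge_1).
  assert (B1 : 2 * PI * sumZ (fun k => Cmod (x k - xc beta z0 k) ^ 2 + Cmod (y k - yc beta z0 k) ^ 2)
     <= 2 * (eps / 3 * (eps / 3))).
  { replace (2 * (eps / 3 * (eps / 3))) with (2 * PI * (2 * (eps / 3 * (eps / 3) / (2 * PI)))) by (field; lra).
    apply Rmult_le_compat_l; [lra | exact B0]. }
  rewrite -Q in B1. apply Rnot_le_lt. intros C. nra. }
revert H0. apply filter_imp. intros z Hz. change (enorm beta (minus z z0) < eps / 3) in Hz.
change (enorm beta (minus z L) < eps). rewrite (minus_trans z0).
eapply Rle_lt_trans. apply enorm_triangle. lra.
Qed.

(** A complete space comes with a limit operator on filters; here it is chosen by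
    description from the existence of limits. *)
Definition energy_lim (F : (E -> Prop) -> Prop) : E :=
  epsilon (inhabits (en_zero beta)) (fun L => forall eps : posreal, F (ball (L : en_UniformSpace beta) eps)).

Lemma energy_lim_spec (F : (E -> Prop) -> Prop) : ProperFilter F ->
  cauchy (T := en_UniformSpace beta) F ->
  forall eps : posreal, F (ball (energy_lim F : en_UniformSpace beta) eps).
Proof. intros PF HC. apply (epsilon_spec _ _ (energy_complete F PF HC)). Qed.

Lemma energy_lim_ext (F1 F2 : (E -> Prop) -> Prop) : filter_le F1 F2 -> filter_le F2 F1 ->
  close (energy_lim F1 : en_UniformSpace beta) (energy_lim F2).
Proof.
intros H1 H2. replace F2 with F1. intros eps. apply ball_center.
apply functional_extensionality. intros P. apply propositional_extensionality. split; auto.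
Qed.

Definition energy_complete_mixin : CompleteSpace.mixin_of (en_UniformSpace beta) :=
  CompleteSpace.Mixin (en_UniformSpace beta) energy_lim energy_lim_spec energy_lim_ext.

(** The energy space as a real Banach space, over the realification used for
    time derivatives and integrals. *)
Definition real_energy : CompleteNormedModule R_AbsRing :=
  CompleteNormedModule.Pack R_AbsRing E
    (CompleteNormedModule.Class R_AbsRing E
       (NormedModule.class R_AbsRing (realify (en_NormedModule beta))) energy_complete_mixin) E.
End Completeness.

(** * Multiplication by a smooth function on L2 *)

(** Multiplication of the Fourier coefficients by 1 fixes [v], and it is defined
    on [f] by the right-hand side. *)
Lemma parseval (v : distT) (f : testT) :
  ex_sumZC (fun k => coef v k * t_coef f (- k))%C /\
  v f = (RtoC (2 * PI) * sumZC (fun k => coef v k * t_coef f (- k)))%C.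
Proof.
assert (Hs : bounded_symbol (fun _ => RtoC 1)).
{ exists 1. intros _. rewrite Cmod_1. lra. }
assert (E : forall k, (RtoC 1 * coef v k * t_coef f (- k))%C = (coef v k * t_coef f (- k))%C)
  by (intros; ring).
split.
- destruct (multiplier_ex _ v f Hs) as [A B].
  split; [eapply ex_sumZ_ext; [|exact A] | eapply ex_sumZ_ext; [|exact B]];
  intros k; exact (f_equal _ (E k)).
- rewrite -(sumZC_ext _ _ E).
  assert (V : d_multiplier _ Hs v = v).
  { apply coef_inj. intros k. rewrite coef_multiplier. ring. }
  exact (f_equal (fun d : distT => d f) (eq_sym V)).
Qed.

Definition t_conj (f : testT) : testT := MkTest (t_re f) (s_opp (t_im f)).

Lemma t_int_conj f : t_int (t_conj f) = Cconj (t_int f).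
Proof.
unfold t_int, Cconj; cbn [t_re t_im t_conj fst snd]. f_equal.
apply: (RInt_opp (V := R_CompleteNormedModule) (t_im f)). apply s_ex_RInt.
Qed.

Lemma t_coef_conj f k : t_coef (t_conj f) k = Cconj (t_coef f (- k)).
Proof.
assert (Hpi := PI_RGT_0).
unfold t_coef. rewrite Z.opp_involutive Cmult_conj -t_int_conj. f_equal.
- rewrite -RtoC_inv; [|lra]. unfold Cconj, RtoC; simpl; f_equal; ring.
- f_equal. apply testT_ext. intros x. unfold teval; simpl. rewrite opp_IZR.
  rewrite Ropp_mult_distr_l_reverse cos_neg sin_neg. f_equal; ring.
Qed.

(** [2 PI * t_norm2 f] is the integral of [|f|^2] ([t_norm2_parseval]); the
    coefficients are taken at [- k] because this is how they enter [parseval]. *)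
Definition t_norm2 (f : testT) : R := sumZ (fun k => Cmod (t_coef f (- k)) ^ 2).

Lemma t_norm2_parseval f :
  ex_sumZ (fun k => Cmod (t_coef f (- k)) ^ 2) /\
  Re (t_int (t_mult (t_conj f) f)) = 2 * PI * t_norm2 f.
Proof.
destruct (parseval (d_of_test (t_conj f)) f) as [[A _] B].
assert (E : forall k, Re (coef (d_of_test (t_conj f)) k * t_coef f (- k)) = Cmod (t_coef f (- k)) ^ 2).
{ intros k. rewrite coef_of_test t_coef_conj Cmult_comm -Cmod2_conj. reflexivity. }
split.
- eapply ex_sumZ_ext; [|exact A]. intros k. apply E.
- assert (B' := f_equal Re B). rewrite re_scal_l in B'. rewrite -[LHS]/(Re (d_of_test (t_conj f) f)) B'.
  f_equal. unfold t_norm2. rewrite Re_sumZC. apply sumZ_ext. exact E.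
Qed.

(** On the side of the integrals, multiplication by [c] is bounded pointwise. *)
Lemma t_norm2_smult (c : smoothT) (M : R) f : (forall x, Rabs (c x) <= M) ->
  t_norm2 (t_smult c f) <= M ^ 2 * t_norm2 f.
Proof.
intros H. assert (Hpi := PI_RGT_0).
apply Rmult_le_reg_l with (2 * PI); [lra|].
rewrite -(proj2 (t_norm2_parseval _)).
replace (2 * PI * (M ^ 2 * t_norm2 f)) with (M ^ 2 * (2 * PI * t_norm2 f)) by ring.
rewrite -(proj2 (t_norm2_parseval _)).
set (g := t_re (t_mult (t_conj (t_smult c f)) (t_smult c f))).
set (h := t_re (t_mult (t_conj f) f)).
change (RInt g 0 (2 * PI) <= M ^ 2 * RInt h 0 (2 * PI)).
replace (M ^ 2 * RInt h 0 (2 * PI)) with (RInt (s_mult (s_const (M ^ 2)) h) 0 (2 * PI)).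
2:{ apply: (RInt_scal (V := R_CompleteNormedModule) h). apply s_ex_RInt. }
apply RInt_le; try apply s_ex_RInt. lra.
intros x _. specialize (H x).
change (c x * t_re f x * (c x * t_re f x) + - (- (c x * t_im f x) * (c x * t_im f x)) <=
  M ^ 2 * (t_re f x * t_re f x + - (- t_im f x * t_im f x))).
assert (Q : c x * c x <= M ^ 2).
{ assert (T := pow2_abs (c x)). assert (0 <= Rabs (c x)) by apply Rabs_pos. nra. }
assert (0 <= t_re f x * t_re f x + t_im f x * t_im f x) by nra. nra.
Qed.

(** The Cauchy-Schwarz inequality, in the form
    [x y <= (delta x^2 + y^2 / delta) / 2] for each term. *)
Lemma pairing_bound (v : distT) f delta : 0 < delta -> ex_sumZ (fun k => Cmod (coef v k) ^ 2) ->
  Cmod (v f) <= 2 * PI * (delta * sumZ (fun k => Cmod (coef v k) ^ 2) + / delta * t_norm2 f).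
Proof.
intros Hd Hv. assert (Hpi := PI_RGT_0). destruct (t_norm2_parseval f) as [Hf _].
rewrite (proj2 (parseval v f)) Cmod_mult Cmod_R Rabs_pos_eq; [|lra].
apply Rmult_le_compat_l; [lra|].
eapply Rle_trans.
- apply sumZC_bound with (g := fun k => / 2 * (delta * Cmod (coef v k) ^ 2 + / delta * Cmod (t_coef f (- k)) ^ 2)).
  + intros k. rewrite Cmod_mult. set (x := Cmod (coef v k)). set (y := Cmod (t_coef f (- k))).
    assert (0 <= (delta * x - y) ^ 2 * / delta).
    { apply Rmult_le_pos. apply pow2_ge_0. left; now apply Rinv_0_lt_compat. }
    replace ((delta * x - y) ^ 2 * / delta) with (delta * x ^ 2 + / delta * y ^ 2 - 2 * (x * y)) in H
      by (field; lra). lra.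
  + apply ex_sumZ_scal, ex_sumZ_plus; now apply ex_sumZ_scal.
- rewrite sumZ_scal sumZ_plus; [|now apply ex_sumZ_scal..]. rewrite !sumZ_scal.
  unfold t_norm2. right; field. lra.
Qed.

Lemma t_coef_sum n f k : t_coef (t_sum n f) k = c_sum n (fun j => t_coef (f j) k).
Proof.
induction n; cbn [t_sum c_sum]; [|now rewrite t_coef_plus IHn].
replace (t_const 0) with (t_scal 0 (t_const 0)). rewrite t_coef_scal; ring.
apply testT_ext; intros. rewrite t_scalE t_constE; ring.
Qed.

Lemma c_sum_RtoC n (r : nat -> R) : c_sum (S n) (fun j => RtoC (r j)) = RtoC (sum_n r n).
Proof.
induction n. rewrite sum_O. cbn [c_sum]. ring.
change (c_sum (S n) (fun j => RtoC (r j)) + RtoC (r (S n)) = RtoC (sum_n r (S n)))%C.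
rewrite IHn sum_Sn -RtoC_plus. reflexivity.
Qed.

Lemma coef_pairing (v : distT) k : v (t_exp (- k)) = (RtoC (2 * PI) * coef v k)%C.
Proof. unfold coef. field. apply RtoC_2PI_neq. Qed.

(** Testing [c v] against the trigonometric polynomial built from finitely many
    of its own coefficients bounds these by the [L2] norm of [v]. *)
Lemma smult_partial_sum (c : smoothT) (M : R) (v : distT) (e : nat -> Z) n :
  1 <= M -> (forall x, Rabs (c x) <= M) -> (forall i j, e i = e j -> i = j) ->
  ex_sumZ (fun k => Cmod (coef v k) ^ 2) ->
  sum_n (fun j => Cmod (coef (d_smult c v) (e j)) ^ 2) n <=
    4 * M ^ 2 * sumZ (fun k => Cmod (coef v k) ^ 2).
Proof.
intros HM Hc He Hv. assert (Hpi := PI_RGT_0).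
set (w := fun j => coef (d_smult c v) (e j)).
set (phi := t_sum (S n) (fun j => t_scal (Cconj (w j)) (t_exp (- e j)))).
set (s := sum_n (fun j => Cmod (w j) ^ 2) n).
assert (A : d_smult c v phi = RtoC (2 * PI * s)).
{ unfold phi. rewrite dist_sum.
  rewrite (c_sum_ext _ _ (fun j => RtoC (2 * PI) * RtoC (Cmod (w j) ^ 2))%C).
  - rewrite c_sum_scal c_sum_RtoC -RtoC_mult. reflexivity.
  - intros j _. rewrite dist_scal coef_pairing Cmod2_conj. unfold w. ring. }
assert (cphi : forall j, (j < S n)%nat -> t_coef phi (- e j) = Cconj (w j)).
{ intros j Hj. unfold phi. rewrite t_coef_sum (c_sum_one _ _ j) //.
  - rewrite t_coef_scal t_coef_exp. destruct Z.eq_dec; [ring | easy].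
  - intros l Hl. rewrite t_coef_scal t_coef_exp. destruct Z.eq_dec as [E|]; [|ring].
    elim Hl. apply He. lia. }
assert (Nphi : t_norm2 phi = s).
{ apply Rmult_eq_reg_l with (2 * PI); [|lra]. rewrite -(proj2 (t_norm2_parseval phi)).
  change (t_int (t_mult (t_conj phi) phi)) with (d_of_test (t_conj phi) phi).
  unfold phi at 2. rewrite dist_sum.
  rewrite (c_sum_ext _ _ (fun j => RtoC (2 * PI) * RtoC (Cmod (w j) ^ 2))%C).
  - rewrite c_sum_scal c_sum_RtoC -RtoC_mult. reflexivity.
  - intros j Hj. rewrite dist_scal coef_pairing coef_of_test t_coef_conj cphi // Cconj_conj Cmod2_conj.
    ring. }
(* with this delta, the term in phi is at most s / 2 and is absorbed on the left *)
assert (B := pairing_bound v (t_smult c phi) (2 * M ^ 2)).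
change (v (t_smult c phi)) with (d_smult c v phi) in B. rewrite A Cmod_R in B.
assert (D := t_norm2_smult c M phi Hc). rewrite Nphi in D.
assert (M2 : 0 < M ^ 2) by nra. specialize (B ltac:(lra) Hv).
assert (B2 := Rle_trans _ _ _ (Rle_abs _) B). apply Rmult_le_reg_l in B2; [|lra].
assert (I : / (2 * M ^ 2) * t_norm2 (t_smult c phi) <= / 2 * s).
{ replace (/ 2 * s) with (/ (2 * M ^ 2) * (M ^ 2 * s)) by (field; lra).
  apply Rmult_le_compat_l; [|exact D]. left; apply Rinv_0_lt_compat; lra. }
change (s <= 4 * M ^ 2 * sumZ (fun k => Cmod (coef v k) ^ 2)). lra.
Qed.

Lemma smult_L2_bounded (c : smoothT) : exists K, 0 <= K /\ forall v,
  ex_sumZ (fun k => Cmod (coef v k) ^ 2) ->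
  ex_sumZ (fun k => Cmod (coef (d_smult c v) k) ^ 2) /\
  sumZ (fun k => Cmod (coef (d_smult c v) k) ^ 2) <= K * sumZ (fun k => Cmod (coef v k) ^ 2).
Proof.
destruct (s_bounded c) as [M [M0 HM]]. exists (2 * (4 * (M + 1) ^ 2)). split. nra.
intros v Hv.
assert (HM' : forall x, Rabs (c x) <= M + 1) by (intros x; specialize (HM x); lra).
rewrite (Rmult_assoc 2). apply bounded_nonneg_sumZ.
- intros k. apply pow2_ge_0.
- intros n. apply (smult_partial_sum c (M + 1) v (fun j => Z.of_nat j)); auto. lra. lia.
- intros n. apply (smult_partial_sum c (M + 1) v (fun j => (- Z.of_nat (S j))%Z)); auto. lra. lia.
Qed.

(** * The undamped group *)

Section Rotation.
Context (beta : posreal).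
Notation E := (energy beta).
Notation p := (p_symb beta).
Notation theta := (theta beta).
Notation xc := (xc beta).
Notation yc := (yc beta).
Notation density := (density beta).

(** The matrix with rows (c, - i s) and (- i s, c) is a multiple of a unitary one. *)
Lemma rotation_sq (c s : R) (x y : C) :
  Cmod (RtoC c * x - Ci * RtoC s * y) ^ 2 + Cmod (RtoC c * y - Ci * RtoC s * x) ^ 2 =
  (c ^ 2 + s ^ 2) * (Cmod x ^ 2 + Cmod y ^ 2).
Proof.
rewrite !Cmod2_alt. destruct x as [x1 x2], y as [y1 y2].
unfold Re, Im, Ci, RtoC, Cminus, Cplus, Cmult, Copp; cbn [fst snd]. ring.
Qed.

Definition rotates (c s : Z -> R) (z w : E) : Prop :=
  forall k, xc w k = (RtoC (c k) * xc z k - Ci * RtoC (s k) * yc z k)%C /\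
            yc w k = (RtoC (c k) * yc z k - Ci * RtoC (s k) * xc z k)%C.

Lemma rotates_density c s z w k : rotates c s z w ->
  density w k = (c k ^ 2 + s k ^ 2) * density z k.
Proof. intros H. destruct (H k) as [Hx Hy]. rewrite densityE Hx Hy. apply rotation_sq. Qed.

Lemma rotates_ex c s z : ex_sumZ (fun k => (c k ^ 2 + s k ^ 2) * density z k) ->
  exists w, rotates c s z w.
Proof.
intros H. destruct (energy_of_coords beta
  (fun k => RtoC (c k) * xc z k - Ci * RtoC (s k) * yc z k)%C
  (fun k => RtoC (c k) * yc z k - Ci * RtoC (s k) * xc z k)%C) as [w [Hx Hy]].
- eapply ex_sumZ_ext; [|exact H]. intros k; cbv beta. symmetry. apply rotation_sq.
- exists w. intros k. now split.
Qed.

Lemma rotates_unique c s z w w' : rotates c s z w -> rotates c s z w' -> w = w'.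
Proof.
intros H H'. apply coords_ext; intros k; destruct (H k) as [A B], (H' k) as [A' B']; congruence.
Qed.

(** Dominated convergence: it suffices to control each Fourier mode, with a
    summable bound. *)
Lemma energy_limit {T} (F : (T -> Prop) -> Prop) {FF : Filter F} (f : T -> E) (l : E) (g : Z -> R) :
  ex_sumZ g -> F (fun t => forall k, density (minus (f t) l) k <= g k) ->
  (forall k, filterlim (fun t => density (minus (f t) l) k) F (locally 0)) ->
  filterlim f F (locally (l : real_energy beta)).
Proof.
intros Hg D L. apply (filterlim_minus_zero (Y := real_energy beta) F f l).
change (filterlim (fun t => enorm beta (minus (f t) l)) F (locally 0)).
eapply filterlim_ext. { intros t. symmetry. apply enorm_density. }
replace 0 with (sqrt (2 * PI * 0)) by (rewrite Rmult_0_r; apply sqrt_0).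
eapply filterlim_comp; [|apply continuous_sqrt].
refine (filterlim_Rmult F _ _ _ _ _ _). apply filterlim_const.
refine (sumZ_dominated F _ g Hg _ L). revert D. apply filter_imp. intros t Ht k.
split; auto. apply density_nonneg.
Qed.

Lemma coords_limit {T} (F : (T -> Prop) -> Prop) {FF : Filter F} (f : T -> E) (l : E) k :
  filterlim f F (locally (l : real_energy beta)) ->
  (filterlim (fun t => Re (xc (f t) k)) F (locally (Re (xc l k))) /\
   filterlim (fun t => Im (xc (f t) k)) F (locally (Im (xc l k)))) /\
  (filterlim (fun t => Re (yc (f t) k)) F (locally (Re (yc l k))) /\
   filterlim (fun t => Im (yc (f t) k)) F (locally (Im (yc l k)))).
Proof.
intros H. apply (filterlim_minus_zero (Y := real_energy beta) F f l) in H.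
change (filterlim (fun t => enorm beta (minus (f t) l)) F (locally 0)) in H.
assert (Q : forall (u : T -> R) r, (forall t, Rabs (u t - r) <= enorm beta (minus (f t) l)) ->
  filterlim u F (locally r)).
{ intros u r Hu. apply (filterlim_minus_zero (Y := R_NormedModule) F u r).
  apply (filterlim_squeeze_zero (Y := R_NormedModule) F _ (fun t => enorm beta (minus (f t) l))); auto.
  apply filter_forall. intros t. change (Rabs (Rabs (u t - r)) <= enorm beta (minus (f t) l)).
  rewrite Rabs_Rabsolu. apply Hu. }
assert (N := fun t => coords_le_enorm beta (minus (f t) l) k).
split; split; apply Q; intros t; destruct (N t) as [Nx Ny]; rewrite ?xc_minus ?yc_minus in Nx Ny.
- eapply Rle_trans; [apply (Re_le_Cmod (xc (f t) k - xc l k)%C) | exact Nx].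
- eapply Rle_trans; [apply (Im_le_Cmod (xc (f t) k - xc l k)%C) | exact Nx].
- eapply Rle_trans; [apply (Re_le_Cmod (yc (f t) k - yc l k)%C) | exact Ny].
- eapply Rle_trans; [apply (Im_le_Cmod (yc (f t) k - yc l k)%C) | exact Ny].
Qed.

Lemma Rabs_sin_le x : Rabs (sin x) <= Rabs x.
Proof.
destruct (MVT_gen sin 0 x cos) as [c [_ Hc]].
- intros; auto_derive; auto; ring.
- intros. apply continuity_pt_filterlim. apply: ex_derive_continuous. auto_derive; auto.
- rewrite sin_0 !Rminus_0_r in Hc. rewrite Hc Rabs_mult.
  assert (Rabs (cos c) <= 1) by (apply Rabs_le, COS_bound).
  assert (0 <= Rabs x) by apply Rabs_pos. nra.
Qed.

Lemma Rabs_cos_minus_1_le x : Rabs (cos x - 1) <= Rabs x.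
Proof.
destruct (MVT_gen cos 0 x (fun t => - sin t)) as [c [_ Hc]].
- intros; auto_derive; auto; ring.
- intros. apply continuity_pt_filterlim. apply: ex_derive_continuous. auto_derive; auto.
- rewrite cos_0 Rminus_0_r in Hc. rewrite Hc Rabs_mult Rabs_Ropp.
  assert (Rabs (sin c) <= 1) by (apply Rabs_le, SIN_bound).
  assert (0 <= Rabs x) by apply Rabs_pos. nra.
Qed.

Lemma cos_sin_sq x : cos x ^ 2 + sin x ^ 2 = 1.
Proof. assert (H := sin2_cos2 x). unfold Rsqr in H. lra. Qed.

Definition rotation_at (t : R) : E -> E -> Prop :=
  rotates (fun k => cos (theta k * t)) (fun k => sin (theta k * t)).

(** The undamped operator in Fourier coordinates. *)
Definition skew (z w : E) : Prop := rotates (fun _ => 0) theta z w.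

(** In each Fourier mode [U t] is the exponential of [t] times the skew-adjoint
    matrix of the operator. Both [U t z - z] and the error of the difference
    quotient are again of the form [rotates], so by [rotation_sq] their densities
    are multiples of the density of [z]; these are dominated by 4 times the density
    of [z] and by 5 times that of its image, respectively. *)
Lemma undamped_group : exists U : R -> E -> E,
  C0_group (Y := real_energy beta) U (fun _ => 1) /\
  (forall t c z, U t (en_scal beta c z) = en_scal beta c (U t z)) /\
  (forall z w, generator (Y := real_energy beta) U z w <-> skew z w).
Proof.
destruct (functional_choice (fun (q : R * E) w => rotation_at (fst q) (snd q) w)) as [U0 HU0].
{ intros [t z]. apply rotates_ex. eapply ex_sumZ_ext; [|exact (ex_density beta z)].
  intros k; cbn [fst snd]. rewrite cos_sin_sq. ring. }
set (U := fun t z => U0 (t, z)). exists U.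
assert (HU : forall t z, rotation_at t z (U t z)) by (intros t z; apply (HU0 (t, z))).
assert (Uscal : forall t c z, U t (en_scal beta c z) = en_scal beta c (U t z)).
{ intros t c z. apply (rotates_unique _ _ _ _ _ (HU t _)). intros k.
  destruct (HU t z k) as [A B]. rewrite !xc_scal !yc_scal A B. split; ring. }
assert (Unorm : forall t z, enorm beta (U t z) = enorm beta z).
{ intros t z. rewrite !enorm_density. do 2 f_equal. apply sumZ_ext. intros k.
  rewrite (rotates_density _ _ _ _ k (HU t z)) cos_sin_sq. ring. }
assert (Uquot : forall h z k,
  xc (en_scal beta (RtoC (/ h)) (minus (U h z) z)) k =
    (RtoC (/ h * (cos (theta k * h) - 1)) * xc z k - Ci * RtoC (/ h * sin (theta k * h)) * yc z k)%C /\
  yc (en_scal beta (RtoC (/ h)) (minus (U h z) z)) k =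
    (RtoC (/ h * (cos (theta k * h) - 1)) * yc z k - Ci * RtoC (/ h * sin (theta k * h)) * xc z k)%C).
{ intros h z k. destruct (HU h z k) as [A B].
  rewrite xc_scal yc_scal xc_minus yc_minus A B !RtoC_mult RtoC_minus. split; ring. }
assert (Lc : forall k, filterlim (fun h => / h * (cos (theta k * h) - 1)) (at_right 0) (locally 0)).
{ intros k. assert (D : is_derive (fun h => cos (theta k * h)) 0 (0 : R)).
  { auto_derive; auto. rewrite !Rmult_0_r sin_0. ring. }
  apply (is_derive_quot (Y := R_NormedModule)) in D. apply (quot_at_right (Y := R_NormedModule)) in D.
  eapply filterlim_ext; [|exact D]. intros h. rewrite Rmult_0_r cos_0. reflexivity. }
assert (Ls : forall k, filterlim (fun h => / h * sin (theta k * h)) (at_right 0) (locally (theta k))).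
{ intros k. assert (D : is_derive (fun h => sin (theta k * h)) 0 (theta k : R)).
  { auto_derive; auto. rewrite !Rmult_0_r cos_0. ring. }
  apply (is_derive_quot (Y := R_NormedModule)) in D. apply (quot_at_right (Y := R_NormedModule)) in D.
  eapply filterlim_ext; [|exact D]. intros h. rewrite Rmult_0_r sin_0.
  change (/ h * (sin (theta k * h) - 0) = / h * sin (theta k * h)). now rewrite Rminus_0_r. }
split; [|split; [exact Uscal|]].
- apply (contraction_group (Y := real_energy beta)).
  + intros t. split.
    * intros z w. apply (rotates_unique _ _ _ _ _ (HU t (plus (z : E) w))). intros k.
      destruct (HU t z k) as [A B], (HU t w k) as [A' B'].
      change (xc (plus (U t z) (U t w)) k = (RtoC (cos (theta k * t)) * xc (plus (z : E) w) k -
          Ci * RtoC (sin (theta k * t)) * yc (plus (z : E) w) k)%C /\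
        yc (plus (U t z) (U t w)) k = (RtoC (cos (theta k * t)) * yc (plus (z : E) w) k -
          Ci * RtoC (sin (theta k * t)) * xc (plus (z : E) w) k)%C).
      rewrite !xc_plus !yc_plus A B A' B'. split; ring.
    * intros r z. apply (Uscal t (RtoC r) z).
    * exists 1. split; [lra|]. intros z. right. change (enorm beta (U t z) = 1 * enorm beta z).
      rewrite Unorm. ring.
  + intros t z. right. apply Unorm.
  + intros z. apply (rotates_unique _ _ _ _ _ (HU 0 z)). intros k.
    rewrite Rmult_0_r cos_0 sin_0. split; ring.
  + intros s t z. apply (rotates_unique _ _ _ _ _ (HU (s + t) z)). intros k.
    destruct (HU s (U t z) k) as [A B], (HU t z k) as [A' B'].
    rewrite A B A' B' Rmult_plus_distr_l cos_plus sin_plus RtoC_minus RtoC_plus !RtoC_mult.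
    assert (I2 : (Ci * Ci = RtoC (-1))%C) by (unfold Ci, Cmult, RtoC; simpl; f_equal; ring).
    set (cs := RtoC (cos (theta k * s))). set (ss := RtoC (sin (theta k * s))).
    set (ct := RtoC (cos (theta k * t))). set (st := RtoC (sin (theta k * t))).
    assert (R1 : (RtoC (-1) = - (1))%C) by (unfold Copp, RtoC; simpl; f_equal; ring).
    rewrite R1 in I2.
    split.
    * transitivity (cs * ct * xc z k - Ci * (cs * st + ss * ct) * yc z k + (Ci * Ci) * ss * st * xc z k)%C;
      [ring | rewrite I2; ring].
    * transitivity (cs * ct * yc z k - Ci * (cs * st + ss * ct) * xc z k + (Ci * Ci) * ss * st * yc z k)%C;
      [ring | rewrite I2; ring].
  + intros z.
    assert (Dk : forall t k, density (minus (U t z) z) k =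
      ((cos (theta k * t) - 1) ^ 2 + sin (theta k * t) ^ 2) * density z k).
    { intros t k. apply (rotates_density (fun k => cos (theta k * t) - 1) (fun k => sin (theta k * t))).
      intros l. destruct (HU t z l) as [A B]. rewrite xc_minus yc_minus A B RtoC_minus. split; ring. }
    apply (energy_limit (locally 0) (fun t => U t z) z (fun k => 4 * density z k)).
    * apply ex_sumZ_scal, ex_density.
    * apply filter_forall. intros t k. rewrite Dk. apply Rmult_le_compat_r. apply density_nonneg.
      assert (H := cos_sin_sq (theta k * t)). assert (H1 := COS_bound (theta k * t)). nra.
    * intros k. eapply filterlim_ext. { intros t. symmetry. apply Dk. }
      assert (Q : continuous (fun t => ((cos (theta k * t) - 1) ^ 2 + sin (theta k * t) ^ 2) * density z k) 0).
      { apply: ex_derive_continuous. auto_derive; auto. }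
      unfold continuous in Q. rewrite Rmult_0_r cos_0 sin_0 in Q.
      replace 0 with (((1 - 1) ^ 2 + 0 ^ 2) * density z k) at 2 by ring. exact Q.
- intros z w. split.
  + intros G k.
    assert (HG := coords_limit (at_right 0) (fun h => en_scal beta (RtoC (/ h)) (minus (U h z) z)) w k G).
    destruct HG as [[X1 X2] [Y1 Y2]].
    assert (Lim : forall r i : R,
      filterlim (fun h => / h * (cos (theta k * h) - 1) * r + / h * sin (theta k * h) * i)
        (at_right 0) (locally (theta k * i))).
    { intros r i. replace (theta k * i) with (0 * r + theta k * i) by ring.
      refine (filterlim_Rplus (at_right 0) _ _ _ _ _ _).
      - refine (filterlim_Rmult (at_right 0) _ _ _ _ (Lc k) _). apply filterlim_const.
      - refine (filterlim_Rmult (at_right 0) _ _ _ _ (Ls k) _). apply filterlim_const. }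
    assert (Uq : forall (f : R -> R) u v, filterlim f (at_right 0) (locally u) ->
       filterlim f (at_right 0) (locally v) -> u = v).
    { intros f u v. exact (filterlim_locally_unique (F := at_right 0) (V := R_NormedModule) f u v). }
    assert (EX1 : Re (xc w k) = theta k * Im (yc z k)).
    { apply (Uq _ _ _ X1). eapply filterlim_ext; [|apply (Lim (Re (xc z k)) (Im (yc z k)))].
      intros h. rewrite (proj1 (Uquot h z k)).
      unfold Re, Im, Ci, RtoC, Cminus, Cplus, Cmult, Copp; cbn [fst snd]. ring. }
    assert (EX2 : Im (xc w k) = theta k * - Re (yc z k)).
    { apply (Uq _ _ _ X2). eapply filterlim_ext; [|apply (Lim (Im (xc z k)) (- Re (yc z k)))].
      intros h. rewrite (proj1 (Uquot h z k)).
      unfold Re, Im, Ci, RtoC, Cminus, Cplus, Cmult, Copp; cbn [fst snd]. ring. }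
    assert (EY1 : Re (yc w k) = theta k * Im (xc z k)).
    { apply (Uq _ _ _ Y1). eapply filterlim_ext; [|apply (Lim (Re (yc z k)) (Im (xc z k)))].
      intros h. rewrite (proj2 (Uquot h z k)).
      unfold Re, Im, Ci, RtoC, Cminus, Cplus, Cmult, Copp; cbn [fst snd]. ring. }
    assert (EY2 : Im (yc w k) = theta k * - Re (xc z k)).
    { apply (Uq _ _ _ Y2). eapply filterlim_ext; [|apply (Lim (Im (yc z k)) (- Re (xc z k)))].
      intros h. rewrite (proj2 (Uquot h z k)).
      unfold Re, Im, Ci, RtoC, Cminus, Cplus, Cmult, Copp; cbn [fst snd]. ring. }
    split; apply injective_projections; unfold Re, Im in *; rewrite ?EX1 ?EX2 ?EY1 ?EY2;
    unfold Ci, RtoC, Cminus, Cplus, Cmult, Copp; cbn [fst snd]; ring.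
  + intros G.
    assert (Dw := fun k => rotates_density _ _ _ _ k G). cbv beta in Dw.
    assert (Dk : forall h k, density (minus (en_scal beta (RtoC (/ h)) (minus (U h z) z)) w) k =
      ((/ h * (cos (theta k * h) - 1)) ^ 2 + (/ h * sin (theta k * h) - theta k) ^ 2) * density z k).
    { intros h k. apply (rotates_density (fun k => / h * (cos (theta k * h) - 1))
        (fun k => / h * sin (theta k * h) - theta k)).
      intros l. destruct (Uquot h z l) as [A B], (G l) as [A' B'].
      rewrite xc_minus yc_minus A B A' B' RtoC_minus. split; ring. }
    apply (energy_limit (at_right 0) (fun h => en_scal beta (RtoC (/ h)) (minus (U h z) z)) w
       (fun k => 5 * density w k)).
    * apply ex_sumZ_scal, ex_density.
    * exists (mkposreal 1 Rlt_0_1). intros h _ Hh k. rewrite Dk Dw.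
      replace (5 * ((0 ^ 2 + theta k ^ 2) * density z k)) with (5 * theta k ^ 2 * density z k) by ring.
      apply Rmult_le_compat_r. apply density_nonneg.
      assert (K : forall r, Rabs r <= Rabs (theta k * h) -> Rabs (/ h * r) <= Rabs (theta k)).
      { intros r Hr. rewrite Rabs_mult Rabs_inv (Rabs_pos_eq h); [|lra].
        rewrite Rabs_mult (Rabs_pos_eq h) in Hr; [|lra].
        apply Rmult_le_reg_l with h; [lra|]. rewrite -Rmult_assoc Rinv_r; lra. }
      assert (K1 := K _ (Rabs_cos_minus_1_le (theta k * h))).
      assert (K2 := K _ (Rabs_sin_le (theta k * h))).
      set (u := / h * (cos (theta k * h) - 1)) in *. set (v := / h * sin (theta k * h)) in *.
      assert (T0 := Rabs_pos (theta k)).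
      assert (U2 : u ^ 2 <= theta k ^ 2).
      { rewrite -(pow2_abs u) -(pow2_abs (theta k)). apply pow_incr. split; auto. apply Rabs_pos. }
      assert (V2 : v ^ 2 <= theta k ^ 2).
      { rewrite -(pow2_abs v) -(pow2_abs (theta k)). apply pow_incr. split; auto. apply Rabs_pos. }
      assert (0 <= (v + theta k) ^ 2) by apply pow2_ge_0. nra.
    * intros k. eapply filterlim_ext. { intros h. symmetry. apply Dk. }
      replace 0 with ((0 * 0 + (theta k + - theta k) * (theta k + - theta k)) * density z k) at 2 by ring.
      apply filterlim_ext with (fun h =>
       ((/ h * (cos (theta k * h) - 1)) * (/ h * (cos (theta k * h) - 1)) +
        (/ h * sin (theta k * h) + - theta k) * (/ h * sin (theta k * h) + - theta k)) * density z k).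
      { intros h. ring. }
      assert (Ls' : filterlim (fun h => / h * sin (theta k * h) + - theta k) (at_right 0)
        (locally (theta k + - theta k))).
      { refine (filterlim_Rplus (at_right 0) _ _ _ _ (Ls k) _). apply filterlim_const. }
      refine (filterlim_Rmult (at_right 0) _ _ _ _ _ _); [|apply filterlim_const].
      refine (filterlim_Rplus (at_right 0) _ _ _ _ _ _);
      refine (filterlim_Rmult (at_right 0) _ _ _ _ _ _); auto.
Qed.
End Rotation.

(** * The operators of the damped system in Fourier coordinates *)

Section Operators.
Context (beta : posreal).
Notation E := (energy beta).
Notation p := (p_symb beta).
Notation theta := (theta beta).
Notation xc := (xc beta).
Notation yc := (yc beta).
Notation density := (density beta).

Lemma m_symb_p_symb k : m_symb beta k = IZR k * p k.
Proof.
assert (Hb := cond_pos beta). unfold m_symb, p_symb. destruct Z.eq_dec as [->|Hk].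
- rewrite Rmult_0_r. unfold tanh. rewrite sinh_0. unfold Rdiv. ring.
- field. split; [|lra]. intros Q. now apply eq_IZR in Q.
Qed.

Lemma theta_sq k : theta k ^ 2 = IZR k ^ 2 * p k.
Proof.
rewrite thetaE Rpow_mult_distr. f_equal. simpl. rewrite Rmult_1_r. apply sqrt_p_sq.
Qed.

Lemma coef_opA z k :
  coef (fst (opA beta (en_h z, en_u z))) k = (RtoC 0 * xc z k - Ci * RtoC (theta k) * yc z k)%C /\
  (RtoC (sqrt (p k)) * coef (snd (opA beta (en_h z, en_u z))) k =
     RtoC 0 * yc z k - Ci * RtoC (theta k) * xc z k)%C.
Proof.
split.
- cbn [opA fst snd]. unfold Tbeta. rewrite coef_multiplier m_symb_p_symb -(sqrt_p_sq beta k).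
  rewrite thetaE ycE !RtoC_mult. ring.
- cbn [opA fst snd]. unfold d_opp. rewrite coef_scal coef_deriv.
  rewrite thetaE xcE RtoC_mult. ring.
Qed.

(** [p k] is comparable to [1 / (1 + |k|)], so that [theta k ^ 2] is comparable
    to [|k|]: bounding [theta x] and [theta y] in [l2] is the domain condition. *)
Lemma domA_iff (z : E) :
  domA beta z <-> ex_sumZ (fun k => theta k ^ 2 * density z k).
Proof.
assert (Hb := cond_pos beta).
assert (k_or : forall k, k = 0%Z \/ 1 <= Rabs (IZR k)).
{ intros k. destruct (Z.eq_dec k 0); auto. right. now apply IZR_abs_ge1. }
assert (D : forall k, theta k ^ 2 * density z k =
  IZR k ^ 2 * p k * Cmod (coef (en_h z) k) ^ 2 + (IZR k * p k) ^ 2 * Cmod (coef (en_u z) k) ^ 2).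
{ intros k. rewrite theta_sq densityE yc_sq xcE. ring. }
assert (Nk : forall k, IZR k ^ 2 = Rabs (IZR k) ^ 2) by (intros; symmetry; apply pow2_abs).
split.
- intros [Hh Hu]. apply Hs0_iff in Hu.
  eapply ex_sumZ_nonneg_le; [|apply ex_sumZ_plus;
    [exact (ex_sumZ_scal (/ beta) _ Hh) | exact (ex_sumZ_scal (/ beta ^ 2) _ Hu)]].
  intros k; cbv beta. rewrite D weight_half.
  assert (A := pow2_ge_0 (Cmod (coef (en_h z) k))). assert (B := pow2_ge_0 (Cmod (coef (en_u z) k))).
  assert (Pp := p_symb_pos beta k). assert (K2 := pow2_ge_0 (IZR k)).
  split. { apply Rplus_le_le_0_compat; apply Rmult_le_pos; auto. nra. apply pow2_ge_0. }
  assert (U : Rabs (IZR k) * p k <= / beta).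
  { destruct (k_or k) as [->|Hk]. rewrite Rabs_R0 Rmult_0_l. left; now apply Rinv_0_lt_compat.
    assert (Hk0 : k <> 0%Z) by (intros ->; rewrite Rabs_R0 in Hk; lra).
    apply Rle_trans with (Rabs (IZR k) * / (beta * Rabs (IZR k))).
    apply Rmult_le_compat_l; [lra | now apply p_symb_le]. right; field; lra. }
  assert (T0 := Rabs_pos (IZR k)). assert (T1 := Rabs_IZR_le_sqrt k).
  assert (Ib : 0 < / beta) by now apply Rinv_0_lt_compat.
  apply Rplus_le_compat.
  + rewrite -Rmult_assoc. apply Rmult_le_compat_r; auto. rewrite {1}Nk.
    replace (Rabs (IZR k) ^ 2 * p k) with (Rabs (IZR k) * p k * Rabs (IZR k)) by ring.
    apply Rmult_le_compat; auto. nra.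
  + apply Rmult_le_compat_r; auto. rewrite Rpow_mult_distr Nk -Rpow_mult_distr -pow_inv.
    apply pow_incr. split; auto. nra.
- intros H.
  assert (L : forall k, k <> 0%Z -> / (1 + beta) <= Rabs (IZR k) * p k).
  { intros k Hk. assert (K1 := IZR_abs_ge1 k Hk). assert (Q := p_symb_lower beta k).
    apply Rle_trans with (Rabs (IZR k) * / (1 + beta * Rabs (IZR k))).
    2: apply Rmult_le_compat_l; lra.
    apply Rmult_le_reg_l with ((1 + beta) * (1 + beta * Rabs (IZR k))). nra.
    replace ((1 + beta) * (1 + beta * Rabs (IZR k)) * / (1 + beta)) with (1 + beta * Rabs (IZR k)) by (field; lra).
    replace ((1 + beta) * (1 + beta * Rabs (IZR k)) * (Rabs (IZR k) * / (1 + beta * Rabs (IZR k))))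
      with ((1 + beta) * Rabs (IZR k)) by (field; nra). nra. }
  assert (L' : forall k, k <> 0%Z -> 1 <= (1 + beta) * (Rabs (IZR k) * p k)).
  { intros k Hk. specialize (L k Hk). apply (Rmult_le_compat_l (1 + beta)) in L; [|lra].
    rewrite Rinv_r in L; lra. }
  split.
  + eapply ex_sumZ_nonneg_le; [|apply ex_sumZ_plus;
      [exact (ex_density beta z) | exact (ex_sumZ_scal (1 + beta) _ H)]].
    intros k; cbv beta. rewrite D weight_half densityE yc_sq xcE.
    set (A := Cmod (coef (en_h z) k) ^ 2). set (B := Cmod (coef (en_u z) k) ^ 2).
    assert (A0 : 0 <= A) by apply pow2_ge_0. assert (B0 : 0 <= B) by apply pow2_ge_0.
    assert (Pp := p_symb_pos beta k). assert (S1 := one_le_sqrt k). assert (T0 := Rabs_pos (IZR k)).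
    split. { apply Rmult_le_pos; auto. lra. }
    assert (S2 : sqrt (1 + IZR k ^ 2) <= 1 + Rabs (IZR k)).
    { rewrite -(sqrt_pow2 (1 + Rabs (IZR k))); [|lra]. apply sqrt_le_1_alt. rewrite Nk. nra. }
    assert (S3 : Rabs (IZR k) <= (1 + beta) * (IZR k ^ 2 * p k)).
    { destruct (Z.eq_dec k 0) as [->|Hk]. rewrite Rabs_R0. simpl. lra.
      rewrite Nk. specialize (L' k Hk). nra. }
    assert (0 <= p k * B) by nra. assert (0 <= (IZR k * p k) ^ 2 * B).
    { apply Rmult_le_pos; auto. apply pow2_ge_0. }
    apply Rle_trans with ((1 + (1 + beta) * (IZR k ^ 2 * p k)) * A).
    { apply Rmult_le_compat_r; lra. }
    assert (0 <= (1 + beta) * ((IZR k * p k) ^ 2 * B)) by (apply Rmult_le_pos; lra). nra.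
  + apply Hs0_iff.
    eapply ex_sumZ_nonneg_le; [|exact (ex_sumZ_scal ((1 + beta) ^ 2) _
      (ex_sumZ_plus _ _ (ex_density beta z) H))].
    intros k; cbv beta. rewrite D densityE yc_sq xcE.
    set (A := Cmod (coef (en_h z) k) ^ 2). set (B := Cmod (coef (en_u z) k) ^ 2).
    assert (A0 : 0 <= A) by apply pow2_ge_0. assert (B0 : 0 <= B) by apply pow2_ge_0.
    assert (Pp := p_symb_pos beta k). split; auto.
    assert (Q0 : 0 <= IZR k ^ 2 * p k * A).
    { apply Rmult_le_pos; auto. apply Rmult_le_pos; [apply pow2_ge_0 | lra]. }
    assert (Q : 1 <= (1 + beta) ^ 2 * (p k + (IZR k * p k) ^ 2)).
    { destruct (Z.eq_dec k 0) as [->|Hk].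
      - replace (p 0) with 1 by reflexivity. nra.
      - specialize (L' k Hk). rewrite Rpow_mult_distr Nk -Rpow_mult_distr.
        set (r := (1 + beta) * (Rabs (IZR k) * p k)) in *.
        assert (E1 : (1 + beta) ^ 2 * (Rabs (IZR k) * p k) ^ 2 = r ^ 2) by (unfold r; ring).
        rewrite Rmult_plus_distr_l E1. assert (0 <= (1 + beta) ^ 2 * p k).
        { apply Rmult_le_pos; [apply pow2_ge_0 | lra]. } nra. }
    apply (Rmult_le_compat_r B) in Q; auto. rewrite Rmult_1_l in Q.
    eapply Rle_trans. exact Q.
    replace ((1 + beta) ^ 2 * (p k + (IZR k * p k) ^ 2) * B) with
      ((1 + beta) ^ 2 * (p k * B + (IZR k * p k) ^ 2 * B)) by ring.
    apply Rmult_le_compat_l. apply pow2_ge_0. lra.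
Qed.

Lemma skew_density (z w : E) k : skew beta z w -> density w k = theta k ^ 2 * density z k.
Proof. intros H. rewrite (rotates_density beta _ _ _ _ k H). ring. Qed.

Lemma skew_domA (z w : E) : skew beta z w -> domA beta z.
Proof.
intros H. apply domA_iff. eapply ex_sumZ_ext; [|exact (ex_density beta w)].
intros k. now apply skew_density.
Qed.

Lemma domA_skew_ex (z : E) : domA beta z -> exists w, skew beta z w.
Proof.
intros H. apply domA_iff in H. apply rotates_ex. eapply ex_sumZ_ext; [|exact H].
intros k; cbv beta. ring.
Qed.

Context (a b : smoothT).

Lemma d_smult_plus (c : smoothT) v w : d_smult c (d_plus v w) = d_plus (d_smult c v) (d_smult c w).
Proof. apply distT_ext. reflexivity. Qed.
Lemma d_smult_scal (c : smoothT) r v : d_smult c (d_scal r v) = d_scal r (d_smult c v).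
Proof. apply distT_ext. reflexivity. Qed.
Lemma Pbeta_plus v w : Pbeta beta (d_plus v w) = d_plus (Pbeta beta v) (Pbeta beta w).
Proof.
apply coef_inj. intros k. unfold Pbeta. rewrite coef_plus !coef_multiplier coef_plus. ring.
Qed.
Lemma Pbeta_scal r v : Pbeta beta (d_scal r v) = d_scal r (Pbeta beta v).
Proof.
apply coef_inj. intros k. unfold Pbeta. rewrite coef_scal !coef_multiplier coef_scal. ring.
Qed.

Definition damps (z w : E) : Prop := (en_h w, en_u w) = opD beta a b (en_h z, en_u z).

Lemma damps_unique z w w' : damps z w -> damps z w' -> w = w'.
Proof.
unfold damps. intros H H'. rewrite -H' in H. injection H. intros A B. now apply energy_ext.
Qed.

(** [p k ^ 2 |u^(k)|^2] is at most a constant times [p k |u^(k)|^2]: P maps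
    H^(-1/2) into L^2, where multiplication by [b ^ 2] is bounded. *)
Lemma damping_operator : exists (B : E -> E) (C : R), 0 < C /\
  (forall z, damps z (B z)) /\
  (forall z w, B (plus z w) = plus (B z) (B w)) /\
  (forall c z, B (en_scal beta c z) = en_scal beta c (B z)) /\
  (forall z, enorm beta (B z) <= C * enorm beta z).
Proof.
destruct (smult_L2_bounded (s_mult a a)) as [K1 [K1p H1]].
destruct (smult_L2_bounded (s_mult b b)) as [K2 [K2p H2]].
destruct (p_symb_upper beta) as [P [Pp HP]].
assert (xE : forall z : E, ex_sumZ (fun k => Cmod (coef (en_h z) k) ^ 2)).
{ intros z. apply Hs0_iff, en_h_L2. }
assert (yE : forall z : E, ex_sumZ (fun k => Cmod (yc z k) ^ 2)).
{ intros z. eapply ex_sumZ_ext; [|exact (en_ex_u beta z)]. intros k. unfold w2. now rewrite yc_sq. }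
assert (pu : forall (z : E) k, 0 <= Cmod (coef (Pbeta beta (en_u z)) k) ^ 2 <= P * Cmod (yc z k) ^ 2).
{ intros z k. split. apply pow2_ge_0. unfold Pbeta. rewrite coef_multiplier Cmod_mult Cmod_R yc_sq.
  assert (Q := p_symb_pos beta k). rewrite Rabs_pos_eq; [|lra]. rewrite Rpow_mult_distr -Rmult_assoc.
  apply Rmult_le_compat_r. apply pow2_ge_0. specialize (HP k). nra. }
assert (puE : forall z : E, ex_sumZ (fun k => Cmod (coef (Pbeta beta (en_u z)) k) ^ 2)).
{ intros z. eapply ex_sumZ_nonneg_le; [apply pu | exact (ex_sumZ_scal P _ (yE z))]. }
destruct (functional_choice damps) as [B HB].
{ intros z. destruct (H1 _ (xE z)) as [Eh _], (H2 _ (puE z)) as [Eu _].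
  assert (Lh : Hs 0 (d_smult (s_mult a a) (en_h z))) by now apply Hs0_iff.
  assert (Lu : Hs (- / 2) (d_smult (s_mult b b) (Pbeta beta (en_u z)))).
  { eapply ex_sumZ_nonneg_le; [|exact Eu]. intros k; cbv beta.
    rewrite weight_minus_half. assert (S1 := one_le_sqrt k).
    assert (I1 : / sqrt (1 + IZR k ^ 2) <= 1).
    { rewrite -[X in _ <= X]Rinv_1. apply Rinv_le_contravar; lra. }
    assert (I0 : 0 < / sqrt (1 + IZR k ^ 2)) by (apply Rinv_0_lt_compat; lra).
    assert (Q := pow2_ge_0 (Cmod (coef (d_smult (s_mult b b) (Pbeta beta (en_u z))) k))). nra. }
  exists (MkEnergy _ _ Lh Lu). reflexivity. }
assert (Bh : forall z, en_h (B z) = d_smult (s_mult a a) (en_h z)).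
{ intros z. exact (f_equal fst (HB z)). }
assert (Bu : forall z, en_u (B z) = d_smult (s_mult b b) (Pbeta beta (en_u z))).
{ intros z. exact (f_equal snd (HB z)). }
set (K := K1 + P * (K2 * P)).
assert (PK : 0 <= P * (K2 * P)) by (apply Rmult_le_pos; [lra|apply Rmult_le_pos; lra]).
exists B, (K + 1). split; [unfold K; lra|]. split; [exact HB|]. split; [|split].
- intros z w. apply (damps_unique (plus z w)); auto. unfold damps.
  change (en_h (plus (B z) (B w))) with (d_plus (en_h (B z)) (en_h (B w))).
  change (en_u (plus (B z) (B w))) with (d_plus (en_u (B z)) (en_u (B w))).
  change (en_h (plus z w)) with (d_plus (en_h z) (en_h w)).
  change (en_u (plus z w)) with (d_plus (en_u z) (en_u w)).
  unfold opD; cbn [fst snd]. now rewrite !Bh !Bu Pbeta_plus !d_smult_plus.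
- intros c z. apply (damps_unique (en_scal beta c z)); auto. unfold damps, opD.
  cbn [en_h en_u en_scal fst snd]. now rewrite !Bh !Bu Pbeta_scal !d_smult_scal.
- intros z. assert (N := enorm_nonneg beta z).
  assert (Hpi := PI_RGT_0).
  assert (Q : sumZ (density (B z)) <= K * sumZ (density z)).
  { destruct (H1 _ (xE z)) as [Eh Sh], (H2 _ (puE z)) as [Eu Su].
    assert (Sx : sumZ (density z) = sumZ (fun k => Cmod (coef (en_h z) k) ^ 2) + sumZ (fun k => Cmod (yc z k) ^ 2)).
    { rewrite -sumZ_plus //. }
    assert (Sy : sumZ (fun k => Cmod (coef (Pbeta beta (en_u z)) k) ^ 2) <= P * sumZ (fun k => Cmod (yc z k) ^ 2)).
    { rewrite -sumZ_scal. apply sumZ_le. apply pu. now apply ex_sumZ_scal. }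
    apply Rle_trans with (sumZ (fun k => Cmod (coef (d_smult (s_mult a a) (en_h z)) k) ^ 2 +
       P * Cmod (coef (d_smult (s_mult b b) (Pbeta beta (en_u z))) k) ^ 2)).
    { apply sumZ_le. 2: apply ex_sumZ_plus; auto; now apply ex_sumZ_scal.
      intros k. split. apply density_nonneg. rewrite densityE yc_sq xcE. rewrite Bh Bu.
      apply Rplus_le_compat_l, Rmult_le_compat_r. apply pow2_ge_0. apply HP. }
    rewrite sumZ_plus; [|auto|now apply ex_sumZ_scal]. rewrite sumZ_scal Sx.
    assert (X0 : 0 <= sumZ (fun k => Cmod (coef (en_h z) k) ^ 2)).
    { apply sumZ_nonneg; auto. intros; apply pow2_ge_0. }
    assert (Y0 : 0 <= sumZ (fun k => Cmod (yc z k) ^ 2)).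
    { apply sumZ_nonneg; auto. intros; apply pow2_ge_0. }
    set (X := sumZ (fun k => Cmod (coef (en_h z) k) ^ 2)) in *.
    set (Y := sumZ (fun k => Cmod (yc z k) ^ 2)) in *.
    assert (Su' : sumZ (fun k => Cmod (coef (d_smult (s_mult b b) (Pbeta beta (en_u z))) k) ^ 2) <= K2 * (P * Y)).
    { eapply Rle_trans. exact Su. apply Rmult_le_compat_l; auto. }
    assert (P * sumZ (fun k => Cmod (coef (d_smult (s_mult b b) (Pbeta beta (en_u z))) k) ^ 2)
        <= P * (K2 * (P * Y))) by (apply Rmult_le_compat_l; lra).
    replace (K * (X + Y)) with (K1 * X + P * (K2 * (P * Y)) + (K1 * Y + P * (K2 * P) * X)) by (unfold K; ring).
    assert (0 <= K1 * Y) by now apply Rmult_le_pos.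
    assert (0 <= P * (K2 * P) * X) by now apply Rmult_le_pos. lra. }
  assert (K0 : 0 <= K) by (unfold K; lra).
  assert (E1 := enorm_sq beta (B z)). assert (E2 := enorm_sq beta z).
  assert (E3 : enorm beta (B z) ^ 2 <= K * enorm beta z ^ 2).
  { rewrite E1 E2. replace (K * (2 * PI * sumZ (density z))) with (2 * PI * (K * sumZ (density z))) by ring.
    apply Rmult_le_compat_l; lra. }
  assert (0 <= enorm beta z ^ 2) by apply pow2_ge_0.
  apply Rnot_lt_le. intros C.
  assert (((K + 1) * enorm beta z) ^ 2 < enorm beta (B z) ^ 2).
  { assert (0 <= (K + 1) * enorm beta z) by (apply Rmult_le_pos; lra). nra. }
  assert (((K + 1) * enorm beta z) ^ 2 = K * enorm beta z ^ 2 + (K * K + K + 1) * enorm beta z ^ 2) by ring.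
  assert (0 <= (K * K + K + 1) * enorm beta z ^ 2) by (apply Rmult_le_pos; nra). lra.
Qed.

(** The damping moved to the left-hand side of [w = A z - D z]. *)
Lemma graphAd_skew (B : E -> E) z w : (forall z, damps z (B z)) ->
  (graphAd beta a b z w <-> skew beta z (plus w (B z))).
Proof.
intros HB.
assert (Eh : coef (en_h (B z)) = coef (fst (opD beta a b (en_h z, en_u z)))).
{ now rewrite -(HB z). }
assert (Eu : coef (en_u (B z)) = coef (snd (opD beta a b (en_h z, en_u z)))).
{ now rewrite -(HB z). }
assert (Sx : forall k, xc (plus w (B z)) k =
  (coef (en_h w) k + coef (fst (opD beta a b (en_h z, en_u z))) k)%C).
{ intros k. rewrite xc_plus -Eh. reflexivity. }
assert (Sy : forall k, yc (plus w (B z)) k =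
  (RtoC (sqrt (p k)) * (coef (en_u w) k + coef (snd (opD beta a b (en_h z, en_u z))) k))%C).
{ intros k. rewrite yc_plus -Eu !ycE. ring. }
assert (nz : forall k, RtoC (sqrt (p k)) <> RtoC 0).
{ intros k Q. apply RtoC_inj in Q. assert (T := sqrt_p_pos beta k). lra. }
unfold graphAd, opAd; cbv zeta. split.
- intros [_ G] k. destruct (coef_opA z k) as [A1 A2].
  assert (Gh := f_equal fst G). assert (Gu := f_equal snd G). cbn [fst snd] in Gh, Gu.
  rewrite Sx Sy Gh Gu -A1 -A2. unfold d_opp. rewrite !coef_plus !coef_scal. split; ring.
- intros G. split. exact (skew_domA _ _ G).
  apply injective_projections; apply coef_inj; intros k; destruct (G k) as [G1 G2];
  destruct (coef_opA z k) as [A1 A2]; cbn [fst snd]; unfold d_opp; rewrite coef_plus coef_scal.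
  + rewrite A1 -G1 Sx. ring.
  + rewrite -A2 Sy in G2.
    assert (Q : (coef (en_u w) k + coef (snd (opD beta a b (en_h z, en_u z))) k)%C =
      coef (snd (opA beta (en_h z, en_u z))) k).
    { transitivity (/ RtoC (sqrt (p k)) * (RtoC (sqrt (p k)) *
        (coef (en_u w) k + coef (snd (opD beta a b (en_h z, en_u z))) k)))%C.
      field. apply nz. rewrite G2. field. apply nz. }
    rewrite -Q. ring.
Qed.
End Operators.

(** * Well-posedness of the damped system *)

Lemma half_line_of_continuous {V : UniformSpace} (f : R -> V) : (forall t, continuous f t) ->
  forall t, filterlim f (half_line t) (locally (f t)).
Proof.
intros H t P HP. specialize (H t P HP). unfold filtermap, half_line, within in *.
revert H. apply filter_imp. auto.
Qed.

Theorem theorem2p8 (beta : posreal) (a b : smoothT)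
  (ha : forall x, 0 <= a x) (hb : forall x, 0 <= b x)
  (ha0 : exists x, a x <> 0) (hb0 : exists x, b x <> 0) :
  (forall Z : energy beta, domA beta Z -> exists W, graphAd beta a b Z W) /\
  exists Sd : R -> energy beta -> energy beta,
    C0_semigroup Sd /\
    generates (graphAd beta a b) Sd /\
    forall Z0 : energy beta,
      mild_solution (graphAd beta a b) Z0 (fun t => Sd t Z0) /\
      (forall Z : R -> energy beta, mild_solution (graphAd beta a b) Z0 Z ->
         forall t, 0 <= t -> Z t = Sd t Z0) /\
      (domA beta Z0 ->
         continuous_graph (graphAd beta a b) (fun t => Sd t Z0) /\
         (exists Z' : R -> energy beta, C1_half (fun t => Sd t Z0) Z') /\
         classical_solution (graphAd beta a b) Z0 (fun t => Sd t Z0) /\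
         (forall Z : R -> energy beta, classical_solution (graphAd beta a b) Z0 Z ->
            forall t, 0 <= t -> Z t = Sd t Z0)).
Proof.
destruct (undamped_group beta) as [U [HU [Uscal HUG]]].
destruct (damping_operator beta a b) as [B [C [C_pos [HB [Bplus [Bscal Bb]]]]]].
assert (Blin : is_linear (U := real_energy beta) (V := real_energy beta) B).
{ split.
  - exact Bplus.
  - intros r z. exact (Bscal (RtoC r) z).
  - exists C. split; [exact C_pos | exact Bb]. }
destruct (bounded_perturbation (Y := real_energy beta) U HU B Blin C C_pos Bb)
  as [S [phi [HS [HG HJ]]]].
assert (G_iff : forall z w, graphAd beta a b z w <-> generator (Y := real_energy beta) S z w).
{ intros z w. rewrite (graphAd_skew beta a b B z w HB). rewrite -HUG. symmetry. apply HG. }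
assert (dom_ex : forall z, domA beta z -> exists w, graphAd beta a b z w).
{ intros z Hz. destruct (domA_skew_ex beta z Hz) as [w Hw]. exists (minus w (B z)).
  apply (graphAd_skew beta a b B _ _ HB). now rewrite plus_minus_cancel. }
split; [exact dom_ex|].
exists S.
assert (Slin := sc_linear _ _ (group_sc _ _ HS)).
assert (Sc := orbit_continuous S phi HS).
(* commuting with multiplication by i makes the real-linear operators complex linear *)
assert (Sscal : forall t c z, S t (en_scal beta c z) = en_scal beta c (S t z)).
{ intros t c z.
  assert (J : forall z, S t (en_scal beta Ci z) = en_scal beta Ci (S t z)).
  { intros y. symmetry. apply (HJ (en_scal beta Ci)).
    - split.
      + intros u v. apply en_scal_plus.
      + intros r u. change (en_scal beta Ci (en_scal beta (RtoC r) u) =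
          en_scal beta (RtoC r) (en_scal beta Ci u)).
        rewrite !en_scal_assoc. f_equal. ring.
      + exists 1. split; [lra|]. intros u. right.
        change (enorm beta (en_scal beta Ci u) = 1 * enorm beta u). now rewrite enorm_scal Cmod_Ci.
    - intros s u. symmetry. apply Uscal.
    - intros u. symmetry. apply Bscal. }
  assert (D : forall y, en_scal beta c y =
    plus (en_scal beta (RtoC (Re c)) y) (en_scal beta Ci (en_scal beta (RtoC (Im c)) y))).
  { intros y. rewrite en_scal_assoc. change (en_scal beta c y =
      en_plus beta (en_scal beta (RtoC (Re c)) y) (en_scal beta (Ci * RtoC (Im c))%C y)).
    rewrite -en_scal_plus_l. f_equal. destruct c as [c1 c2].
    unfold Re, Im, Ci, RtoC, Cplus, Cmult; cbn [fst snd]. f_equal; ring. }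
  assert (R1 : forall r y, S t (en_scal beta (RtoC r) y) = en_scal beta (RtoC r) (S t y)).
  { intros r y. exact (linear_scal (S t) (Slin t) r y). }
  rewrite (D z) (D (S t z)).
  etransitivity. { exact (linear_plus (S t) (Slin t) _ _). }
  rewrite J !R1. reflexivity. }
split; [|split].
- split; [|split; [|split]].
  + intros t _. split.
    * exact (linear_plus (S t) (Slin t)).
    * intros c z. exact (Sscal t c z).
    * exact (linear_norm (S t) (Slin t)).
  + exact (group_zero _ _ HS).
  + intros s t z _ _. exact (group_add _ _ HS s t z).
  + intros z. assert (L := Sc z 0). unfold continuous in L. rewrite (group_zero _ _ HS) in L.
    exact (filterlim_filter_le_1 _ at_right_le_locally L).
- intros z w. exact (G_iff z w).
- intros Z0.
  assert (mild_iff : forall Z, mild_solution (graphAd beta a b) Z0 Z <->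
    abstract_mild (Y := real_energy beta) S Z0 Z).
  { intros Z. split; intros [Cz M]; split; auto; intros t Ht;
    destruct (M t Ht) as [I [AI [HI [HA HE]]]]; exists I, AI; (split; [exact HI|]);
    (split; [now apply G_iff | exact HE]). }
  assert (Smild := orbit_mild (Y := real_energy beta) S phi HS Z0).
  split; [|split].
  + now apply mild_iff.
  + intros Z HZ t Ht. apply mild_iff in HZ.
    exact (mild_unique (Y := real_energy beta) S phi HS Z0 Z _ HZ Smild t Ht).
  + intros Hd. destruct (dom_ex Z0 Hd) as [W HW]. apply G_iff in HW.
    assert (Gt : forall t, graphAd beta a b (S t Z0) (S t W)).
    { intros t. apply G_iff. apply (generator_invariant (Y := real_energy beta) S phi HS). exact HW. }
    assert (C1 : C1_half (fun t => S t Z0) (fun t => S t W)).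
    { split.
      - intros t _. exact (half_line_of_continuous (V := real_energy beta) (fun s => S s W) (Sc W) t).
      - intros t Ht. apply (is_derive_to_half (Y := real_energy beta) (fun s => S s Z0) t (S t W) Ht).
        exact (orbit_derivative (Y := real_energy beta) S phi HS Z0 W t HW). }
    split; [|split; [|split]].
    * exists (fun t => S t W). split; [auto|]. intros t Ht.
      rewrite -(Rplus_0_l 0).
      refine (filterlim_Rplus (half_line t) _ _ 0 0 _ _);
      apply (filterlim_minus_zero (Y := real_energy beta) (half_line t));
      apply (half_line_of_continuous (V := real_energy beta)); apply Sc.
    * now exists (fun t => S t W).
    * split. exact (group_zero _ _ HS Z0). exists (fun t => S t W). split; auto.
    * intros Z [HZ0 [Z' [[_ HZ'] HGZ]]] t Ht. rewrite -HZ0.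
      apply (classical_unique (Y := real_energy beta) S phi HS Z Z').
      -- exact HZ'.
      -- intros s Hs. now apply G_iff, HGZ.
      -- exact Ht.
Qed.
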